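(* Let $M\subset\mathbb{C}^n$ be a complex domain containing the origin, endowed with a radial Kähler potential $\Phi:M\to\mathbb{R}$, with associated function $f$, so that $\Phi(z)=f(|z|^2)$. Let $(M^*,\Phi^* )$ be the local dual of $(M,\Phi)$, and put $\omega=\frac{i}{2}\partial\bar\partial\Phi$ on $M$ and $\omega^*=\frac{i}{2}\partial\bar\partial\Phi^*$ on $M^*$. Assume that there are no non-empty open subset of $M$ and real number $c$ such that $\omega=c\,\omega_0$ on that subset. Let $\lambda>0$. (1) Let $\Psi:U\to U^*$ be a $\lambda$-symplectic duality between $\omega$ and $\omega^*$. Then there exist an open subset $V\subset U$ containing the origin, a radial function $g:V\to\mathbb{R}$ and a unitary $n\times n$ matrix $A\in U(n)$ such that $$\Psi(z)=e^{ig(z)}\,\psi(z)\,A(z),\qquad z\in V,$$ where $\psi:V\to\mathbb{R}$ is the radial and real analytic function on $V$ given by $$\psi(z)=\left(\lambda f'(x)\right)^{\frac12},\qquad x=|z|^2=|z_1|^2+\cdots+|z_n|^2 .$$ (2) Consequently, there exists a $\lambda$-symplectic duality between $\omega$ and $\omega^*$ if and only if $$\lambda^2 f'(x)\,f'\left(-\lambda x f'(x)\right)=1$$ for all $x$ in some open neighbourhood of the origin of $\mathbb{R}$.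
   Context: A complex domain is an open connected subset of $\mathbb{C}^n$. $\omega_0=\frac{i}{2}\sum_{j=1}^n dz_j\wedge d\bar z_j$ is the flat Kähler form and $|z|^2=\sum_j|z_j|^2$. A Kähler potential on a complex domain $M$ is a real analytic strictly plurisubharmonic function $\Phi:M\to\mathbb{R}$; then $\frac{i}{2}\partial\bar\partial\Phi$ is a Kähler form. A function is radial if it depends only on $|z|^2$. If $\Phi$ is radial, the associated function is $f:\hat M\to\mathbb{R}$, $\hat M=\{|z|^2:z\in M\}\subset[0,\infty)$, with $\Phi(z)=f(|z|^2)$; since $\Phi$ is real analytic, $f$ is given near $0$ by a convergent power series and so extends real analytically to an open neighbourhood of $0$ in $\mathbb{R}$; this extension is still denoted $f$. Local dual: expand $\Phi$ near the origin as a convergent power series in $z,\bar z$, and let $\Phi(z,-\bar z)$ denote the result of replacing $\bar z$ by $-\bar z$ in it. A local dual $(M^*,\Phi^* )$ of $(M,\Phi)$ consists of a complex domain $M^*\subset\mathbb{C}^n$ containing the origin such that $\Phi^*(z,\bar z)=-\Phi(z,-\bar z)$ is a real valued strictly plurisubharmonic function on $M^*$. For radial $\Phi$ a local dual exists and $\Phi^*(z)=-f(-|z|^2)$ near the origin. For $\lambda>0$, a $\lambda$-symplectic duality between $\omega$ and $\omega^*$ is a diffeomorphism $\Psi:U\to U^*$ between open neighbourhoods of the origin $U\subset M$, $U^*\subset M^*$ such that $\Psi^*\omega_0=\lambda\,\omega$ and $\Psi^*(\lambda\,\omega^* )=\omega_0$ on $U$. It is not assumed that $\Psi(0)=0$.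 In the radial setting all neighbourhoods of the origin involved may be taken to be open balls centered at the origin. $A(z)$ denotes the image of the vector $z$ under the linear map $A$. *)

(* Defs.v *)
From HB Require Import structures.
From mathcomp Require Import all_boot all_order all_algebra.
From mathcomp Require Import complex.
From mathcomp Require Import all_classical all_reals all_analysis.

Set Implicit Arguments.
Unset Strict Implicit.
Unset Printing Implicit Defensive.

Import Order.TTheory GRing.Theory Num.Theory.
Import numFieldNormedType.Exports.

Local Open Scope classical_set_scope.
Local Open Scope ring_scope.
Local Open Scope complex_scope.

(* C^n, as column vectors. The cast to numClosedFieldType is what gives C its
   topology: there is no topological structure on the bare type R[i]. *)
Notation Cvec R n := 'cV[(complex R : numClosedFieldType)]_n (only parsing).

Definition normsq (R : realType) (n : nat) (z : Cvec R n) : R :=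
  \sum_(j < n) (complex.Re (z j 0) ^+ 2 + complex.Im (z j 0) ^+ 2).

Definition conjv (R : realType) (n : nat) (z : Cvec R n) : Cvec R n :=
  map_mx (@conjc R) z.

Definition expi (R : realType) (t : R) : R[i] := cos t +i* sin t.

Definition complex_domain (R : realType) (n : nat) (U : set (Cvec R n)) : Prop :=
  open U /\ connected U.

Definition radial (R : realType) (n : nat) (T : Type)
    (U : set (Cvec R n)) (h : Cvec R n -> T) : Prop :=
  forall z w, U z -> U w -> normsq z = normsq w -> h z = h w.

Definition multi_index (n : nat) := {ffun 'I_n -> nat}.

Definition monomial (R : realType) (n : nat) (p : multi_index n)
    (z : Cvec R n) : R[i] :=
  \prod_(j < n) (z j 0 : R[i]) ^+ p j.

Definition series_term (R : realType) (n : nat)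
    (a : multi_index n -> multi_index n -> R[i]) (z w : Cvec R n)
    (p q : multi_index n) : R[i] :=
  a p q * monomial p z * monomial q w.

Definition series_box (R : realType) (n : nat)
    (a : multi_index n -> multi_index n -> R[i]) (z w : Cvec R n)
    (N : nat) : R[i] :=
  \sum_(p : {ffun 'I_n -> 'I_N}) \sum_(q : {ffun 'I_n -> 'I_N})
    series_term a z w [ffun j => p j : nat] [ffun j => q j : nat].

(* sum_(p, q) a_(p, q) z^p w^q converges absolutely, with sum s. The second
   argument w stands for the variable "z bar", so that replacing z bar by
   - z bar amounts to taking w := - conjv z instead of w := conjv z. *)
Definition has_sum (R : realType) (n : nat)
    (a : multi_index n -> multi_index n -> R[i]) (z w : Cvec R n)
    (s : R[i]) : Prop :=
  summable [set: multi_index n * multi_index n]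
    (fun pq => (complex.Re `|series_term a z w pq.1 pq.2|)%:E) /\
  (series_box a z w : nat -> R[i]^o) @ \oo --> (s : R[i]^o).

(* Local expansions in the real coordinates are written in z and z bar. *)
Definition real_analytic (R : realType) (n : nat) (U : set (Cvec R n))
    (h : Cvec R n -> R) : Prop :=
  forall z0, U z0 ->
    exists a : multi_index n -> multi_index n -> R[i],
      \forall z \near z0, has_sum a (z - z0) (conjv (z - z0)) (h z)%:C.

Definition analytic_near0 (R : realType) (f : R -> R) : Prop :=
  exists c : nat -> R,
    \forall x \near (0 : R), series (fun k => c k * x ^+ k) @ \oo --> f x.

Definition dird (R : realType) (n : nat) (h : Cvec R n -> R)
    (v z : Cvec R n) : R :=
  derive1 (fun t : R => h (z + t%:C *: v)) 0.

Definition cdird (R : realType) (n : nat) (F : Cvec R n -> R[i])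
    (v z : Cvec R n) : R[i] :=
  dird (fun x => complex.Re (F x)) v z +i* dird (fun x => complex.Im (F x)) v z.

Definition basis_vec (R : realType) (n : nat) (j : 'I_n) : Cvec R n :=
  delta_mx j 0.

(* d/dz_j = (d/dx_j - i d/dy_j) / 2 *)
Definition d_z (R : realType) (n : nat) (j : 'I_n) (F : Cvec R n -> R[i])
    (z : Cvec R n) : R[i] :=
  (cdird F (basis_vec R j) z - 'i * cdird F ('i *: basis_vec R j) z) / 2.

Definition d_zbar (R : realType) (n : nat) (j : 'I_n) (F : Cvec R n -> R[i])
    (z : Cvec R n) : R[i] :=
  (cdird F (basis_vec R j) z + 'i * cdird F ('i *: basis_vec R j) z) / 2.

Definition complex_hessian (R : realType) (n : nat) (Phi : Cvec R n -> R)
    (z : Cvec R n) (j k : 'I_n) : R[i] :=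
  d_z j (d_zbar k (fun x => (Phi x)%:C)) z.

(* In R[i], 0 < s means that s is real and positive. *)
Definition strictly_psh (R : realType) (n : nat) (U : set (Cvec R n))
    (Phi : Cvec R n -> R) : Prop :=
  forall z, U z -> forall v : Cvec R n, v != 0 ->
    0 < \sum_(j < n) \sum_(k < n)
          complex_hessian Phi z j k * v j 0 * (v k 0)^*.

Definition kahler_potential (R : realType) (n : nat) (U : set (Cvec R n))
    (Phi : Cvec R n -> R) : Prop :=
  real_analytic U Phi /\ strictly_psh U Phi.

(* f is the associated function of the radial function Phi on U, together
   with its analytic extension across 0. *)
Definition associated_function (R : realType) (n : nat) (U : set (Cvec R n))
    (Phi : Cvec R n -> R) (f : R -> R) : Prop :=
  (forall z, U z -> Phi z = f (normsq z)) /\ analytic_near0 f.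

(* Base point, then two tangent vectors. *)
Definition form2 (R : realType) (n : nat) :=
  Cvec R n -> Cvec R n -> Cvec R n -> R[i].

(* (dz_j /\ d zbar_k)(u, v) *)
Definition dz_dzbar (R : realType) (n : nat) (j k : 'I_n)
    (u v : Cvec R n) : R[i] :=
  u j 0 * (v k 0)^* - v j 0 * (u k 0)^*.

Definition flat_form (R : realType) (n : nat) : form2 R n :=
  fun _ u v => 'i / 2 * \sum_(j < n) dz_dzbar j j u v.

Definition kahler_form (R : realType) (n : nat) (Phi : Cvec R n -> R) :
    form2 R n :=
  fun z u v => 'i / 2 * \sum_(j < n) \sum_(k < n)
    complex_hessian Phi z j k * dz_dzbar j k u v.

Definition scale_form (R : realType) (n : nat) (c : R) (alpha : form2 R n) :
    form2 R n :=
  fun z u v => c%:C * alpha z u v.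

Definition eq_form_on (R : realType) (n : nat) (U : set (Cvec R n))
    (alpha beta : form2 R n) : Prop :=
  forall z, U z -> forall u v, alpha z u v = beta z u v.

Definition tangent_map (R : realType) (n : nat) (Psi : Cvec R n -> Cvec R n)
    (z v : Cvec R n) : Cvec R n :=
  \col_(j < n) cdird (fun x => Psi x j 0) v z.

Definition pullback (R : realType) (n : nat) (Psi : Cvec R n -> Cvec R n)
    (alpha : form2 R n) : form2 R n :=
  fun z u v => alpha (Psi z) (tangent_map Psi z u) (tangent_map Psi z v).

(* C^k on the open set U: the iterated directional derivatives of order at
   most k exist and are continuous on U. *)
Fixpoint Ck_on (R : realType) (n : nat) (k : nat) (U : set (Cvec R n))
    (h : Cvec R n -> R) : Prop :=
  (forall z, U z -> {for z, continuous h}) /\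
  if k is k'.+1 then
    forall v : Cvec R n,
      (forall z, U z -> derivable (fun t : R => h (z + t%:C *: v)) 0 1) /\
      Ck_on k' U (dird h v)
  else True.

Definition smooth_map (R : realType) (n : nat) (U : set (Cvec R n))
    (Psi : Cvec R n -> Cvec R n) : Prop :=
  forall (k : nat) (j : 'I_n),
    Ck_on k U (fun z => complex.Re (Psi z j 0)) /\
    Ck_on k U (fun z => complex.Im (Psi z j 0)).

Definition diffeomorphism (R : realType) (n : nat) (U U' : set (Cvec R n))
    (Psi : Cvec R n -> Cvec R n) : Prop :=
  [/\ set_bij U U' Psi, smooth_map U Psi &
      exists Theta : Cvec R n -> Cvec R n,
        smooth_map U' Theta /\ {in U, cancel Psi Theta}].

(* Phi' z = - Phi(z, - zbar): near the origin this is read off the expansion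
   of Phi; on the rest of the connected set M' the function Phi' is
   determined by real analyticity, so M' need not lie inside the domain of
   convergence of the series. *)
Definition local_dual (R : realType) (n : nat) (Phi : Cvec R n -> R)
    (M' : set (Cvec R n)) (Phi' : Cvec R n -> R) : Prop :=
  [/\ complex_domain M', M' 0, kahler_potential M' Phi' &
      exists a : multi_index n -> multi_index n -> R[i],
        \forall z \near (0 : Cvec R n),
          has_sum a z (conjv z) (Phi z)%:C /\
          has_sum a z (- conjv z) (- Phi' z)%:C].

Definition symplectic_duality (R : realType) (n : nat) (lambda : R)
    (M : set (Cvec R n)) (omega : form2 R n)
    (M' : set (Cvec R n)) (omega' : form2 R n)
    (U U' : set (Cvec R n)) (Psi : Cvec R n -> Cvec R n) : Prop :=
  [/\ [/\ open U, U 0 & U `<=` M],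
      [/\ open U', U' 0 & U' `<=` M'],
      diffeomorphism U U' Psi,
      eq_form_on U (pullback Psi (@flat_form R n)) (scale_form lambda omega) &
      eq_form_on U (pullback Psi (scale_form lambda omega')) (@flat_form R n)].

(* Main.v *)
Require Import Defs.
From HB Require Import structures.
From mathcomp Require Import all_boot all_order all_algebra.
From mathcomp Require Import complex.
From mathcomp Require Import ring lra.
From mathcomp Require Import all_classical all_reals all_analysis.
Import Order.TTheory GRing.Theory Num.Theory.
Import numFieldNormedType.Exports.
Local Open Scope classical_set_scope.
Local Open Scope ring_scope.
Local Open Scope complex_scope.

(** Write x = |z|^2, e(x) = f'(x) + x f''(x), w = Psi z, y = |w|^2 and D for the differential of Psi
at z. Since Phi is radial, omega at z is - Im <P u, v> with P u = f'(x) u + f''(x) <u, z> z, and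
near 0 the form omega^* comes in the same way from y |-> - f(- y), because replacing zbar by -
zbar turns x into - x ([dual_radial]). The two form equations read Im <D u, D v> = lambda Im <P
u, v> and lambda Im <P^* D u, D v> = Im <u, v>; together they give lambda^2 P^* D P = D
([duality_conj]), so lambda^2 P^* is conjugate to P^-1.

Taking traces, n f'(- y) - y f''(- y) is a function of x ([duality_trace]). It determines y for
small y, because f is not affine when omega is nowhere a multiple of omega_0
([positivity_radius]); hence y depends on x only. The same argument, applied to the preimage of
0 and to its rotations, shows Psi 0 = 0 ([preimage_zero]).

Consequently D preserves tangency to spheres, which forces D (i z) = mu i w with mu a function
of x. Then e^(- i mu t) Psi (e^(it) z) is constant in t, so mu is an integer; it tends to 1 at
the origin, where D is complex linear, so mu = 1 nearby ([mu_eq1]). Integration along rays gives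
y = lambda x f'(x) ([y_formula]). Comparing eigenvectors in lambda^2 P^* D P = D gives lambda^2
e(x) (f'(- y) - y f''(- y)) = 1 ([e_dual]), and, as f'' vanishes at most at 0, that D maps the
complex line of z to that of w and the orthogonal complements to one another ([D_radial],
[D_orth]). The first of these makes the complex line of Psi (t z) independent of t, so that Psi
z = q(z) A z with A the differential at 0 divided by sqrt(lambda f'(0)), a unitary matrix; the
second makes q constant along great circles, hence radial. As |q|^2 = lambda f'(x), this is
assertion (1).

For (2), [e_dual] says that the derivative in x of y f'(- y) is 1 / lambda, which integrates to
the functional equation for x >= 0; the map x |-> - lambda x f'(x) is then an involution and
carries the equation to x < 0 ([relation_near]). Conversely, if the equation holds, z |->
sqrt(lambda f'(x)) z is a duality, its inverse being w |-> sqrt(lambda f'(- y)) w: the form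
equations reduce to the functional equation and its derivative ([duality_converse]). *)

Set Implicit Arguments.
Unset Strict Implicit.
Unset Printing Implicit Defensive.

(** * Topology and differential calculus in the squared norm *)

(** The topology of C^n is generated by the sup norm of the entries, which is comparable with
    the square root of [normsq]; with this, all topological arguments can be made in terms of
    [normsq]. *)
Lemma nbhs_normsqP (R : realType) (n : nat) (z : Cvec R n) (P : set (Cvec R n)) :
  nbhs z P <-> exists2 e : R, 0 < e & forall w, normsq (w - z) < e -> P w.
Proof.
have entry (w : Cvec R n) j : (complex.Re (w j 0) ^+ 2 + complex.Im (w j 0) ^+ 2) <= normsq w.
  rewrite /normsq (bigD1 j) //= lerDl sumr_ge0 // => i _.
  by rewrite addr_ge0 ?sqr_ge0.
split.
  move/nbhs_ballP => [[e f]]; rewrite /= ltcE /= => /andP[/eqP -> e0] He.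
  exists (e ^+ 2); first by rewrite exprn_gt0.
  move=> w we; apply: He; split; first by rewrite ltcE /= eqxx.
  move=> i j; rewrite /ball /= (ord1 j) distrC.
  have := le_lt_trans (entry (w - z) i) we.
  rewrite !mxE normc_def => H; rewrite ltcE /= eqxx /=.
  by rewrite -(ltr_pXn2r (n:=2)) ?nnegrE ?sqrtr_ge0 ?ltW // sqr_sqrtr ?addr_ge0 ?sqr_ge0.
move=> [e e0 He]; apply/nbhs_ballP.
have e1 : 0 < Num.sqrt (e / n.+1%:R) by rewrite sqrtr_gt0 divr_gt0.
exists ((Num.sqrt (e / n.+1%:R))%:C); first by rewrite /= ltcE /= eqxx.
move=> w [_ zw]; apply: He.
have Hj j : complex.Re ((w - z) j 0) ^+ 2 + complex.Im ((w - z) j 0) ^+ 2 <= e / n.+1%:R.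
  have := zw j 0; rewrite /ball /= distrC normc_def ltcE /= eqxx /= !mxE => H.
  by apply: ltW; rewrite -ltr_sqrt // divr_gt0.
apply: (@le_lt_trans _ _ (\sum_(j < n) (e / n.+1%:R))).
  by apply: ler_sum => j _; exact: Hj.
rewrite sumr_const card_ord -[ltLHS]mulr_natr mulrAC ltr_pdivrMr // ltr_pM2l //.
by rewrite ltr_nat.
Qed.

(** A form of the derivative suited to estimates in which several increments are mixed. *)
Lemma is_derive1P (R : realType) (f : R -> R) (x d : R) :
  is_derive x 1 f d <->
  forall e, 0 < e -> exists2 r, 0 < r &
    forall t, `|t| < r -> `|f (x + t) - f x - d * t| <= e * `|t|.
Proof.
split.
  move=> [df <-] e e0.
  move/cvgrPdist_le : (df) => /(_ e e0) /nbhs_ballP [r /= r0 Hr].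
  exists r => // t tr; have [->|t0] := eqVneq t 0.
    by rewrite addr0 subrr mulr0 subr0 normr0 mulr0.
  have := Hr t; rewrite /= -ball_normE /= sub0r normrN => /(_ tr t0).
  rewrite -[X in _ - X]/(t^-1 * (f (t * 1 + x) - f x)) mulr1 (addrC t) => H.
  rewrite -ler_pdivrMr ?normr_gt0 // -normf_div mulrBl (mulfK t0) distrC.
  by rewrite (mulrC (_ - f x)).
move=> H.
have dl : h^-1 *: ((f \o shift x) (h *: (1 : R)) - f x) @[h --> 0^'] --> d.
  apply/cvgrPdist_le => e e0; have [r r0 Hr] := H e e0.
  apply/nbhs_ballP; exists r => //= t; rewrite -ball_normE /= sub0r normrN => tr t0.
  rewrite -[X in _ - X]/(t^-1 * (f (t * 1 + x) - f x)) mulr1 (addrC t).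
  rewrite distrC -(ler_pM2r (x := `|t|)) ?normr_gt0 // -normrM mulrBl.
  by rewrite mulrAC mulVf // mul1r Hr.
by split; [apply/cvg_ex; exists d | exact: cvg_lim].
Qed.

Section der.
Variable R : realType.
Implicit Types (f g df : R -> R) (x a b c d r t : R).

Lemma der_near f g x d : (\forall t \near x, f t = g t) ->
  is_derive x 1 f d -> is_derive x 1 g d.
Proof.
move=> /nbhs_ballP [s /= s0 Hs] /is_derive1P H; apply/is_derive1P => e /H [r r0 Hr].
exists (Num.min r s); first by rewrite lt_min r0 s0.
move=> t; rewrite lt_min => /andP[tr ts].
have <- : f (x + t) = g (x + t).
  by apply: Hs; rewrite -ball_normE /= opprD addNKr normrN.
have <- : f x = g x by apply: Hs; exact: ballxx.
exact: Hr.
Qed.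

Lemma der_eq f g x d d' : (forall t, f t = g t) -> d = d' ->
  is_derive x 1 f d -> is_derive x 1 g d'.
Proof. by move=> fg <-; apply: der_near; near=> t; exact: fg. Unshelve. all: end_near. Qed.

Lemma der_cst x c : is_derive x 1 (fun _ : R => c) (0 : R).
Proof. exact: is_derive_cst. Qed.

Lemma der_id x : is_derive x 1 (fun t : R => t) (1 : R).
Proof. exact: is_derive_id. Qed.

Lemma derD f g x a b : is_derive x 1 f a -> is_derive x 1 g b ->
  is_derive x 1 (fun t => f t + g t) (a + b).
Proof. by move=> fa gb; exact: is_deriveD. Qed.

Lemma derN f x a : is_derive x 1 f a -> is_derive x 1 (fun t => - f t) (- a).
Proof. by move=> fa; exact: is_deriveN. Qed.

Lemma derB f g x a b : is_derive x 1 f a -> is_derive x 1 g b ->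
  is_derive x 1 (fun t => f t - g t) (a - b).
Proof. by move=> fa gb; exact: is_deriveB. Qed.

Lemma derM f g x a b : is_derive x 1 f a -> is_derive x 1 g b ->
  is_derive x 1 (fun t => f t * g t) (a * g x + f x * b).
Proof.
move=> fa gb; have := is_deriveM fa gb; apply: der_eq => //.
by rewrite addrC /GRing.scale /= mulrC.
Qed.

Lemma derZ f x c a : is_derive x 1 f a -> is_derive x 1 (fun t => c * f t) (c * a).
Proof. by move=> fa; apply: der_eq (derM (der_cst x c) fa) => //; rewrite mul0r add0r. Qed.

Lemma derV (h : R -> R) (t d : R) : is_derive t 1 h d -> h t != 0 ->
  is_derive t 1 (fun s => (h s)^-1) (- (h t) ^- 2 * d).
Proof. by move=> hd h0; have := is_deriveV h0 hd; apply: der_eq. Qed.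

Lemma der_comp f g x a b : is_derive (g x) 1 f a -> is_derive x 1 g b ->
  is_derive x 1 (fun t => f (g t)) (a * b).
Proof. by move=> fa gb; exact: is_derive1_comp. Qed.

Lemma der_sum (I : Type) (r : seq I) (h : I -> R -> R) (dh : I -> R) x :
  (forall i, is_derive x 1 (h i) (dh i)) ->
  is_derive x 1 (fun t => \sum_(i <- r) h i t) (\sum_(i <- r) dh i).
Proof.
move=> H; elim: r => [|i r IH].
  by apply: der_eq (der_cst x 0) => [t|]; rewrite big_nil.
by apply: der_eq (derD (H i) IH) => [t|]; rewrite big_cons.
Qed.

Lemma der_cont f x d : is_derive x 1 f d -> {for x, continuous f}.
Proof. by move=> [fx _]; exact/differentiable_continuous/derivable1_diffP. Qed.

Lemma der_uniq f x a b : is_derive x 1 f a -> is_derive x 1 f b -> a = b.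
Proof. by move=> [_ <-] [_ <-]. Qed.

Lemma der_derive1 f x d : is_derive x 1 f d -> derive1 f x = d.
Proof. by move=> [_ <-]; rewrite derive1E. Qed.

Lemma derivable_der f x : derivable f x 1 -> is_derive x 1 f (derive1 f x).
Proof. by move=> fx; rewrite derive1E; exact: derivableP. Qed.

Lemma continuousP_dist f x : {for x, continuous f} <->
  forall e, 0 < e -> exists2 r, 0 < r & forall t, `|t - x| < r -> `|f t - f x| < e.
Proof.
split.
  move/cvgrPdist_lt => H e /H /nbhs_ballP [r /= r0 Hr]; exists r => // t tr.
  by rewrite distrC; apply: Hr; rewrite -ball_normE /= distrC.
move=> H; apply/cvgrPdist_lt => e /H [r r0 Hr]; apply/nbhs_ballP; exists r => //= t.
by rewrite /ball /= distrC => /Hr; rewrite distrC.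
Qed.

Lemma MVTle f df a b : a <= b -> (forall t, a <= t <= b -> is_derive t 1 f (df t)) ->
  exists2 c, a <= c <= b & f b - f a = df c * (b - a).
Proof.
move=> ab H.
have H1 : forall x : R, x \in `]a, b[ -> is_derive x 1 f (df x).
  by move=> t; rewrite in_itv /= => /andP[at_ tb]; apply: H; rewrite !ltW.
have H2 : {within `[a, b], continuous f}.
  apply: continuous_in_subspaceT => t /set_mem; rewrite /= in_itv /= => tb.
  by apply: der_cont; apply: H.
have [c] := MVT_segment ab H1 H2.
by rewrite in_itv /= => ? ?; exists c.
Qed.

Lemma cst_of_der0 (f : R -> R) (a b : R) : a <= b ->
  (forall t, a <= t <= b -> is_derive t 1 f (0 : R)) -> f a = f b.
Proof.
by move=> ab H; have [c _ E] := MVTle (df := fun=> 0) ab H; apply/esym/eqP; rewrite -subr_eq0 E mul0r.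
Qed.

End der.

Section curves.
Variables (R : realType) (n : nat).
Implicit Types (z u v w : Cvec R n) (U : set (Cvec R n)) (h : Cvec R n -> R).

Lemma normsq_ge0 z : 0 <= normsq z.
Proof. by apply: sumr_ge0 => j _; rewrite addr_ge0 ?sqr_ge0. Qed.

Lemma normsqZ (c : R) z : normsq (c%:C *: z) = c ^+ 2 * normsq z.
Proof.
rewrite /normsq mulr_sumr; apply: eq_bigr => j _; rewrite mxE.
by case: (z j 0) => a b; simpc => /=; ring.
Qed.

Lemma normsqN z : normsq (- z) = normsq z.
Proof.
rewrite /normsq; apply: eq_bigr => j _; rewrite mxE.
by case: (z j 0) => a b; simpc => /=; ring.
Qed.

Lemma normsq0 : normsq (0 : Cvec R n) = 0.
Proof. by rewrite /normsq big1 // => j _; rewrite mxE /= expr0n addr0. Qed.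

Lemma normsqD_le u v : normsq (u + v) <= 2 * normsq u + 2 * normsq v.
Proof.
rewrite /normsq !mulr_sumr -big_split /=; apply: ler_sum => j _; rewrite mxE.
case: (u j 0) (v j 0) => a b [c d]; simpc => /=.
have := sqr_ge0 (a - c); have := sqr_ge0 (b - d); rewrite !expr2; lra.
Qed.

Lemma normsq_eq0 z : (normsq z == 0) = (z == 0).
Proof.
apply/eqP/eqP => [|->]; last exact: normsq0.
move/eqP; rewrite psumr_eq0 => [/allP H|j _]; last by rewrite addr_ge0 ?sqr_ge0.
apply/matrixP => j k; rewrite (ord1 k) mxE.
have /= := H j (mem_index_enum _); rewrite paddr_eq0 ?sqr_ge0 // !sqrf_eq0.
by case: (z j 0) => a b /= /andP[/eqP -> /eqP ->].
Qed.

Lemma continuous_normsqP h z : {for z, continuous h} <->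
  forall e, 0 < e -> exists2 d, 0 < d &
    forall w, normsq (w - z) < d -> `|h w - h z| < e.
Proof.
split.
  move=> H e e0; have He : nbhs (h z) [set y | `|y - h z| < e].
    by apply/nbhs_ballP; exists e => // y; rewrite /ball /= distrC.
  by have /nbhs_normsqP[d d0 Hd] := H _ He; exists d.
move=> H P /nbhs_ballP[e /= /H [d d0 Hd] HP]; apply/nbhs_normsqP; exists d => // w /Hd wz.
by apply: HP; rewrite /ball /= distrC.
Qed.

Lemma openP U : open U <->
  forall z, U z -> exists2 d, 0 < d & forall w, normsq (w - z) < d -> U w.
Proof.
rewrite openE; split=> H z /H; first by move/nbhs_normsqP.
by move=> ?; apply/nbhs_normsqP.
Qed.

Lemma der_line U h v z (t : R) : Ck_on 1 U h -> U (z + t%:C *: v) ->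
  is_derive t 1 (fun s : R => h (z + s%:C *: v)) (dird h v (z + t%:C *: v)).
Proof.
move=> [_ /(_ v) [dh _]] Uz.
have H := derivable_der (dh _ Uz).
have H0 : is_derive (t - t) 1 (fun s : R => h (z + t%:C *: v + s%:C *: v))
    (dird h v (z + t%:C *: v)) by rewrite subrr.
have H1 := derB (der_id t) (der_cst t t).
apply: der_eq (der_comp (g := fun s => s - t) H0 H1) => [s|].
  by rewrite -addrA -scalerDl -rmorphD /= [t + _]addrC subrK.
by rewrite subr0 mulr1.
Qed.

(** The increment of h is split into one along u, where the one-variable chain rule applies, and
    one along v, which the mean value theorem and the continuity of the derivative along v
    control. *)
Lemma der_curve2 U h z u v (a b : R -> R) (da db : R) :
  open U -> U z -> Ck_on 1 U h ->
  is_derive (0:R) (1:R) a da -> a 0 = 0 -> is_derive (0:R) (1:R) b db -> b 0 = 0 ->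
  is_derive (0:R) (1:R) (fun t => h (z + (a t)%:C *: u + (b t)%:C *: v))
    (da * dird h u z + db * dird h v z).
Proof.
move=> oU Uz hC Da a0 Db b0.
have [d1 d1_gt0 Hd1] := (openP U).1 oU _ Uz.
have H1 : is_derive (0:R) (1:R) (fun t => h (z + (a t)%:C *: u)) (dird h u z * da).
  have := @der_line U h u z (a 0) hC; rewrite a0 scale0r addr0 => /(_ Uz) H.
  have H' : is_derive (a 0) 1 (fun s : R => h (z + s%:C *: u)) (dird h u z).
    by rewrite a0.
  exact: (der_comp (g := a) H' Da).
suff H2 : is_derive (0:R) (1:R) (fun t => h (z + (a t)%:C *: u + (b t)%:C *: v)
    - h (z + (a t)%:C *: u)) (db * dird h v z).
  by apply: der_eq (derD H1 H2) => [t|]; [rewrite addrC subrK | rewrite mulrC].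
have hC' := hC; case: hC' => _ /(_ v) [_ [/(_ _ Uz) /continuous_normsqP cv _]].
set m := dird h v z in cv *.
have small (s : R -> R) (ds : R) (x : Cvec R n) (e : R) : is_derive (0:R) (1:R) s ds -> s 0 = 0 -> 0 < e ->
    exists2 r, 0 < r & forall t c, `|t| < r -> `|c| <= `|s t| -> normsq (c%:C *: x) < e.
  move=> Ds s0 e0; have /continuousP_dist := der_cont Ds.
  rewrite s0 => /(_ (Num.sqrt (e / (normsq x + 1)))) [].
    by rewrite sqrtr_gt0 divr_gt0 // ltr_wpDl ?normsq_ge0.
  move=> r r0 Hr; exists r => // t c tr cs; have := Hr t; rewrite !subr0 => /(_ tr) H.
  have : `|c| < Num.sqrt (e / (normsq x + 1)) by apply: le_lt_trans H.
  rewrite -(ltr_pXn2r (n := 2)) ?nnegrE ?sqrtr_ge0 // sqr_sqrtr; last first.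
    by rewrite divr_ge0 ?ltW // ltr_wpDl ?normsq_ge0.
  rewrite normsqZ real_normK ?num_real // ltr_pdivlMr ?ltr_wpDl ?normsq_ge0 //.
  by apply: le_lt_trans; rewrite ler_wpM2l ?sqr_ge0 // lerDl.
apply/is_derive1P => e e0.
pose K : R := `|db| + 1; have K0 : 0 < K by rewrite ltr_wpDl.
have [d2 d2_gt0 Hd2] := cv (e / 2 / K) (divr_gt0 (divr_gt0 e0 (ltr0Sn _ 1)) K0).
have M0 : 0 < `|m| + 1 by rewrite ltr_wpDl.
pose d : R := Num.min d1 d2; have d_gt0 : 0 < d by rewrite lt_min d1_gt0.
have dq : 0 < d / 4 by rewrite divr_gt0.
have [r1 r1_gt0 Hr1] := small _ _ u _ Da a0 dq.
have [r2 r2_gt0 Hr2] := small _ _ v _ Db b0 dq.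
move/is_derive1P: (Db) => Hb.
have [r3 r3_gt0 Hr3] := Hb (e / 2 / (`|m| + 1)) (divr_gt0 (divr_gt0 e0 (ltr0Sn _ 1)) M0).
have [r4 r4_gt0 Hr4] := Hb 1 ltr01.
exists (Num.min (Num.min r1 r2) (Num.min r3 r4)).
  by rewrite !lt_min r1_gt0 r2_gt0 r3_gt0.
move=> t; rewrite !lt_min => /andP[/andP[t1 t2] /andP[t3 t4]].
have near (c : R) : `|c| <= `|b t| -> normsq (z + (a t)%:C *: u + c%:C *: v - z) < d.
  move=> cb; rewrite addrAC [z + _]addrC addrK.
  have := Hr1 t _ t1 (lexx _); have := Hr2 t c t2 cb.
  have := normsqD_le ((a t)%:C *: u) (c%:C *: v); lra.
have [c cb E] : exists2 c, `|c| <= `|b t| & h (z + (a t)%:C *: u + (b t)%:C *: v)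
    - h (z + (a t)%:C *: u) = dird h v (z + (a t)%:C *: u + c%:C *: v) * b t.
  have [->|bt0] := eqVneq (b t) 0.
    by exists 0; rewrite // scale0r addr0 subrr mulr0.
  pose F (s : R) : R := h (z + (a t)%:C *: u + s%:C *: v).
  pose dF (s : R) : R := dird h v (z + (a t)%:C *: u + s%:C *: v).
  have Lip (s : R) : `|s| <= `|b t| -> is_derive s 1 F (dF s).
    move=> sb; apply: der_line hC _; apply: Hd1.
    by apply: lt_le_trans (near _ sb) _; rewrite ge_min lexx.
  have [c cb E] : exists2 c, `|c| <= `|b t| & F (b t) - F 0 = dF c * b t.
    have [b_lt|b_gt|/eqP] := ltgtP (b t) 0; last by rewrite (negbTE bt0).
    - have [|c /andP[bc c0] E] := @MVTle _ F dF (b t) 0 (ltW b_lt).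
        by move=> s /andP[bs s0]; apply: Lip; rewrite !ler0_norm ?(ltW b_lt) // lerN2.
      exists c; first by rewrite !ler0_norm ?(ltW b_lt) // lerN2.
      by apply: oppr_inj; rewrite opprB E; ring.
    - have [|c /andP[bc c0] E] := @MVTle _ F dF 0 (b t) (ltW b_gt).
        by move=> s /andP[bs s0]; apply: Lip; rewrite !ger0_norm ?(ltW b_gt).
      exists c; first by rewrite !ger0_norm ?(ltW b_gt).
      by rewrite E; ring.
  by exists c => //; move: E; rewrite /F scale0r addr0.
rewrite add0r E b0 a0 !scale0r !addr0 subrr subr0.
set p := z + _ + _.
have pm : `|dird h v p - m| < e / 2 / K.
  by apply: Hd2; apply: lt_le_trans (near _ cb) _; rewrite ge_min lexx orbT.
have bK : `|b t| <= K * `|t|.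
  have := Hr4 t t4; rewrite add0r b0 subr0 mul1r => H.
  rewrite -(subrK (db * t) (b t)); apply: le_trans (ler_normD _ _) _.
  by rewrite normrM /K mulrDl mul1r addrC lerD2l.
have := Hr3 t t3; rewrite add0r b0 subr0 => b3.
have -> : dird h v p * b t - db * m * t = (dird h v p - m) * b t + m * (b t - db * t) by ring.
apply: le_trans (ler_normD _ _) _; rewrite !normrM.
have -> : e * `|t| = (e / 2 / K) * (K * `|t|) + (e / 2 * `|t|).
  by field; rewrite gt_eqF.
apply: lerD; first by apply: ler_pM => //; exact: ltW.
apply: (@le_trans _ _ (`|m| * (e / 2 / (`|m| + 1) * `|t|))); first exact: ler_wpM2l.
rewrite mulrA ler_wpM2r // mulrCA ler_piMr ?divr_ge0 ?ltW //.
by rewrite ltr_pdivrMr // mul1r ltrDl.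
Qed.

End curves.

(** * The Hermitian product and directional derivatives *)

Section Re_Im.
Variable R : realType.

Lemma ReD (c d : R[i]) : complex.Re (c + d) = complex.Re c + complex.Re d.
Proof. by case: c d => a b [p q]. Qed.

Lemma ImD (c d : R[i]) : complex.Im (c + d) = complex.Im c + complex.Im d.
Proof. by case: c d => a b [p q]. Qed.

Lemma ReM (c d : R[i]) : complex.Re (c * d) = complex.Re c * complex.Re d - complex.Im c * complex.Im d.
Proof. by case: c d => a b [p q]. Qed.

Lemma ImM (c d : R[i]) : complex.Im (c * d) = complex.Re c * complex.Im d + complex.Im c * complex.Re d.
Proof. by case: c d => a b [p q]. Qed.

Lemma ImZr (r : R) (c : R[i]) : complex.Im (r%:C * c) = r * complex.Im c.
Proof. by case: c => p q; simpc. Qed.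

Lemma ReZr (r : R) (c : R[i]) : complex.Re (r%:C * c) = r * complex.Re c.
Proof. by case: c => p q; simpc. Qed.

Lemma ReN (c : R[i]) : complex.Re (- c) = - complex.Re c.
Proof. by case: c. Qed.

Lemma ImN (c : R[i]) : complex.Im (- c) = - complex.Im c.
Proof. by case: c. Qed.

Lemma ReJ (c : R[i]) : complex.Re (conjc c) = complex.Re c.
Proof. by case: c. Qed.

Lemma ImJ (c : R[i]) : complex.Im (conjc c) = - complex.Im c.
Proof. by case: c. Qed.

Lemma Re_iM (c : R[i]) : complex.Re ('i * c) = - complex.Im c.
Proof. by case: c => p q; simpc. Qed.

Lemma Im_iM (c : R[i]) : complex.Im ('i * c) = complex.Re c.
Proof. by case: c => p q; simpc. Qed.

Definition sqn (c : R[i]) : R := complex.Re c ^+ 2 + complex.Im c ^+ 2.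

Lemma sqnE (c : R[i]) : c * conjc c = (sqn c)%:C.
Proof. by case: c => a b; rewrite /sqn /=; simpc; congr (_ +i* _); ring. Qed.

Lemma expi_mul (t : R) : expi t * conjc (expi t) = 1.
Proof.
rewrite /expi; apply/eqP; rewrite eq_complex /=; apply/andP; split; apply/eqP; last by ring.
by rewrite -(cos2Dsin2 t); ring.
Qed.

End Re_Im.

Section hdot.
Variables (R : realType) (n : nat).
Implicit Types (z u v w : Cvec R n) (c : R[i]).

(** Minus the imaginary part of this product is [flat_form]. *)
Definition hdot u v : R[i] := \sum_(j < n) (u j 0 : R[i]) * (v j 0 : R[i])^*.

Lemma hdotDl u v w : hdot (u + v) w = hdot u w + hdot v w.
Proof. by rewrite /hdot -big_split; apply: eq_bigr => j _; rewrite mxE mulrDl. Qed.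

Lemma hdotZl c u w : hdot (c *: u) w = c * hdot u w.
Proof. by rewrite /hdot mulr_sumr; apply: eq_bigr => j _; rewrite mxE mulrA. Qed.

Lemma hdotC u v : hdot v u = conjc (hdot u v).
Proof.
rewrite /hdot rmorph_sum; apply: eq_bigr => j _ /=.
by rewrite rmorphM /= conjcK mulrC.
Qed.

Lemma hdotDr u v w : hdot w (u + v) = hdot w u + hdot w v.
Proof. by rewrite hdotC hdotDl rmorphD /= -!hdotC. Qed.

Lemma hdotZr c u w : hdot w (c *: u) = conjc c * hdot w u.
Proof. by rewrite hdotC hdotZl rmorphM /= -hdotC. Qed.

Lemma hdot0l w : hdot 0 w = 0.
Proof. by rewrite /hdot big1 // => j _; rewrite mxE mul0r. Qed.

Lemma hdotNl u w : hdot (- u) w = - hdot u w.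
Proof. by rewrite -scaleN1r hdotZl mulN1r. Qed.

Lemma hdotNr u w : hdot w (- u) = - hdot w u.
Proof. by rewrite hdotC hdotNl rmorphN /= -hdotC. Qed.

Lemma hdotBl u v w : hdot (u - v) w = hdot u w - hdot v w.
Proof. by rewrite hdotDl hdotNl. Qed.

Lemma hdot_normsq z : hdot z z = (normsq z)%:C.
Proof.
rewrite /hdot /normsq rmorph_sum; apply: eq_bigr => j _ /=.
by case: (z j 0) => a b; simpc; rewrite !expr2 addrC; congr (_ +i* _); ring.
Qed.

Lemma normsqZc c z : normsq (c *: z) = complex.Re (c * conjc c) * normsq z.
Proof.
have : (normsq (c *: z))%:C = (complex.Re (c * conjc c))%:C * (normsq z)%:C.
  rewrite -!hdot_normsq hdotZl hdotZr mulrA; congr (_ * _).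
  by case: c => a b; simpc; congr (_ +i* _); ring.
by rewrite -rmorphM /= => -[].
Qed.

Lemma normsqD u v : normsq (u + v) = normsq u + normsq v + 2 * complex.Re (hdot u v).
Proof.
have := hdot_normsq (u + v); rewrite hdotDl !hdotDr !hdot_normsq (hdotC u v).
case: (hdot u v) => a b; simpc => H; move: (congr1 (@complex.Re R) H) => /= {}H; rewrite -H; ring.
Qed.

Lemma hdotZr_real (r : R) u w : hdot w (r%:C *: u) = r%:C * hdot w u.
Proof. by rewrite hdotZr; congr (_ * _); rewrite /= oppr0. Qed.

Lemma hdotZr_i u w : hdot w ('i *: u) = - ('i * hdot w u).
Proof. by rewrite hdotZr -mulNr; congr (_ * _); apply/eqP; rewrite eq_complex /= oppr0 !eqxx. Qed.

Lemma normsq_i u : normsq ('i *: u) = normsq u.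
Proof. by rewrite normsqZc /=; ring. Qed.

Lemma pos_normsq z : z != 0 -> 0 < normsq z.
Proof. by move=> z0; rewrite lt_neqAle eq_sym normsq_eq0 z0 normsq_ge0. Qed.

Lemma hdot_basis z (k : 'I_n) : hdot z (basis_vec R k) = z k 0.
Proof.
rewrite /hdot (bigD1 k) //= big1 ?addr0 => [|j jk]; rewrite /basis_vec !mxE.
  by rewrite !eqxx /= mulr1n; case: (z k 0) => a b; simpc.
by rewrite (negbTE jk) /= mulr0n; case: (z j 0) => a b; simpc.
Qed.

Lemma normsq_basis (j : 'I_n) : normsq (basis_vec R j) = 1.
Proof.
rewrite /normsq (bigD1 j) //= big1 => [|k kj]; rewrite /basis_vec !mxE.
  by rewrite !eqxx /= expr1n expr0n !addr0.
by rewrite (negbTE kj) /= expr0n addr0.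
Qed.

(** Makes the equality case of the Cauchy-Schwarz inequality explicit. *)
Lemma gram (w p : Cvec R n) :
  normsq ((normsq p)%:C *: w - hdot w p *: p) = normsq p * (normsq p * normsq w - sqn (hdot w p)).
Proof.
have : (normsq ((normsq p)%:C *: w - hdot w p *: p))%:C =
    (normsq p * (normsq p * normsq w - sqn (hdot w p)))%:C :> R[i].
  rewrite -hdot_normsq !(hdotBl, hdotNr, hdotDr, hdotZl, hdotZr_real) !hdotZr !hdot_normsq.
  rewrite rmorphM rmorphB rmorphM /= -sqnE (hdotC w p); ring.
by move=> /(congr1 (@complex.Re R)).
Qed.

Lemma Re_hdotE u v : complex.Re (hdot u v) =
  \sum_j (complex.Re (u j 0) * complex.Re (v j 0) + complex.Im (u j 0) * complex.Im (v j 0)).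
Proof.
rewrite /hdot raddf_sum; apply: eq_bigr => j _ /=.
by case: (u j 0) (v j 0) => a b [p q] /=; ring.
Qed.

Lemma Im_hdot_nondeg u : (forall v, complex.Im (hdot u v) = 0) -> u = 0.
Proof.
move=> /(_ ('i *: u)); rewrite hdotZr hdot_normsq; simpc => /= H.
by apply/eqP; rewrite -normsq_eq0 -oppr_eq0 -H; apply/eqP; ring.
Qed.

Lemma half_i_sub_conj c : 'i / 2 * (c - conjc c) = (- complex.Im c)%:C.
Proof.
have -> : c - conjc c = 2 * ((complex.Im c)%:C * 'i).
  by case: c => a b; rewrite mulr_natl mulr2n; simpc.
have -> : 'i / 2 * (2 * ((complex.Im c)%:C * 'i)) = 'i ^+ 2 * (complex.Im c)%:C :> R[i] by field.
by rewrite sqr_i mulN1r rmorphN.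
Qed.

Lemma flat_formE z u v : flat_form z u v = (- complex.Im (hdot u v))%:C.
Proof.
by rewrite /flat_form /dz_dzbar sumrB -/(hdot u v) -/(hdot v u) (hdotC u v) half_i_sub_conj.
Qed.
End hdot.

Section dird.
Variables (R : realType) (n : nat).
Implicit Types (z u v w : Cvec R n) (U : set (Cvec R n)) (h : Cvec R n -> R).

Lemma dird_eq (d : R) h v z :
  is_derive (0 : R) (1 : R) (fun t : R => h (z + t%:C *: v)) d -> dird h v z = d.
Proof. exact: der_derive1. Qed.

(** Linearity in the direction needs C^1: it is the chain rule for two linear parameters. *)
Lemma dird_lin U h z u v (a b : R) : open U -> U z -> Ck_on 1 U h ->
  dird h (a%:C *: u + b%:C *: v) z = a * dird h u z + b * dird h v z.
Proof.
move=> oU Uz hC; apply: dird_eq.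
have Da (c : R) : is_derive (0 : R) (1 : R) (fun t => t * c) c.
  by apply: der_eq (derM (der_id 0) (der_cst 0 c)) => //; rewrite mulr0 addr0 mul1r.
apply: der_eq (der_curve2 u v oU Uz hC (Da a) (mul0r _) (Da b) (mul0r _)) => // t.
by rewrite scalerDr addrA !scalerA -!rmorphM.
Qed.

Lemma der_curve U h u v (a b : R -> R) (s da db : R) :
  open U -> Ck_on 1 U h -> U ((a s)%:C *: u + (b s)%:C *: v) ->
  is_derive s 1 a da -> is_derive s 1 b db ->
  is_derive s 1 (fun t => h ((a t)%:C *: u + (b t)%:C *: v))
    (dird h (da%:C *: u + db%:C *: v) ((a s)%:C *: u + (b s)%:C *: v)).
Proof.
move=> oU hC Us Da Db; rewrite (dird_lin _ _ _ _ oU Us hC).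
have sh (c : R -> R) (dc : R) : is_derive s 1 c dc ->
    is_derive (0 : R) (1 : R) (fun t => c (s + t) - c s) dc.
  move=> Dc; have Dc' : is_derive (s + 0) 1 c dc by rewrite addr0.
  apply: der_eq (derB (der_comp (g := fun t => s + t) Dc' (derD (der_cst 0 s) (der_id 0))) (der_cst 0 (c s))) => //.
  by rewrite add0r mulr1 subr0.
have H := der_curve2 u v oU Us hC (sh _ _ Da) _ (sh _ _ Db) _.
rewrite !addr0 !subrr in H.
have {H}H0 := H erefl erefl; rewrite -(subrr s) in H0.
apply: der_eq (der_comp (g := fun t => t - s) H0 (derB (der_id s) (der_cst s s))) => [t|].
  rewrite (addrC s) subrK !rmorphB /= !scalerBl; congr h.
  by rewrite -addrA addrACA ![_ + (_ - _)]addrC !subrK.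
by rewrite subr0 mulr1.
Qed.
End dird.

(** * Kaehler forms of radial potentials *)

Section radial_hessian.
Variables (R : realType) (n : nat).
Implicit Types (z u v w : Cvec R n) (U : set (Cvec R n)) (h : Cvec R n -> R).

Lemma near_line z v (P : set (Cvec R n)) : nbhs z P ->
  \forall t \near (0 : R), P (z + t%:C *: v).
Proof.
move=> /nbhs_normsqP[e e0 He].
have h0 : 0 < e / (normsq v + 1) by rewrite divr_gt0 // ltr_wpDl ?normsq_ge0.
apply/nbhs_ballP; exists (Num.min 1 (e / (normsq v + 1))).
  by rewrite /= lt_min ltr01.
move=> t; rewrite /ball /= sub0r normrN lt_min => /andP[t1 te].
apply: He; rewrite addrC addKr normsqZ -[t ^+ 2]real_normK ?num_real // expr2.
have v0 := normsq_ge0 v; have t0 := normr_ge0 t.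
move: te; rewrite ltr_pdivlMr ?ltr_wpDl //; apply: le_lt_trans.
have := ler_wpM2r (mulr_ge0 t0 v0) (ltW t1); rewrite mul1r mulrA mulrDr mulr1; lra.
Qed.

Lemma normsq_line z v (t : R) :
  normsq (z + t%:C *: v) = normsq z + t ^+ 2 * normsq v + 2 * (t * complex.Re (hdot z v)).
Proof.
rewrite normsqD normsqZ hdotZr; congr (_ + _ * _).
by case: (hdot z v) => a b; simpc.
Qed.

Lemma der_normsq_line z v :
  is_derive (0 : R) (1 : R) (fun t : R => normsq (z + t%:C *: v)) (2 * complex.Re (hdot z v)).
Proof.
set d := complex.Re _.
have H := derD (derD (der_cst 0 (normsq z)) (derM (derM (der_id 0) (der_id 0)) (der_cst 0 (normsq v))))
  (derZ 2 (derM (der_id 0) (der_cst 0 d))).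
apply: der_eq H => [t|]; first by rewrite normsq_line expr2.
by ring.
Qed.

Lemma der_radial (phi : R -> R) (d : R) z v : is_derive (normsq z) 1 phi d ->
  is_derive (0 : R) (1 : R) (fun t : R => phi (normsq (z + t%:C *: v)))
    (d * (2 * complex.Re (hdot z v))).
Proof.
move=> D; have D' : is_derive (normsq (z + (0 : R)%:C *: v)) 1 phi d.
  by rewrite scale0r addr0.
exact: (der_comp (g := fun t : R => normsq (z + t%:C *: v)) D' (der_normsq_line z v)).
Qed.

Lemma der_coord z v (j : 'I_n) :
  is_derive (0 : R) (1 : R) (fun t : R => complex.Re ((z + t%:C *: v) j 0)) (complex.Re (v j 0)) /\
  is_derive (0 : R) (1 : R) (fun t : R => complex.Im ((z + t%:C *: v) j 0)) (complex.Im (v j 0)).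
Proof.
have H (a b : R) : is_derive (0 : R) (1 : R) (fun t : R => a + t * b) b.
  apply: der_eq (derD (der_cst 0 a) (derM (der_id 0) (der_cst 0 b))) => //.
  by rewrite mul1r mul0r addr0 add0r.
split.
  apply: der_eq (H (complex.Re (z j 0)) (complex.Re (v j 0))) => // t.
  by rewrite !mxE; case: (z j 0) (v j 0) => a b [c d]; simpc.
apply: der_eq (H (complex.Im (z j 0)) (complex.Im (v j 0))) => // t.
by rewrite !mxE; case: (z j 0) (v j 0) => a b [c d]; simpc.
Qed.

(** Cauchy-Schwarz in the form of Young, which involves no square root of [normsq]. *)
Lemma cauchy_young z v (s : R) : 0 < s ->
  `|2 * complex.Re (hdot z v)| <= s * normsq z + normsq v / s.
Proof.
move=> s0; have E (t : R) : normsq (t%:C *: z + v) =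
    t ^+ 2 * normsq z + normsq v + t * (2 * complex.Re (hdot z v)).
  rewrite normsqD normsqZ hdotZl; congr (_ + _).
  by case: (hdot z v) => a b; simpc => /=; ring.
have H (t : R) : 0 <= t ^+ 2 * normsq z + normsq v + t * (2 * complex.Re (hdot z v)).
  by rewrite -E normsq_ge0.
set a := 2 * complex.Re _ in H *; set b := normsq z in H *; set c := normsq v in H *.
have cs : c / s * s = c by rewrite mulfVK // gt_eqF.
have H1 := H s; have H2 := H (- s).
rewrite ler_norml; apply/andP; split; rewrite -(ler_pM2r s0) ?mulNr mulrDl cs; lra.
Qed.

Lemma normsq_cont z (r : R) : 0 < r -> \forall w \near z, `|normsq w - normsq z| < r.
Proof.
move=> r0; have z0 := normsq_ge0 z.
pose s := r / (4 * (normsq z + 1)).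
have s0 : 0 < s by rewrite divr_gt0 // mulr_gt0 // ltr_wpDl.
apply/nbhs_normsqP; exists (Num.min (r / 4) (s * (r / 4))).
  have r4 : 0 < r / 4 by rewrite divr_gt0.
  by rewrite lt_min r4 mulr_gt0.
move=> w; rewrite lt_min => /andP[w1 w2].
have -> : w = z + (w - z) by rewrite addrC subrK.
move: w1 w2; set k := w - z => k1 k2; rewrite normsqD.
have C := cauchy_young z k s0; have k0 := normsq_ge0 k.
have -> : normsq z + normsq k + 2 * complex.Re (hdot z k) - normsq z =
  normsq k + 2 * complex.Re (hdot z k) by ring.
have ks : normsq k / s < r / 4 by rewrite ltr_pdivrMr // mulrC.
have zs : s * normsq z <= r / 4.
  have E : s * (normsq z + 1) = r / 4 by rewrite /s; field; rewrite gt_eqF // ltr_wpDl.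
  by rewrite -E mulrDr mulr1 lerDl ltW.
apply: le_lt_trans (ler_normD _ _) _; rewrite (ger0_norm k0); lra.
Qed.

Lemma open_ball (r : R) : open [set z : Cvec R n | normsq z < r].
Proof.
apply/openP => z /= zr; have r0 : 0 < r - normsq z by rewrite subr_gt0.
have /nbhs_normsqP[d d0 Hd] := normsq_cont z r0; exists d => // w /Hd.
by rewrite ltr_norml => /andP[_]; rewrite ltrD2r.
Qed.

Lemma dird_near (h h' : Cvec R n -> R) (d : R) z v :
  (\forall w \near z, h w = h' w) ->
  is_derive (0 : R) (1 : R) (fun t : R => h' (z + t%:C *: v)) d -> dird h v z = d.
Proof.
move=> hh' H; apply: dird_eq; apply: der_near H.
by have := near_line v hh'; apply: filterS => t ->.
Qed.

Lemma cdird_near (F : Cvec R n -> R[i]) (a b : Cvec R n -> R) (da db : R) z v :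
  (\forall w \near z, F w = a w +i* b w) ->
  is_derive (0 : R) (1 : R) (fun t : R => a (z + t%:C *: v)) da ->
  is_derive (0 : R) (1 : R) (fun t : R => b (z + t%:C *: v)) db ->
  cdird F v z = da +i* db.
Proof.
move=> nF Ha Hb; rewrite /cdird; congr (_ +i* _).
  by apply: dird_near Ha; apply: filterS nF => w ->.
by apply: dird_near Hb; apply: filterS nF => w ->.
Qed.

(** Near z, d/dzbar_k of phi(|z|^2) is phi'(|z|^2) z_k; differentiating this product along z_j
    gives the two terms. *)
Lemma complex_hessian_radial (Phi : Cvec R n -> R) (phi phi1 : R -> R) (phi2 r : R) z :
  0 < r -> (forall x, `|x - normsq z| < r -> is_derive x 1 phi (phi1 x)) ->
  is_derive (normsq z) 1 phi1 phi2 ->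
  (\forall w \near z, Phi w = phi (normsq w)) ->
  forall j k, complex_hessian Phi z j k =
    (phi1 (normsq z))%:C * (j == k)%:R + phi2%:C * (conjc (z j 0) * z k 0).
Proof.
move=> r0 D1 D2 nPhi j k.
have nb : \forall w \near z, d_zbar k (fun x => (Phi x)%:C) w =
    (phi1 (normsq w) * complex.Re (w k 0)) +i* (phi1 (normsq w) * complex.Im (w k 0)).
  have nnPhi : \forall w \near z, \forall w' \near w, Phi w' = phi (normsq w').
    exact: nbhs_interior nPhi.
  near=> w.
  have D (v : Cvec R n) : cdird (fun x => (Phi x)%:C) v w =
      (phi1 (normsq w) * (2 * complex.Re (hdot w v)))%:C.
    have nw : \forall w' \near w, (Phi w')%:C = phi (normsq w') +i* 0.
      have : \forall w' \near w, Phi w' = phi (normsq w') by near: w.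
      by apply: filterS => w' ->.
    apply: (@cdird_near _ (fun w => phi (normsq w)) (fun=> 0) _ _ w v nw _ (der_cst _ _)).
    apply: der_radial; apply: D1; near: w; exact: normsq_cont.
  rewrite /d_zbar !D hdotZr hdot_basis; case: (w k 0) => a b.
  rewrite mulrC; apply: (mulfI (x := 2)); first by rewrite pnatr_eq0.
  rewrite mulVKf ?pnatr_eq0 //; simpc => /=; rewrite mulr_natl mulr2n; simpc.
  by congr (_ +i* _); ring.
have D (v : Cvec R n) : cdird (d_zbar k (fun x => (Phi x)%:C)) v z =
    (phi2 * (2 * complex.Re (hdot z v)))%:C * z k 0 + (phi1 (normsq z))%:C * v k 0.
  have [cr ci] := der_coord z v k.
  have H1 := derM (der_radial v D2) cr; have H2 := derM (der_radial v D2) ci.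
  rewrite (cdird_near nb H1 H2) scale0r addr0.
  by case: (z k 0) (v k 0) => a b [c d]; simpc.
rewrite /complex_hessian /d_z !D hdotZr hdot_basis !mxE eqxx andbT eq_sym.
have -> : conjc (z j 0) = (complex.Re (z j 0))%:C - 'i * (complex.Im (z j 0))%:C :> R[i].
  by case: (z j 0) => a b; simpc.
have -> : complex.Re (conjc 'i * (z j 0 : R[i])) = complex.Im (z j 0).
  by case: (z j 0) => a b; simpc.
rewrite !rmorphM /= !rmorph_nat.
set A := (complex.Re _)%:C; set B := (complex.Im _)%:C; set C := phi2%:C; set E := (phi1 _)%:C.
have i2 : 'i * 'i = -1 :> R[i] by rewrite -expr2 sqr_i.
set Z : R[i] := z k 0; set D0 := (_ == _)%:R.
have -> : C * (2 * A) * Z + E * D0 - 'i * (C * (2 * B) * Z + E * ('i * D0)) =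
  C * (2 * A) * Z + E * D0 - 'i * (C * (2 * B) * Z) - 'i * 'i * (E * D0) by ring.
by rewrite i2; field.
Unshelve. all: end_near.
Qed.

Lemma levi_radial (Phi : Cvec R n -> R) (a b : R) z u v :
  (forall j k, complex_hessian Phi z j k =
    a%:C * (j == k)%:R + b%:C * (conjc (z j 0) * z k 0)) ->
  \sum_(j < n) \sum_(k < n) complex_hessian Phi z j k * ((u j 0 : R[i]) * conjc (v k 0)) =
  a%:C * hdot u v + b%:C * (hdot u z * conjc (hdot v z)).
Proof.
move=> H; rewrite /hdot mulr_sumr rmorph_sum mulr_suml mulr_sumr -big_split /=; apply: eq_bigr => j _.
under eq_bigr do rewrite H mulrDl.
rewrite big_split /=; congr (_ + _).
  rewrite (bigD1 j) //= eqxx mulr1 big1 ?addr0 // => k kj.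
  by rewrite eq_sym (negbTE kj) mulr0 mul0r.
rewrite mulrA mulr_sumr; apply: eq_bigr => k _.
rewrite rmorphM /= conjcK; ring.
Qed.

Lemma kahler_form_radial (Phi : Cvec R n -> R) (a b : R) z u v :
  (forall j k, complex_hessian Phi z j k =
    a%:C * (j == k)%:R + b%:C * (conjc (z j 0) * z k 0)) ->
  kahler_form Phi z u v =
  (- complex.Im (a%:C * hdot u v + b%:C * (hdot u z * conjc (hdot v z))))%:C.
Proof.
move=> H; rewrite /kahler_form -half_i_sub_conj; congr (_ * _).
transitivity (\sum_(j < n) \sum_(k < n) complex_hessian Phi z j k * ((u j 0 : R[i]) * conjc (v k 0))
   - \sum_(j < n) \sum_(k < n) complex_hessian Phi z j k * ((v j 0 : R[i]) * conjc (u k 0))).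
  rewrite -sumrB; apply: eq_bigr => j _; rewrite -sumrB; apply: eq_bigr => k _.
  by rewrite -mulrBr.
rewrite !(levi_radial _ _ H) (hdotC u v).
case: (hdot u v) (hdot u z) (hdot v z) => p p' [q q'] [s s']; simpc.
by congr (_ +i* _); ring.
Qed.
End radial_hessian.

(** * Real power series *)

Section pseries.
Variable R : realType.
Implicit Types (c : nat -> R) (x rho B : R).

Definition psum c x : R := limn (pseries c x).

(** The Cauchy estimate at radius rho. *)
Definition pbound c rho B := forall k, `|c k| * rho ^+ k <= B.

Lemma pbound_ge0 c rho B : 0 < rho -> pbound c rho B -> 0 <= B.
Proof. by move=> r0 /(_ 0%N); apply: le_trans; rewrite mulr_ge0 // exprn_ge0 // ltW. Qed.

Lemma pbound_term c rho B x k : 0 < rho -> pbound c rho B ->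
  `|c k * x ^+ k| <= B * (`|x| / rho) ^+ k.
Proof.
move=> r0 /(_ k) H; rewrite normrM normrX expr_div_n mulrA ler_pdivlMr ?exprn_gt0 //.
by rewrite mulrAC ler_wpM2r // exprn_ge0.
Qed.

Lemma pbound_le c rho rho' B : 0 <= rho' -> rho' <= rho -> pbound c rho B -> pbound c rho' B.
Proof.
move=> r0 rr H k; apply: le_trans (H k); rewrite ler_wpM2l // lerXn2r ?nnegrE //.
exact: le_trans rr.
Qed.

Lemma ratio_lt1 rho x : 0 < rho -> `|x| < rho -> `|x| / rho < 1.
Proof. by move=> r0 xr; rewrite ltr_pdivrMr // mul1r. Qed.

Lemma pcvg_norm c rho B x : 0 < rho -> pbound c rho B -> `|x| < rho ->
  cvgn (series (fun k => `|c k * x ^+ k|)).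
Proof.
move=> r0 H xr; have B0 := pbound_ge0 r0 H.
have q0 : 0 <= `|x| / rho by rewrite divr_ge0 // ltW.
apply: (@series_le_cvg _ _ (geometric B (`|x| / rho))) => //.
- by move=> k; rewrite /geometric /= mulr_ge0 // exprn_ge0.
- by move=> k; rewrite /geometric /=; exact: pbound_term.
- by apply: is_cvg_geometric_series; rewrite ger0_norm // ratio_lt1.
Qed.

Lemma pcvg c rho B x : 0 < rho -> pbound c rho B -> `|x| < rho -> cvgn (pseries c x).
Proof. by move=> r0 H xr; apply: normed_cvg; exact: pcvg_norm H xr. Qed.

Lemma psum_cvg c rho B x : 0 < rho -> pbound c rho B -> `|x| < rho ->
  series (fun k => c k * x ^+ k) @ \oo --> psum c x.
Proof. by move=> r0 H xr; exact: (pcvg r0 H xr). Qed.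

Lemma psum_uniq c x (l : R) : series (fun k => c k * x ^+ k) @ \oo --> l -> psum c x = l.
Proof. by move=> H; exact: cvg_lim. Qed.

Lemma psum_le c rho B x : 0 < rho -> pbound c rho B -> `|x| < rho ->
  `|psum c x| <= B / (1 - `|x| / rho).
Proof.
move=> r0 H xr; have B0 := pbound_ge0 r0 H.
have q1 := ratio_lt1 r0 xr; have q0 : 0 <= `|x| / rho by rewrite divr_ge0 // ltW.
have L : (fun n => `|series (fun k => c k * x ^+ k) n|) @ \oo --> `|psum c x|.
  by apply: cvg_norm; exact: psum_cvg H xr.
rewrite -(cvg_lim _ L) //; apply: limr_le; first by apply/cvg_ex; eexists; exact: L.
apply: nearW => n; rewrite /series /=; apply: le_trans (ler_norm_sum _ _ _) _.
apply: (@le_trans _ _ (\sum_(0 <= k < n) B * (`|x| / rho) ^+ k)).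
  by apply: ler_sum => k _; exact: pbound_term.
rewrite -[X in X <= _]/(series (geometric B (`|x| / rho)) n) geometric_seriesE ?lt_eqF //.
rewrite /= ler_wpM2r ?invr_ge0 ?subr_ge0 ?(ltW q1) //.
by rewrite -[leRHS]mulr1 ler_wpM2l // gerBl exprn_ge0.
Qed.

Lemma pbound_shift c rho B : 0 < rho -> pbound c rho B ->
  pbound (fun k => c k.+1) rho (B / rho).
Proof. by move=> r0 H k; rewrite ler_pdivlMr // -mulrA -exprSr. Qed.

Lemma psum_step c rho B x : 0 < rho -> pbound c rho B -> `|x| < rho ->
  psum c x = c 0%N + x * psum (fun k => c k.+1) x.
Proof.
move=> r0 H xr; have L := psum_cvg r0 (pbound_shift r0 H) xr.
apply: psum_uniq; rewrite -cvg_shiftS /=.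
have E : (fun n => series (fun k => c k * x ^+ k) n.+1) =
    (fun n => c 0%N + x * series (fun k => c k.+1 * x ^+ k) n).
  apply/funext => n; rewrite /series /= big_nat_recl // expr0 mulr1 mulr_sumr.
  by congr (_ + _); apply: eq_bigr => k _; rewrite exprS; ring.
rewrite E; apply: cvgD; first exact: cvg_cst.
by apply: cvgM => //; exact: cvg_cst.
Qed.

Lemma psumE_near0 c rho B x : 0 < rho -> pbound c rho B -> `|x| <= rho / 2 ->
  `|psum c x - c 0%N| <= `|x| * (2 * (B / rho)).
Proof.
move=> r0 H xr; have xr' : `|x| < rho.
  by apply: le_lt_trans xr _; rewrite ltr_pdivrMr // ltr_pMr // ltr1n.
rewrite (psum_step r0 H xr') addrC addKr normrM ler_wpM2l //.
have B0 : 0 <= B / rho by rewrite divr_ge0 ?(pbound_ge0 r0 H) // ltW.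
apply: le_trans (psum_le r0 (pbound_shift r0 H) xr') _; rewrite mulrC ler_wpM2r //.
have q : `|x| / rho <= 2^-1 by rewrite ler_pdivrMr // mulrC.
by rewrite -[leRHS]invrK lef_pV2 ?posrE ?invr_gt0 // ?subr_gt0; lra.
Qed.

(** Differentiation multiplies the k-th term by k, which a smaller radius absorbs: with s^2 =
    rho' / rho < 1 one has (k + 1) s^k <= 1 / (1 - s). *)
Lemma pbound_diffs c rho rho' B : 0 < rho' -> rho' < rho -> pbound c rho B ->
  exists B', pbound (pseries_diffs c) rho' B'.
Proof.
move=> r0' rr H; have r0 : 0 < rho by exact: lt_trans rr.
have B0 := pbound_ge0 r0 H.
pose s := Num.sqrt (rho' / rho).
have q0 : 0 < rho' / rho by rewrite divr_gt0.
have q1 : rho' / rho < 1 by rewrite ltr_pdivrMr // mul1r.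
have s0 : 0 <= s by rewrite sqrtr_ge0.
have s1 : s < 1 by rewrite -(ltr_pXn2r (n := 2)) ?nnegrE // expr1n sqr_sqrtr ?ltW.
have s2 : s * s = rho' / rho by rewrite -expr2 sqr_sqrtr // ltW.
exists (B / rho * (1 - s)^-1) => k.
rewrite /pseries_diffs normrM normr_nat -!mulrA.
have Hk := pbound_shift r0 H k; rewrite /= in Hk.
have -> : rho' ^+ k = rho ^+ k * (s ^+ k * s ^+ k).
  by rewrite -exprMn s2 -exprMn mulrC divfK // gt_eqF.
have -> : k.+1%:R * (`|c k.+1| * (rho ^+ k * (s ^+ k * s ^+ k))) =
  (`|c k.+1| * rho ^+ k) * ((k.+1%:R * s ^+ k) * s ^+ k) by ring.
rewrite mulrA; apply: ler_pM => //.
- by rewrite mulr_ge0 // exprn_ge0 // ltW.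
- by rewrite !mulr_ge0 // exprn_ge0.
- apply: (@le_trans _ _ (k.+1%:R * s ^+ k)).
    by rewrite ler_piMr ?mulr_ge0 ?exprn_ge0 // exprn_ile1 // ltW.
  rewrite -[leRHS]mul1r ler_pdivlMr ?subr_gt0 //.
  have S : \sum_(i < k.+1) s ^+ k <= \sum_(i < k.+1) s ^+ i.
    by apply: ler_sum => i _; rewrite ler_wiXn2l // ?ltW // -ltnS.
  rewrite sumr_const card_ord -[leLHS]mulr_natl in S.
  apply: (@le_trans _ _ ((\sum_(i < k.+1) s ^+ i) * (1 - s))).
    by rewrite ler_wpM2r // subr_ge0 ltW.
  have -> : (\sum_(i < k.+1) s ^+ i) * (1 - s) = 1 - s ^+ k.+1.
    by rewrite -[1 - s ^+ _]opprB subrX1; ring.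
  by rewrite gerBl exprn_ge0.
Qed.

(** Convergence in the open disc of radius rho, expressed by the Cauchy estimates at all smaller
    radii, because these pass easily through operations on the coefficients. *)
Definition pconv c rho := 0 < rho /\ forall r, 0 < r -> r < rho -> exists B, pbound c r B.

Lemma pconv_pbound c rho x : pconv c rho -> `|x| < rho ->
  exists r B, [/\ 0 < r, `|x| < r, r < rho & pbound c r B].
Proof.
move=> [r0 H] xr; pose r := (`|x| + rho) / 2.
have xr' : `|x| < r by have [] := midf_lt xr.
have rr : r < rho by have [] := midf_lt xr.
have r0' : 0 < r by apply: le_lt_trans xr'.
by have [B HB] := H _ r0' rr; exists r, B.
Qed.

Lemma pbound_pconv c rho B : 0 < rho -> pbound c rho B -> pconv c rho.
Proof.
move=> r0 H; split=> // r r0' rr; exists B; apply: pbound_le H; exact: ltW.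
Qed.

Lemma pconv_le c rho rho' : 0 < rho' -> rho' <= rho -> pconv c rho -> pconv c rho'.
Proof. by move=> r0 rr [_ H]; split=> // r r1 r2; apply: H => //; exact: lt_le_trans rr. Qed.

Lemma pconv_ext c c' rho : (forall k, c k = c' k) -> pconv c rho -> pconv c' rho.
Proof. by move=> E; have -> : c' = c by apply/funext => k; rewrite E. Qed.

Lemma pconv_psum_cvg c rho x : pconv c rho -> `|x| < rho ->
  series (fun k => c k * x ^+ k) @ \oo --> psum c x.
Proof. by move=> H /(pconv_pbound H)[r [B [r0 xr _ HB]]]; exact: psum_cvg HB xr. Qed.

Lemma pconv_cvg_norm c rho x : pconv c rho -> `|x| < rho ->
  cvgn (series (fun k => `|c k * x ^+ k|)).
Proof. by move=> H /(pconv_pbound H)[r [B [r0 xr _ HB]]]; exact: pcvg_norm HB xr. Qed.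

Lemma pconv_shift c rho : pconv c rho -> pconv (fun k => c k.+1) rho.
Proof.
by move=> [r0 H]; split=> // r r1 r2; have [B HB] := H _ r1 r2; exists (B / r); exact: pbound_shift.
Qed.

Lemma pconv_diffs c rho : pconv c rho -> pconv (pseries_diffs c) rho.
Proof.
move=> [r0 H]; split=> // r r1 r2.
have [B HB] := H ((r + rho) / 2) (lt_trans r1 (midf_lt r2).1) (midf_lt r2).2.
exact: pbound_diffs r1 (midf_lt r2).1 HB.
Qed.

Lemma pconv_step c rho x : pconv c rho -> `|x| < rho ->
  psum c x = c 0%N + x * psum (fun k => c k.+1) x.
Proof. by move=> H /(pconv_pbound H)[r [B [r0 xr _ HB]]]; exact: psum_step HB xr. Qed.

Lemma pconv_psum0 c rho : pconv c rho -> psum c 0 = c 0%N.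
Proof. by move=> H; rewrite (pconv_step H) ?normr0 ?mul0r ?addr0 //; case: H. Qed.

Lemma pconv_add c c' rho : pconv c rho -> pconv c' rho ->
  pconv (fun k => c k + c' k) rho.
Proof.
move=> [r0 H] [_ H']; split=> // r r1 r2.
have [B HB] := H _ r1 r2; have [B' HB'] := H' _ r1 r2; exists (B + B') => k.
apply: le_trans (lerD (HB k) (HB' k)); rewrite -mulrDl ler_wpM2r ?ler_normD //.
by rewrite exprn_ge0 // ltW.
Qed.

Lemma pconv_scale a c rho : pconv c rho -> pconv (fun k => a * c k) rho.
Proof.
move=> [r0 H]; split=> // r r1 r2.
have [B HB] := H _ r1 r2; exists (`|a| * B) => k.
by rewrite normrM -mulrA ler_wpM2l.
Qed.

Lemma psum_add c c' rho x : pconv c rho -> pconv c' rho -> `|x| < rho ->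
  psum (fun k => c k + c' k) x = psum c x + psum c' x.
Proof.
move=> H H' xr; apply: psum_uniq.
have -> : series (fun k => (c k + c' k) * x ^+ k) =
    series (fun k => c k * x ^+ k) + series (fun k => c' k * x ^+ k).
  apply/funext => n; rewrite /series /= fctE -big_split /=.
  by apply: eq_bigr => k _; rewrite mulrDl.
by apply: cvgD; [exact: pconv_psum_cvg H xr | exact: pconv_psum_cvg H' xr].
Qed.

Lemma psum_scale a c rho x : pconv c rho -> `|x| < rho ->
  psum (fun k => a * c k) x = a * psum c x.
Proof.
move=> H xr; apply: psum_uniq.
have -> : series (fun k => (a * c k) * x ^+ k) = (fun n => a * series (fun k => c k * x ^+ k) n).
  apply/funext => n; rewrite /series /= mulr_sumr.
  by apply: eq_bigr => k _; rewrite mulrA.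
by apply: cvgM; [exact: cvg_cst | exact: pconv_psum_cvg H xr].
Qed.

Lemma der_psum c rho x : pconv c rho -> `|x| < rho ->
  is_derive x 1 (psum c) (psum (pseries_diffs c) x).
Proof.
move=> H xr; pose K := (`|x| + rho) / 2.
have xK : `|x| < K by have [] := midf_lt xr.
have Kr : K < rho by have [] := midf_lt xr.
have K0 : `|K| = K by rewrite ger0_norm // ltW // (le_lt_trans _ xK).
apply: (@pseries_snd_diffs _ _ K); rewrite ?K0 //.
- by apply/cvg_ex; eexists; apply: pconv_psum_cvg H _; rewrite K0.
- by apply/cvg_ex; eexists; apply: (pconv_psum_cvg (pconv_diffs H)); rewrite K0.
- by apply/cvg_ex; eexists; apply: (pconv_psum_cvg (pconv_diffs (pconv_diffs H))); rewrite K0.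
Qed.

(** Dividing by x as long as the constant coefficient vanishes leads to a power series that is
    nonzero at 0, hence nearby. *)
Lemma psum_isolated_zero c rho m : pconv c rho -> c m != 0 ->
  exists2 e, 0 < e & forall x, 0 < `|x| -> `|x| < e -> psum c x != 0.
Proof.
elim: m c => [|m IH] c H cm; have r0 := H.1.
  have := der_cont (der_psum H (x := 0) _); rewrite normr0 => /(_ r0) /continuousP_dist.
  rewrite (pconv_psum0 H) => /(_ `|c 0%N|); rewrite normr_gt0 => /(_ cm)[e e0 He].
  exists e => // x _ xe; apply/eqP => E; have := He x; rewrite subr0 E sub0r normrN => /(_ xe).
  by rewrite ltxx.
have [c0|c0] := eqVneq (c 0%N) 0; last first.
  have := der_cont (der_psum H (x := 0) _); rewrite normr0 => /(_ r0) /continuousP_dist.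
  rewrite (pconv_psum0 H) => /(_ `|c 0%N|); rewrite normr_gt0 => /(_ c0)[e e0 He].
  exists e => // x _ xe; apply/eqP => E; have := He x; rewrite subr0 E sub0r normrN => /(_ xe).
  by rewrite ltxx.
have [e e0 He] := IH _ (pconv_shift H) cm.
exists (Num.min e rho); first by rewrite lt_min e0.
move=> x x0; rewrite lt_min => /andP[xe xr].
by rewrite (pconv_step H xr) c0 add0r mulf_neq0 ?He // -normr_gt0.
Qed.

Lemma psum_eq0 c rho : pconv c rho ->
  (forall e, 0 < e -> exists2 x, 0 < `|x| < e & psum c x = 0) -> forall k, c k = 0.
Proof.
move=> H Z k; apply/eqP; apply: contraT => ck.
have [e e0 He] := psum_isolated_zero H ck.
by have [x /andP[x0 xe] E] := Z _ e0; have := He _ x0 xe; rewrite E eqxx.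
Qed.

Lemma psum_inj c c' rho : pconv c rho -> pconv c' rho ->
  (forall e, 0 < e -> exists2 x, 0 < `|x| < e & psum c x = psum c' x) ->
  forall k, c k = c' k.
Proof.
move=> H H' E k; have Hs := pconv_add H (pconv_scale (-1) H').
apply/eqP; rewrite -subr_eq0 -mulN1r.
apply/eqP; move: k; apply: (psum_eq0 Hs) => e e0; have r0 := H.1.
have [|x /andP[x0]] := E (Num.min e rho); first by rewrite lt_min e0.
rewrite lt_min => /andP[xe xr] Ex; exists x; first by rewrite x0.
by rewrite (psum_add H (pconv_scale (-1) H') xr) (psum_scale _ H' xr) Ex mulN1r subrr.
Qed.

Lemma cvg_pconv c rho : 0 < rho ->
  (forall x, 0 < x -> x < rho -> cvgn (series (fun k => c k * x ^+ k))) -> pconv c rho.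
Proof.
move=> r0 C; split=> // s s0 sr.
have /cvg_series_bounded := C _ s0 sr.
move=> [B [_ HB]]; exists (B + 1) => k; have := HB (B + 1) _ k I; rewrite ltrDl ltr01 => /(_ isT) /=.
by rewrite normrM normrX (ger0_norm (ltW s0)).
Qed.

Lemma analytic_psum (f : R -> R) : analytic_near0 f ->
  exists c rho, pconv c rho /\ forall x, `|x| < rho -> f x = psum c x.
Proof.
move=> [c /nbhs_ballP[r /= r0 Hr]]; exists c, r.
have C x : `|x| < r -> series (fun k => c k * x ^+ k) @ \oo --> f x.
  by move=> xr; apply: Hr; rewrite /ball /= sub0r normrN.
split; last by move=> x /C /psum_uniq.
apply: cvg_pconv => // x x0 xr; apply/cvg_ex; exists (f x); apply: C.
by rewrite gtr0_norm.
Qed.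
End pseries.

(** * Square roots of power series *)

Section sqrt_series.
Variable R : realType.
Implicit Types (u p : nat -> R) (x r B U : R).

(** The recursion is p^2 = u solved with p_0 = 1. The list keeps all earlier coefficients, since
    each new one depends on all of them. *)
Fixpoint sqrt_coefs u (n : nat) : seq R :=
  if n is m.+1 then
    let s := sqrt_coefs u m in
    rcons s ((u n - \sum_(1 <= i < n) s`_i * s`_(n - i)) / 2)
  else [:: 1].

Definition sqrt_coef u n : R := (sqrt_coefs u n)`_n.

Lemma size_sqrt_coefs u n : size (sqrt_coefs u n) = n.+1.
Proof. by elim: n => //= n IH; rewrite size_rcons IH. Qed.

Lemma nth_sqrt_coefs u n i : (i <= n)%N -> (sqrt_coefs u n)`_i = sqrt_coef u i.
Proof.
elim: n => [|n IH]; first by rewrite leqn0 => /eqP ->.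
rewrite leq_eqVlt => /predU1P[->//|]; rewrite ltnS => ni.
by rewrite /= nth_rcons size_sqrt_coefs ltnS ni IH.
Qed.

Lemma sqrt_coefS u n : sqrt_coef u n.+1 =
  (u n.+1 - \sum_(1 <= i < n.+1) sqrt_coef u i * sqrt_coef u (n.+1 - i)) / 2.
Proof.
rewrite {1}/sqrt_coef /= nth_rcons size_sqrt_coefs ltnn eqxx.
congr ((_ - _) / 2); rewrite big_nat_cond [RHS]big_nat_cond.
apply: eq_bigr => i; rewrite andbT => /andP[i1 i2].
by rewrite !nth_sqrt_coefs //; move: i1 i2; case: i => // i; rewrite subSS leq_subr.
Qed.

Lemma sqrt_coef_sq u m : u 0%N = 1 ->
  \sum_(i < m.+1) sqrt_coef u i * sqrt_coef u (m - i) = u m.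
Proof.
move=> u0; case: m => [|m]; first by rewrite big_ord1 /= mul1r u0.
rewrite -(big_mkord xpredT (fun i => sqrt_coef u i * sqrt_coef u (m.+1 - i))).
rewrite big_nat_recl // big_nat_recr //= subn0 subnn [sqrt_coef u 0]/sqrt_coef /= mul1r mulr1.
rewrite sqrt_coefS big_add1 /=; set S := \sum_(_ <= _ < _) _.
by field.
Qed.

Lemma size_poly_sq (P : {poly R}) N : (size P <= N)%N -> (size (P ^+ 2) <= 2 * N)%N.
Proof.
move=> PN; rewrite expr2; apply: leq_trans (size_polyMleq _ _) _.
by apply: leq_trans (leq_pred _) _; rewrite mul2n -addnn leq_add.
Qed.

Lemma poly_coefs_sum1 (P : {poly R}) N : (size P <= N)%N -> P.[1] = \sum_(m < N) P`_m.
Proof.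
by move=> PN; rewrite (horner_coef_wide _ PN); apply: eq_bigr => i _; rewrite expr1n mulr1.
Qed.

(** Induction on the sums S_N of |p_m| r^m over 1 <= m <= N. The recursion gives 2 S_(N+1) <= W
    + S_N^2, where W <= 1 is the corresponding sum for u, so S_N <= 1 is preserved. The square
    S_N^2 is estimated as the value at 1 of the square of a polynomial. *)
Lemma sqrt_coef_bound u r : 0 < r -> (forall N, \sum_(1 <= m < N.+1) `|u m| * r ^+ m <= 1) ->
  pbound (sqrt_coef u) r 1.
Proof.
move=> r0 Hu; pose a m := `|sqrt_coef u m| * r ^+ m.
have a0 m : 0 <= a m by rewrite mulr_ge0 // exprn_ge0 // ltW.
have S N : \sum_(1 <= m < N.+1) a m <= 1.
  elim: N => [|N IH]; first by rewrite big_geq.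
  pose P : {poly R} := \poly_(i < N.+1) (if i is 0%N then 0 else a i).
  have P1 : P.[1] = \sum_(1 <= m < N.+1) a m.
    rewrite (@poly_coefs_sum1 P N.+1) ?size_poly //.
    rewrite big_ord_recl coef_poly /= add0r big_add1 /= big_mkord.
    by apply: eq_bigr => i _; rewrite coef_poly /bump /= add1n ltnS ltn_ord.
  have P0 m : 0 <= P`_m by rewrite coef_poly; case: ifP => // _; case: m.
  have PP0 m : 0 <= (P ^+ 2)`_m.
    by rewrite expr2 coefM; apply: sumr_ge0 => i _; rewrite mulr_ge0.
  have step m : (1 <= m)%N -> (m < N.+2)%N -> 2 * a m <= `|u m| * r ^+ m + (P ^+ 2)`_m.
    case: m => // m _ mN; rewrite /a sqrt_coefS normrM normfV (ger0_norm (ler0n _ 2)) mulrA mulrCA.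
    rewrite mulfV ?pnatr_eq0 // mulr1.
    apply: (@le_trans _ _ ((`|u m.+1| + \sum_(1 <= i < m.+1) `|sqrt_coef u i| * `|sqrt_coef u (m.+1 - i)|) * r ^+ m.+1)).
      rewrite ler_wpM2r ?exprn_ge0 ?(ltW r0) //; apply: le_trans (ler_normB _ _) _.
      rewrite lerD2l; apply: le_trans (ler_norm_sum _ _ _) _.
      by apply: ler_sum => i _; rewrite normrM.
    rewrite mulrDl lerD2l expr2 coefM mulr_suml.
    rewrite -(big_mkord xpredT (fun i => P`_i * P`_(m.+1 - i))) [leRHS]big_nat_recl //.
    apply: ler_wpDl; first exact: mulr_ge0.
    rewrite [leRHS]big_nat_recr //=; apply: ler_wpDr; first exact: mulr_ge0.
    rewrite big_add1 /= big_nat_cond [leRHS]big_nat_cond; apply: ler_sum => i.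
    rewrite andbT => /andP[_ im]; rewrite !coef_poly.
    have -> : (i.+1 < N.+1)%N by rewrite ltnS (leq_trans im).
    rewrite subSS; have -> : (m - i < N.+1)%N by rewrite ltnS (leq_trans (leq_subr _ _)).
    case E : (m - i)%N => [|k]; first by move/eqP: E; rewrite subn_eq0 leqNgt im.
    rewrite /a -E mulrACA -exprD.
    by rewrite addSn subnKC // ltnW.
  have : 2 * \sum_(1 <= m < N.+2) a m <= 1 + 1.
    rewrite mulr_sumr; apply: (@le_trans _ _ (\sum_(1 <= m < N.+2) (`|u m| * r ^+ m + (P ^+ 2)`_m))).
      by rewrite big_nat_cond [leRHS]big_nat_cond; apply: ler_sum => i; rewrite andbT => /andP[]; exact: step.
    rewrite big_split /=; apply: lerD; first exact: Hu.
    apply: (@le_trans _ _ (P ^+ 2).[1]); last first.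
      by rewrite horner_exp P1 expr_le1 // sumr_ge0.
    rewrite (@poly_coefs_sum1 _ (2 * N.+1)) ?size_poly_sq ?size_poly //.
    rewrite -(big_mkord xpredT (fun i => (P ^+ 2)`_i)).
    rewrite [leRHS](big_cat_nat _ (n := N.+2)) //=; last first.
      by rewrite mul2n -addnn addSn addnS !ltnS leq_addr.
    apply: ler_wpDr; first by apply: sumr_ge0.
    rewrite [leRHS](big_cat_nat _ (n := 1)) //=.
    by apply: ler_wpDl => //; apply: sumr_ge0.
  by rewrite -[1 + 1]mulr1 -[1 + 1]/(2%:R) ler_pM2l.
case=> [|k]; first by rewrite /sqrt_coef /= normr1 mulr1.
apply: le_trans (S k.+1); rewrite big_nat_recr //=.
by apply: ler_wpDl => //; apply: sumr_ge0.
Qed.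

(** The square of the N-th partial sum differs from the N-th partial sum of the Cauchy product
    by terms of degree between N and 2 N, which are geometrically small for |x| <= r / 4. *)
Lemma cauchy_square p r B x : 0 < r -> pbound p r B -> `|x| <= r / 4 ->
  series (fun m => (\sum_(i < m.+1) p i * p (m - i)%N) * x ^+ m) @ \oo --> (psum p x) ^+ 2.
Proof.
move=> r0 Hp xr.
have xr' : `|x| < r by apply: le_lt_trans xr _; rewrite ltr_pdivrMr // ltr_pMr // ltr1n.
have L := psum_cvg r0 Hp xr'.
have L2 : (fun n => series (fun k => p k * x ^+ k) n * series (fun k => p k * x ^+ k) n) @ \oo
   --> psum p x * psum p x by apply: cvgM.
have B0 := pbound_ge0 r0 Hp.
have q4 : `|x| / r <= 4^-1 by rewrite ler_pdivrMr // mulrC.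
have q0 : 0 <= `|x| / r by rewrite divr_ge0 // ltW.
have cB (P : {poly R}) m : (forall i, `|P`_i| <= `|p i|) ->
    `|(P ^+ 2)`_m * x ^+ m| <= B ^+ 2 * (2^-1) ^+ m.
  move=> HP; have HP' i : `|P`_i * x ^+ i| <= B * 4^-1 ^+ i.
    apply: (@le_trans _ _ (`|p i * x ^+ i|)); first by rewrite !normrM ler_wpM2r.
    apply: le_trans (pbound_term x i r0 Hp) _; rewrite ler_wpM2l // lerXn2r ?nnegrE //.
  rewrite expr2 coefM mulr_suml; apply: le_trans (ler_norm_sum _ _ _) _.
  apply: (@le_trans _ _ (\sum_(i < m.+1) B ^+ 2 * 4^-1 ^+ m)).
    apply: ler_sum => i _; rewrite -[in x ^+ _](subnKC (ltnSE (ltn_ord i))) exprD mulrACA normrM.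
    rewrite -[in leRHS](subnKC (ltnSE (ltn_ord i))) exprD expr2 mulrACA.
    by apply: ler_pM.
  rewrite sumr_const card_ord -[leLHS]mulr_natl mulrCA ler_wpM2l ?exprn_ge0 //.
  have -> : 4^-1 = 2^-1 * 2^-1 :> R by rewrite -invfM -natrM.
  rewrite exprMn mulrA ler_piMl ?exprn_ge0 // exprVn ler_pdivrMr ?exprn_gt0 //.
  by rewrite mul1r -natrX ler_nat ltn_expl.
have tele N M : \sum_(N <= m < N + M) (2^-1 : R) ^+ m = 2 * (2^-1 ^+ N - 2^-1 ^+ (N + M)).
  elim: M => [|M IH]; first by rewrite addn0 big_geq // subrr mulr0.
  by rewrite addnS big_nat_recr ?leq_addr //= IH exprS; field.
have D N : `|series (fun k => p k * x ^+ k) N * series (fun k => p k * x ^+ k) N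
    - series (fun m => (\sum_(i < m.+1) p i * p (m - i)%N) * x ^+ m) N| <=
    B ^+ 2 * 2 * (2^-1) ^+ N.
  pose P : {poly R} := \poly_(i < N) p i.
  have HP i : `|P`_i| <= `|p i| by rewrite coef_poly; case: ifP => //; rewrite normr0.
  have -> : series (fun k => p k * x ^+ k) N = P.[x].
    by rewrite horner_poly /series /= big_mkord.
  rewrite -expr2 -horner_exp (@horner_coef_wide _ (2 * N)) ?size_poly_sq ?size_poly //.
  rewrite -(big_mkord xpredT (fun i => (P ^+ 2)`_i * x ^+ i)) /series /=.
  rewrite (big_cat_nat _ (n := N)) //=; last by rewrite mul2n -addnn leq_addr.
  rewrite (_ : \sum_(0 <= i < N) _ = \sum_(0 <= k < N) (\sum_(i < k.+1) p i * p (k - i)%N) * x ^+ k); last first.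
    rewrite big_nat_cond [RHS]big_nat_cond; apply: eq_bigr => m; rewrite andbT => /= mN.
    congr (_ * _); rewrite expr2 coefM; apply: eq_bigr => i _.
    rewrite !coef_poly (leq_ltn_trans (leq_subr _ _) mN).
    by rewrite (leq_ltn_trans (ltnSE (ltn_ord i)) mN).
  rewrite addrAC subrr add0r; apply: le_trans (ler_norm_sum _ _ _) _.
  apply: (@le_trans _ _ (\sum_(N <= i < 2 * N) B ^+ 2 * (2^-1) ^+ i)).
    by apply: ler_sum => i _; exact: cB.
  rewrite -mulr_sumr mul2n -addnn tele -mulrA ler_wpM2l ?exprn_ge0 // ler_wpM2l //.
  by rewrite gerBl exprn_ge0 // invr_ge0.
have Z : (fun N => B ^+ 2 * 2 * (2^-1 : R) ^+ N) @ \oo --> (0 : R).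
  have -> : (fun N => B ^+ 2 * 2 * (2^-1 : R) ^+ N) = geometric (B ^+ 2 * 2) (2^-1) by [].
  by apply: cvg_geometric; rewrite ger0_norm ?invr_ge0 // invf_lt1 // ltr1n.
have D0 : (fun N => series (fun k => p k * x ^+ k) N * series (fun k => p k * x ^+ k) N
    - series (fun m => (\sum_(i < m.+1) p i * p (m - i)%N) * x ^+ m) N) @ \oo --> (0 : R).
  apply/norm_cvg0P; apply: (squeeze_cvgr _ (cvg_cst (0 : R)) Z).
  by apply: nearW => N; rewrite normr_ge0 D.
have H := cvgB L2 D0; rewrite subr0 -expr2 in H.
suff -> : series (fun m => (\sum_(i < m.+1) p i * p (m - i)%N) * x ^+ m) =
  (fun N => series (fun k => p k * x ^+ k) N * series (fun k => p k * x ^+ k) N) -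
  (fun N => series (fun k => p k * x ^+ k) N * series (fun k => p k * x ^+ k) N
    - series (fun m => (\sum_(i < m.+1) p i * p (m - i)%N) * x ^+ m) N) by exact: H.
by apply/funext => N; rewrite !fctE opprB addrC subrK.
Qed.

(** After division by g 0, a small radius s makes the remaining terms add up to at most 1, as
    [sqrt_coef_bound] requires. The root so obtained is the positive one because its value at 0
    is 1. *)
Lemma sqrt_series (g : nat -> R) rho : pconv g rho -> 0 < g 0%N ->
  exists p r, [/\ pconv p r, r <= rho &
    forall x, `|x| < r -> 0 < psum g x /\ psum p x = Num.sqrt (psum g x)].
Proof.
move=> [r0 H] g0.
have [||U HU] := H (rho / 2); [by rewrite divr_gt0 | by rewrite ltr_pdivrMr // ltr_pMr // ltr1n |].
have r2 : 0 < rho / 2 by rewrite divr_gt0.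
have U0 := pbound_ge0 r2 HU.
pose u k := g k / g 0%N; pose V := U / g 0%N.
have V0 : 0 <= V by rewrite divr_ge0 // ltW.
have Hu : pbound u (rho / 2) V.
  by move=> k; rewrite /u /V normrM normfV (gtr0_norm g0) mulrAC ler_wpM2r // invr_ge0 ltW.
pose q := (2 * (V + 1))^-1; pose s := q * (rho / 2).
have q_gt0 : 0 < q by rewrite invr_gt0 mulr_gt0 // ltr_wpDl.
have q_half : q <= 2^-1 by rewrite lef_pV2 ?posrE ?mulr_gt0 ?ltr_wpDl // ler_peMr // lerDr.
have s0 : 0 < s by rewrite mulr_gt0.
have W N : \sum_(1 <= m < N.+1) `|u m| * s ^+ m <= 1.
  apply: (@le_trans _ _ (\sum_(1 <= m < N.+1) V * q ^+ m)).
    apply: ler_sum => m _; rewrite /s exprMn mulrCA mulrC ler_wpM2r ?exprn_ge0 ?(ltW q_gt0) //.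
  have E : (\sum_(1 <= m < N.+1) V * q ^+ m) * (1 - q) = V * (q - q ^+ N.+1).
    elim: N => [|N IH]; first by rewrite big_geq // mul0r expr1 subrr mulr0.
    by rewrite big_nat_recr //= mulrDl IH [q ^+ N.+2]exprS; ring.
  have q1 : 0 < 1 - q by rewrite subr_gt0 (le_lt_trans q_half) // invf_lt1 // ltr1n.
  rewrite -(ler_pM2r q1) E mul1r; apply: (@le_trans _ _ (V * q)).
    by rewrite ler_wpM2l // gerBl exprn_ge0 // ltW.
  have : (2 * (V + 1)) * q = 1 by rewrite mulfV // gt_eqF // mulr_gt0 // ltr_wpDl.
  nra.
have Hp := sqrt_coef_bound s0 W.
pose a := Num.sqrt (g 0%N); have a0 : 0 < a by rewrite sqrtr_gt0.
exists (fun k => a * sqrt_coef u k), (s / 4); have s4 : 0 < s / 4 by rewrite divr_gt0.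
have srho : s / 4 < rho by rewrite /s; have := ler_pM (ltW q_gt0) (ltW r2) q_half (lexx _); nra.
have cp : pconv (sqrt_coef u) (s / 4).
  by apply: pconv_le (pbound_pconv s0 Hp) => //; rewrite ler_pdivrMr // ler_peMr ?(ltW s0) // ler1n.
split; [exact: pconv_scale | exact: ltW |] => x xs.
have xr : `|x| < rho by exact: lt_trans srho.
have u0 : u 0%N = 1 by rewrite /u mulfV // gt_eqF.
have sq : psum (sqrt_coef u) x ^+ 2 = psum u x.
  rewrite (_ : psum u x = psum (fun m => \sum_(i < m.+1) sqrt_coef u i * sqrt_coef u (m - i)%N) x).
    by apply/esym/psum_uniq/(cauchy_square s0 Hp); exact: ltW.
  by congr psum; apply/funext => m; rewrite sqrt_coef_sq.
have pg : psum g x = g 0%N * psum u x.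
  have cu : pconv u rho by apply: pconv_ext (pconv_scale (g 0%N)^-1 (conj r0 H)) => k; rewrite mulrC.
  rewrite -(psum_scale _ cu xr); congr psum; apply/funext => k.
  by rewrite /u mulrCA mulfV ?mulr1 // gt_eqF.
have pos : 0 < psum (sqrt_coef u) x.
  have := @psumE_near0 _ _ _ _ x s0 Hp _.
  rewrite /sqrt_coef /= => N1; have {N1} : `|psum (sqrt_coef u) x - 1| <= `|x| * (2 * (1 / s)).
    by apply: N1; apply: le_trans (ltW xs) _; rewrite ler_pM2l // lef_pV2 ?posrE // ler_nat.
  have : `|x| * (2 * (1 / s)) <= 2^-1.
    rewrite mul1r mulrA ler_pdivrMr //; move: xs; rewrite ltr_pdivlMr //; lra.
  move=> h1 h2; have := le_trans h2 h1; rewrite ler_norml => /andP[]; lra.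
rewrite pg -sq; split; first by rewrite mulr_gt0 // exprn_gt0.
by rewrite (psum_scale _ cp xs) sqrtrM ?ltW // sqrtr_sqr gtr0_norm.
Qed.
End sqrt_series.

(** * Regrouping multi-index series by degree *)

Section cnorm.
Variable R : realType.
Implicit Types c d : R[i].

(** The norm of R[i] takes its values in R[i]; here it is a real number. *)
Definition cnorm c : R := complex.Re `|c|.

Lemma cnormE c : `|c| = (cnorm c)%:C.
Proof. by rewrite /cnorm normc_def. Qed.

Lemma cnorm_def c : cnorm c = Num.sqrt (complex.Re c ^+ 2 + complex.Im c ^+ 2).
Proof. by rewrite /cnorm normc_def. Qed.

Lemma cnorm_ge0 c : 0 <= cnorm c.
Proof. by rewrite cnorm_def sqrtr_ge0. Qed.

Lemma cnormM c d : cnorm (c * d) = cnorm c * cnorm d.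
Proof. by have := normrM c d; rewrite !cnormE -rmorphM /= => -[]. Qed.

Lemma cnormD c d : cnorm (c + d) <= cnorm c + cnorm d.
Proof. by have := ler_normD c d; rewrite !cnormE -rmorphD /= lecR. Qed.

Lemma cnormN c : cnorm (- c) = cnorm c.
Proof. by rewrite /cnorm normrN. Qed.

Lemma cnorm0 : cnorm 0 = 0.
Proof. by rewrite /cnorm normr0. Qed.

Lemma cnormJ c : cnorm (conjc c) = cnorm c.
Proof. by case: c => a b; rewrite !cnorm_def /= sqrrN. Qed.

Lemma cnorm_real (r : R) : cnorm r%:C = `|r|.
Proof. by rewrite cnorm_def /= expr0n addr0 sqrtr_sqr. Qed.

Lemma cnorm_sum (I : Type) (r : seq I) (F : I -> R[i]) :
  cnorm (\sum_(i <- r) F i) <= \sum_(i <- r) cnorm (F i).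
Proof.
elim: r => [|i r IH]; rewrite ?big_nil ?big_cons ?cnorm0 //.
by apply: le_trans (cnormD _ _) _; rewrite lerD2l.
Qed.

Lemma Re_cnorm c : `|complex.Re c| <= cnorm c.
Proof. by rewrite cnorm_def -sqrtr_sqr ler_wsqrtr // lerDl sqr_ge0. Qed.

Lemma Im_cnorm c : `|complex.Im c| <= cnorm c.
Proof. by rewrite cnorm_def -sqrtr_sqr ler_wsqrtr // lerDr sqr_ge0. Qed.

Lemma ccvgP (u : nat -> R[i]) c : ((u : nat -> R[i]^o) @ \oo --> (c : R[i]^o)) <->
  forall e : R, 0 < e -> exists N, forall k, (N <= k)%N -> cnorm (u k - c) < e.
Proof.
split.
  move/cvgrPdist_lt => H e e0; have ec : 0 < e%:C :> R[i] by rewrite ltcR.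
  have [N _ HN] := H _ ec; exists N => k /HN /=.
  by rewrite distrC [`|_|]cnormE ltcR.
move=> H; apply/cvgrPdist_lt => -[e e']; rewrite ltcE /= => /andP[/eqP -> e0].
have [N HN] := H _ e0; exists N => // k /HN /=.
by rewrite distrC [`|_|]cnormE ltcR.
Qed.
End cnorm.

Section regroup.
Variables (R : realType) (n : nat).
Implicit Types (N m : nat).
Notation idx := (multi_index n * multi_index n)%type.

(** The index set of [series_box], as a duplicate-free list: regrouping then becomes a
    permutation of lists. *)
Definition box N : seq idx :=
  map (fun pq : {ffun 'I_n -> 'I_N} * {ffun 'I_n -> 'I_N} =>
    ([ffun j => pq.1 j : nat], [ffun j => pq.2 j : nat]))
  (enum {: {ffun 'I_n -> 'I_N} * {ffun 'I_n -> 'I_N}}).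

Definition deg (x : idx) : nat := (\sum_j x.1 j + \sum_j x.2 j)%N.

Lemma box_uniq N : uniq (box N).
Proof.
rewrite map_inj_uniq ?enum_uniq // => -[p q] [p' q'] /= [/ffunP E /ffunP E'].
congr pair; apply/ffunP => j; apply: val_inj.
  by have := E j; rewrite !ffunE.
by have := E' j; rewrite !ffunE.
Qed.

Lemma mem_box N (x : idx) : reflect (forall j, (x.1 j < N)%N /\ (x.2 j < N)%N) (x \in box N).
Proof.
apply: (iffP mapP) => [[[p q] _ ->] j|H]; first by rewrite /= !ffunE.
exists ([ffun j => Ordinal (proj1 (H j))], [ffun j => Ordinal (proj2 (H j))]).
  by rewrite mem_enum.
by rewrite [LHS]surjective_pairing; congr pair; apply/ffunP => j; rewrite !ffunE.
Qed.

Lemma coord_le_deg (x : idx) j : (x.1 j <= deg x)%N /\ (x.2 j <= deg x)%N.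
Proof.
rewrite /deg; split.
  by rewrite (bigD1 j) //= -addnA leq_addr.
by rewrite addnC (bigD1 j) //= -addnA leq_addr.
Qed.

Lemma mem_box_deg N (x : idx) : (deg x < N)%N -> x \in box N.
Proof.
move=> dN; apply/mem_box => j; have [h1 h2] := coord_le_deg x j.
by split; apply: leq_ltn_trans dN.
Qed.

Definition hom N : seq idx := [seq x <- box N | (deg x < N)%N].
Definition layer m : seq idx := [seq x <- box m.+1 | deg x == m].

Lemma mem_hom N x : (x \in hom N) = (deg x < N)%N.
Proof. by rewrite mem_filter; case: ltnP => // /mem_box_deg ->. Qed.

Lemma mem_layer m x : (x \in layer m) = (deg x == m).
Proof. by rewrite mem_filter; case: eqP => //= <-; rewrite mem_box_deg. Qed.

Lemma hom_uniq N : uniq (hom N). Proof. by rewrite filter_uniq ?box_uniq. Qed.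
Lemma layer_uniq N : uniq (layer N). Proof. by rewrite filter_uniq ?box_uniq. Qed.

Lemma sum_hom (V : nmodType) (t : idx -> V) N :
  \sum_(x <- hom N) t x = \sum_(0 <= m < N) \sum_(x <- layer m) t x.
Proof.
elim: N => [|N IH].
  rewrite big_geq // big1_seq // => x /andP[_]; by rewrite mem_hom.
rewrite big_nat_recr //= -IH -big_cat; apply: perm_big; apply: uniq_perm.
- exact: hom_uniq.
- rewrite cat_uniq hom_uniq layer_uniq andbT /=; apply/hasPn => x.
  by rewrite mem_layer mem_hom => /eqP ->; rewrite ltnn.
- by move=> x; rewrite mem_cat !mem_hom mem_layer ltnS leq_eqVlt orbC.
Qed.

Lemma series_boxE a (z w : Cvec R n) N :
  series_box a z w N = \sum_(x <- box N) series_term a z w x.1 x.2.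
Proof. by rewrite /series_box pair_big /= big_map big_enum. Qed.

Lemma summable_bound (t : idx -> R) : (forall x, 0 <= t x) ->
  summable [set: idx] (fun x => (t x)%:E) <->
  exists M : R, forall s : seq idx, uniq s -> \sum_(x <- s) t x <= M.
Proof.
move=> t0; rewrite /summable; split.
  move=> H; have : (0 <= \esum_(x in [set: idx]) `|(t x)%:E|)%E by apply: esum_ge0.
  move: H; case E : (\esum_(x in [set: idx]) `|(t x)%:E|)%E => [M| |] // _ _.
  exists M => s us; rewrite -lee_fin -E; apply: esum_ge; exists [set` s].
    by split => //; exact: finite_seq.
  rewrite -fsbig_seq // -sumEFin; apply: lee_sum => x _.
  by rewrite /= lee_fin ler_norm.
move=> [M HM]; apply: (@le_lt_trans _ _ M%:E); last exact: ltry.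
apply: ge_ereal_sup => _ [X [finX _] <-].
rewrite fsbig_finite //= sumEFin lee_fin.
have H := HM _ (finmap.fset_uniq (fset_set X)); apply: le_trans H; 
by apply: ler_sum => x _; rewrite ger0_norm.
Qed.

(** A finite family that nearly attains the supremum of the partial sums is disjoint from any
    family of larger degree, so the latter contributes little. *)
Lemma summable_small (t : idx -> R) (M e : R) : (forall x, 0 <= t x) ->
  (forall s : seq idx, uniq s -> \sum_(x <- s) t x <= M) -> 0 < e ->
  exists N0, forall s : seq idx, uniq s -> (forall x, x \in s -> (N0 <= deg x)%N) ->
    \sum_(x <- s) t x < e.
Proof.
move=> t0 HM e0.
pose A := [set \sum_(x <- s) t x | s in [set s : seq idx | uniq s]].
have hA : has_sup A.
  split; first by exists 0; exists [::] => //; rewrite big_nil.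
  by exists M => _ [s us <-]; exact: HM.
have [_ [s0 us0 <-] Hs0] := sup_adherent e0 hA.
exists (\max_(x <- s0) deg x).+1 => s us Hs.
have : \sum_(x <- s0 ++ s) t x <= sup A.
  apply: ub_le_sup; first by case: hA.
  exists (s0 ++ s) => //=; rewrite cat_uniq us0 us andbT /=.
  apply/hasPn => x /Hs; apply: contraL => xs0; rewrite -leqNgt.
  by apply: leq_bigmax_seq.
rewrite big_cat /=; lra.
Qed.

(** The part of degree m of the series: scaling both variables by c multiplies it by c ^+ m. *)
Definition hsum a (z w : Cvec R n) m : R[i] :=
  \sum_(x <- layer m) series_term a z w x.1 x.2.

(** Boxes and sets of bounded degree differ by indices of large degree only. *)
Lemma has_sum_hsum a (z w : Cvec R n) (S : R[i]) : has_sum a z w S ->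
  forall e, 0 < e -> exists N, forall k, (N <= k)%N ->
    cnorm (\sum_(0 <= m < k) hsum a z w m - S) < e.
Proof.
move=> [Hs /ccvgP HS] e e0.
have t0 (x : idx) : 0 <= cnorm (series_term a z w x.1 x.2) by exact: cnorm_ge0.
have [M HM] := (summable_bound t0).1 Hs.
have e2 : 0 < e / 2 by rewrite divr_gt0.
have [N1 HN1] := summable_small t0 HM e2.
have [N2 HN2] := HS _ e2.
exists (maxn N1 N2) => k; rewrite geq_max => /andP[k1 k2].
have -> : \sum_(0 <= m < k) hsum a z w m = \sum_(x <- hom k) series_term a z w x.1 x.2.
  by rewrite sum_hom.
set A := \sum_(_ <- _) _.
have -> : A - S = (A - series_box a z w k) + (series_box a z w k - S) by rewrite addrA subrK.
apply: le_lt_trans (cnormD _ _) _; rewrite [e]splitr; apply: ltrD; last exact: HN2.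
rewrite series_boxE (bigID (fun x => deg x < k)%N) /= -[in X in _ - (X + _)]big_filter -/(hom k) -/A.
rewrite opprD addrA subrr add0r cnormN -big_filter; apply: le_lt_trans (cnorm_sum _ _) _.
apply: HN1; first by rewrite filter_uniq ?box_uniq.
by move=> x; rewrite mem_filter -leqNgt => /andP[kx _]; apply: leq_trans kx.
Qed.

Lemma monomialZ (p : multi_index n) (c : R[i]) (z : Cvec R n) :
  monomial p (c *: z) = c ^+ (\sum_j p j)%N * monomial p z.
Proof.
rewrite /monomial -prodrXr -big_split /=; apply: eq_bigr => j _.
by rewrite mxE exprMn.
Qed.

Lemma hsumZ a c (z w : Cvec R n) m : hsum a (c *: z) (c *: w) m = c ^+ m * hsum a z w m.
Proof.
rewrite /hsum mulr_sumr big_seq [RHS]big_seq; apply: eq_bigr => x.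
rewrite mem_layer => /eqP <-; rewrite /series_term /deg !monomialZ exprD; ring.
Qed.

(** On a complex line the series is a power series in the parameter of the line, so that
    one-variable results apply. *)
Lemma has_sum_line a (c : R[i]) (z w : Cvec R n) (S : R[i]) :
  has_sum a (c *: z) (c *: w) S ->
  series (fun m => complex.Re (c ^+ m * hsum a z w m)) @ \oo --> complex.Re S /\
  series (fun m => complex.Im (c ^+ m * hsum a z w m)) @ \oo --> complex.Im S.
Proof.
move=> /has_sum_hsum H.
have E k : \sum_(0 <= m < k) c ^+ m * hsum a z w m = \sum_(0 <= m < k) hsum a (c *: z) (c *: w) m.
  by apply: eq_bigr => m _; rewrite hsumZ.
have ER k : series (fun m => complex.Re (c ^+ m * hsum a z w m)) k =
    complex.Re (\sum_(0 <= m < k) hsum a (c *: z) (c *: w) m).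
  by rewrite -E /series /= raddf_sum.
have EI k : series (fun m => complex.Im (c ^+ m * hsum a z w m)) k =
    complex.Im (\sum_(0 <= m < k) hsum a (c *: z) (c *: w) m).
  by rewrite -E /series /= raddf_sum.
split; apply/cvgrPdist_lt => e /H [N HN]; exists N => // k /HN /=.
  by apply: le_lt_trans; rewrite distrC ER -raddfB; exact: Re_cnorm.
by apply: le_lt_trans; rewrite distrC EI -raddfB; exact: Im_cnorm.
Qed.

End regroup.

(** * Restriction to lines and the local dual *)

Section analytic_lines.
Variables (R : realType) (n : nat).
Implicit Types (z u v w : Cvec R n) (U : set (Cvec R n)).

Lemma conjvZ (c : R[i]) v : conjv (c *: v) = conjc c *: conjv v.
Proof. by apply/matrixP => j k; rewrite !mxE rmorphM. Qed.

Lemma conjv_real (t : R) v : conjv (t%:C *: v) = t%:C *: conjv v.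
Proof. by rewrite conjvZ; congr (_ *: _); rewrite /= oppr0. Qed.

Lemma Re_realX (t : R) (c : R[i]) m : complex.Re (t%:C ^+ m * c) = complex.Re c * t ^+ m.
Proof. by rewrite -rmorphXn; case: c => a b; simpc => /=; rewrite mulrC. Qed.

Lemma Im_realX (t : R) (c : R[i]) m : complex.Im (t%:C ^+ m * c) = complex.Im c * t ^+ m.
Proof. by rewrite -rmorphXn; case: c => a b; simpc => /=; rewrite mulrC. Qed.

Lemma analytic_line U (Phi : Cvec R n -> R) z v : real_analytic U Phi -> U z ->
  exists c rho, pconv c rho /\ forall t : R, `|t| < rho -> Phi (z + t%:C *: v) = psum c t.
Proof.
move=> H /H [a /near_line Ha].
have /nbhs_ballP [r /= r0 Hr] := Ha v.
pose c m := complex.Re (hsum a v (conjv v) m).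
have C (t : R) : `|t| < r -> series (fun k => c k * t ^+ k) @ \oo --> Phi (z + t%:C *: v).
  move=> tr; have /Hr : ball (0 : R) r t by rewrite /ball /= sub0r normrN.
  rewrite addrC addKr conjv_real => /has_sum_line[/= L _].
  rewrite (_ : (fun k => c k * t ^+ k) = (fun m => complex.Re (t%:C ^+ m * hsum a v (conjv v) m))) //.
  by apply/funext => m; rewrite Re_realX.
exists c, r; split; last by move=> t /C /psum_uniq.
apply: cvg_pconv => // x x0 xr; apply/cvg_ex; exists (Phi (z + x%:C *: v)); apply: C.
by rewrite gtr0_norm.
Qed.

Lemma cvg_uphalf (s : nat -> R) (l : R) : s @ \oo --> l -> (fun N => s (uphalf N)) @ \oo --> l.
Proof.
move=> /cvgrPdist_lt H; apply/cvgrPdist_lt => e /H [N _ HN]; exists (2 * N)%N => // k /= kN.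
apply: HN => /=; rewrite uphalf_half; apply: leq_trans (leq_addl _ _).
by rewrite -(doubleK N) half_leq // -mul2n.
Qed.

(** The coefficients of x |-> psum c (a * x ^+ 2). *)
Definition even_coefs (c : nat -> R) (a : R) (m : nat) : R :=
  if odd m then 0 else c m./2 * a ^+ m./2.

Lemma series_even_coefs (c : nat -> R) (a x : R) N :
  series (fun m => even_coefs c a m * x ^+ m) N =
  series (fun k => c k * (a * x ^+ 2) ^+ k) (uphalf N).
Proof.
rewrite /series /=; elim: N => [|N IH]; first by rewrite !big_geq.
rewrite big_nat_recr //= IH /even_coefs uphalf_half; case E : (odd N) => /=.
  by rewrite mul0r addr0 add1n.
rewrite add0n big_nat_recr //=; congr (_ + _).
rewrite exprMn -exprM mulrA; congr (_ * _ ^+ _).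
by rewrite -[LHS]odd_double_half E add0n mul2n.
Qed.

(** With u = i z one has (z, - zbar) = - i (u, ubar): the value - Phi' z is that of the series
    of Phi at the parameter t = - i of the complex line through (u, ubar). For real t the series
    equals f (t^2 |z|^2), so its coefficients are those of f in even degrees, and t = - i
    changes the sign of t^2. *)
Lemma dual_radial (Phi Phi' : Cvec R n -> R) (f : R -> R) (a : multi_index n -> multi_index n -> R[i]) :
  (\forall z \near (0 : Cvec R n), Phi z = f (normsq z)) -> analytic_near0 f ->
  (\forall z \near (0 : Cvec R n), has_sum a z (conjv z) (Phi z)%:C /\
     has_sum a z (- conjv z) (- Phi' z)%:C) ->
  \forall z \near (0 : Cvec R n), Phi' z = - f (- normsq z).
Proof.
move=> nPhi /analytic_psum[c [rho [cc Hf]]] Ha.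
have /nbhs_normsqP[d d0 Hd] : \forall z \near (0 : Cvec R n), Phi z = f (normsq z) /\
    (has_sum a z (conjv z) (Phi z)%:C /\ has_sum a z (- conjv z) (- Phi' z)%:C).
  exact: filterI.
have r0 := cc.1.
apply/nbhs_normsqP; exists (Num.min d rho); first by rewrite lt_min d0.
move=> z; rewrite subr0 lt_min => /andP[zd zr].
pose u := 'i *: z.
have zu : z = (- 'i) *: u by rewrite /u scalerA mulNr -expr2 sqr_i opprK scale1r.
have nu : normsq u = normsq z by rewrite /u normsqZc /=; ring.
pose e m := hsum a u (conjv u) m.
have z0 := normsq_ge0 z.
have Eline (t : R) : `|t| < 1 ->
   series (fun m => complex.Re (e m) * t ^+ m) @ \oo --> psum c (normsq z * t ^+ 2) /\
   series (fun m => complex.Im (e m) * t ^+ m) @ \oo --> (0 : R).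
  move=> t1; have t2 : t ^+ 2 <= 1 by rewrite -real_normK ?num_real // expr_le1 // ltW.
  have nt : normsq (t%:C *: u) = normsq z * t ^+ 2 by rewrite normsqZ nu mulrC.
  have lt : normsq z * t ^+ 2 <= normsq z by rewrite ler_piMr.
  have [|E [H _]] := Hd (t%:C *: u); first by rewrite subr0 nt (le_lt_trans lt zd).
  move: H; rewrite conjv_real => /has_sum_line [/= L1 L2].
  rewrite E nt Hf in L1; last by rewrite (ger0_norm (mulr_ge0 z0 (sqr_ge0 t))) (le_lt_trans lt zr).
  split; [move: L1 | move: L2];
  set s1 := series _; set s2 := series _; suff -> : s1 = s2 by [].
    by apply/funext => k; rewrite /s1 /s2 /series /=; apply: eq_bigr => m _; rewrite Re_realX.
  by apply/funext => k; rewrite /s1 /s2 /series /=; apply: eq_bigr => m _; rewrite Im_realX.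
have pR : pconv (fun m => complex.Re (e m)) 1.
  apply: cvg_pconv => // t t0 t1; apply/cvg_ex; eexists.
  by apply: (Eline t _).1; rewrite gtr0_norm.
have pI : pconv (fun m => complex.Im (e m)) 1.
  apply: cvg_pconv => // t t0 t1; apply/cvg_ex; eexists.
  by apply: (Eline t _).2; rewrite gtr0_norm.
have Leven (t : R) : `|t| < 1 -> series (fun m => even_coefs c (normsq z) m * t ^+ m) @ \oo -->
    psum c (normsq z * t ^+ 2).
  move=> t1; have t2 : t ^+ 2 <= 1 by rewrite -real_normK ?num_real // expr_le1 // ltW.
  have lt : normsq z * t ^+ 2 <= normsq z by rewrite ler_piMr.
  rewrite (_ : series _ = fun N => series (fun k => c k * (normsq z * t ^+ 2) ^+ k) (uphalf N)); last first.
    by apply/funext => N; rewrite series_even_coefs.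
  apply: cvg_uphalf; apply: (pconv_psum_cvg cc).
  by rewrite (ger0_norm (mulr_ge0 z0 (sqr_ge0 t))) (le_lt_trans lt zr).
have pE : pconv (even_coefs c (normsq z)) 1.
  apply: cvg_pconv => // t t0 t1; apply/cvg_ex; eexists.
  by apply: (Leven t _); rewrite gtr0_norm.
have sample (q : R) : 0 < q -> exists2 x : R, 0 < `|x| < q & `|x| < 1.
  move=> q0; exists (Num.min q 1 / 2); have h : 0 < Num.min q 1 by rewrite lt_min q0 ltr01.
    rewrite gtr0_norm ?divr_gt0 //= ltr_pdivrMr // (le_lt_trans (_ : _ <= q)) ?ge_min ?lexx //.
    by rewrite ltr_pMr // ltr1n.
  rewrite gtr0_norm ?divr_gt0 //= ltr_pdivrMr // (le_lt_trans (_ : _ <= 1)) ?ge_min ?lexx ?orbT //.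
  by rewrite mul1r ltr1n.
have Re_e : forall m, complex.Re (e m) = even_coefs c (normsq z) m.
  apply: (psum_inj pR pE) => q /sample[x xq x1]; exists x => //.
  by rewrite (psum_uniq (Eline _ x1).1) (psum_uniq (Leven _ x1)).
have Im_e : forall m, complex.Im (e m) = 0.
  apply: (psum_eq0 pI) => q /sample[x xq x1]; exists x => //.
  by rewrite (psum_uniq (Eline _ x1).2).
have [|_ [_ H]] := Hd z; first by rewrite subr0.
have cz : - conjv z = (- 'i) *: conjv u.
  rewrite /u conjvZ scalerA -[LHS]scaleN1r; congr (_ *: _).
  by apply/eqP; rewrite eq_complex /=; apply/andP; split; apply/eqP; ring.
rewrite {1}zu cz in H; have [/= L _] := has_sum_line H.
have L2 : series (fun m => complex.Re ((- 'i) ^+ m * hsum a u (conjv u) m)) @ \oo -->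
    psum c (- normsq z).
  rewrite (_ : (fun m => complex.Re _) = (fun m => even_coefs c (- normsq z) m * 1 ^+ m)).
    rewrite (_ : series _ = fun N => series (fun k => c k * (- normsq z * 1 ^+ 2) ^+ k) (uphalf N)); last first.
      by apply/funext => N; rewrite series_even_coefs.
    apply: cvg_uphalf; rewrite expr1n mulr1; apply: (pconv_psum_cvg cc).
    by rewrite normrN ger0_norm.
  apply/funext => m; have -> : hsum a u (conjv u) m = (even_coefs c (normsq z) m)%:C.
    by rewrite -/(e m) -Re_e; have := Im_e m; case: (e m) => p q /= ->.
  rewrite expr1n mulr1 /even_coefs; case E : (odd m); first by rewrite mulr0.
  rewrite -[m in LHS](odd_double_half m) E add0n -mul2n exprM sqrrN sqr_i mul2n doubleK.
  by rewrite [(- normsq z) ^+ _]exprNn -(rmorphN1 (@real_complex R)) -rmorphXn -rmorphM /= mulrCA.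
rewrite Hf ?normrN ?ger0_norm //.
have := cvg_lim (@Rhausdorff R) L2; rewrite (cvg_lim (@Rhausdorff R) L) => <-.
by rewrite opprK.
Qed.
End analytic_lines.

(** * Real analyticity of power series in the squared norm *)

Section monomial_lists.
Variables (R : realType) (n : nat).
Notation idx := (multi_index n * multi_index n)%type.
Notation mono := (R[i] * idx)%type.
Implicit Types (h w z : Cvec R n) (l : seq mono) (x y : idx) (m : mono).

Definition mval h w x : R[i] := monomial x.1 h * monomial x.2 w.
Definition ev h w l : R[i] := \sum_(m <- l) m.1 * mval h w m.2.
(** Polynomials in (h, w) are kept as lists of monomials, without collecting terms, because the
    sum of the absolute values of the terms is then multiplicative ([av_mull]). *)
Definition av h w l : R := \sum_(m <- l) cnorm (m.1 * mval h w m.2).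

Definition addx x y : idx := ([ffun j => (x.1 j + y.1 j)%N], [ffun j => (x.2 j + y.2 j)%N]).
Definition mulm m m' : mono := (m.1 * m'.1, addx m.2 m'.2).
Definition mull l l' : seq mono := [seq mulm m m' | m <- l, m' <- l'].

Lemma monomialD (p q : multi_index n) h :
  monomial [ffun j => (p j + q j)%N] h = monomial p h * monomial q h.
Proof.
by rewrite /monomial -big_split /=; apply: eq_bigr => j _; rewrite ffunE exprD.
Qed.

Lemma mvalD h w x y : mval h w (addx x y) = mval h w x * mval h w y.
Proof. by rewrite /mval !monomialD; ring. Qed.

Lemma ev_mull h w l l' : ev h w (mull l l') = ev h w l * ev h w l'.
Proof.
rewrite /ev big_allpairs_dep mulr_suml; apply: eq_bigr => m _.
by rewrite mulr_sumr; apply: eq_bigr => m' _; rewrite /= mvalD; ring.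
Qed.

Lemma av_mull h w l l' : av h w (mull l l') = av h w l * av h w l'.
Proof.
rewrite /av big_allpairs_dep mulr_suml; apply: eq_bigr => m _.
rewrite mulr_sumr; apply: eq_bigr => m' _; rewrite /= mvalD -cnormM; congr cnorm; ring.
Qed.

Definition zeroi : multi_index n := [ffun=> 0%N].
Definition uniti (j : 'I_n) : multi_index n := [ffun k => (k == j) : nat].

Lemma monomial0 h : monomial zeroi h = 1.
Proof. by rewrite /monomial big1 // => j _; rewrite ffunE expr0. Qed.

Lemma monomial1 j h : monomial (uniti j) h = h j 0.
Proof.
rewrite /monomial (bigD1 j) //= ffunE eqxx expr1 big1 ?mulr1 // => k kj.
by rewrite ffunE (negbTE kj) expr0.
Qed.

(** The expansion of sum_j (z_j + h_j) (conj z_j + w_j) in h and w. *)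
Definition normsq_list z : seq mono :=
  flatten [seq [:: ((z j 0 : R[i]) * conjc (z j 0), (zeroi, zeroi));
      (z j 0 : R[i], (zeroi, uniti j)); (conjc (z j 0), (uniti j, zeroi));
      (1, (uniti j, uniti j))] | j <- enum 'I_n].

Fixpoint normsq_pow z k : seq mono :=
  if k is k'.+1 then mull (normsq_list z) (normsq_pow z k') else [:: (1, (zeroi, zeroi))].

Lemma ev_normsq_list z h : ev h (conjv h) (normsq_list z) = (normsq (z + h))%:C.
Proof.
rewrite /ev big_flatten big_map big_enum /= -hdot_normsq /hdot; apply: eq_bigr => j _.
rewrite !big_cons big_nil /mval /= !monomial0 !monomial1 !mxE.
rewrite -[Num.conj _]/(conjc _) [conjc (_ + _)]rmorphD /=; ring.
Qed.

Lemma av_normsq_list z h w : av h w (normsq_list z) =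
  \sum_j (cnorm (z j 0) + cnorm (h j 0)) * (cnorm (z j 0) + cnorm (w j 0)).
Proof.
rewrite /av big_flatten big_map big_enum /=; apply: eq_bigr => j _.
rewrite !big_cons big_nil /mval /= !monomial0 !monomial1 !cnormM cnormJ !(cnorm_real 1) normr1.
ring.
Qed.

Lemma ev_normsq_pow z h k : ev h (conjv h) (normsq_pow z k) = (normsq (z + h) ^+ k)%:C.
Proof.
elim: k => [|k IH] /=; last by rewrite ev_mull ev_normsq_list IH -rmorphM exprS.
by rewrite /ev big_seq1 /mval /= !monomial0 !mul1r.
Qed.

Lemma av_normsq_pow z h w k : av h w (normsq_pow z k) = av h w (normsq_list z) ^+ k.
Proof.
elim: k => [|k IH] /=; last by rewrite av_mull IH exprS.
by rewrite /av big_seq1 /mval /= !monomial0 !mul1r (cnorm_real 1) normr1.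
Qed.

Lemma normsq_list_exp z m j : m \in normsq_list z -> (m.2.1 j <= 1)%N /\ (m.2.2 j <= 1)%N.
Proof.
move/flattenP => [s /mapP[k _ ->]].
by rewrite !inE => /or4P[] /eqP -> /=; rewrite !ffunE ?leq_b1.
Qed.

Lemma normsq_pow_box z k N m : (k < N)%N -> m \in normsq_pow z k -> m.2 \in box n N.
Proof.
move=> kN H; suff S : forall j, (m.2.1 j <= k)%N /\ (m.2.2 j <= k)%N.
  by apply/mem_box => j; have [h1 h2] := S j; split; apply: leq_ltn_trans kN.
elim: k m {kN} H => [|k IH] m /=; first by rewrite inE => /eqP -> j; rewrite /= !ffunE.
move/allpairsP => [[m1 m2] /= [H1 /IH H2 ->]] j; have [a1 a2] := normsq_list_exp j H1.
by have [b1 b2] := H2 j; rewrite /= !ffunE -add1n; split; apply: leq_add.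
Qed.

Definition coef l x : R[i] := \sum_(m <- l | m.2 == x) m.1.

Lemma sum_pick (V : nmodType) (s : seq idx) y (F : idx -> V) : uniq s ->
  \sum_(x <- s | y == x) F x = if y \in s then F y else 0.
Proof.
move=> us; rewrite (eq_bigl (pred1 y)) => [|x]; last by rewrite eq_sym.
case: ifPn => ys; first by rewrite -big_filter filter_pred1_uniq // big_seq1.
rewrite big_seq_cond big1 // => x /andP[xs /eqP xy]; by rewrite -xy xs in ys.
Qed.

Lemma ev_coef h w l (s : seq idx) : uniq s -> (forall m, m \in l -> m.2 \in s) ->
  \sum_(x <- s) coef l x * mval h w x = ev h w l.
Proof.
move=> us H; rewrite /ev /coef.
under eq_bigr do rewrite mulr_suml.
rewrite (exchange_big_dep xpredT) //= [LHS]big_seq [RHS]big_seq; apply: eq_bigr => m /H ms.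
by rewrite (sum_pick m.2 (fun x => m.1 * mval h w x) us) ms.
Qed.

Lemma av_coef h w l (s : seq idx) : uniq s ->
  \sum_(x <- s) cnorm (coef l x * mval h w x) <= av h w l.
Proof.
move=> us; rewrite /av.
apply: (@le_trans _ _ (\sum_(x <- s) \sum_(m <- l | m.2 == x) cnorm (m.1 * mval h w x))).
  apply: ler_sum => x _; rewrite /coef mulr_suml -big_filter -[leRHS]big_filter.
  exact: cnorm_sum.
rewrite (exchange_big_dep xpredT) //=; apply: ler_sum => m _.
rewrite (sum_pick m.2 (fun x => cnorm (m.1 * mval h w x)) us).
by case: ifP => // _; exact: cnorm_ge0.
Qed.

Definition constv (d : R) : Cvec R n := const_mx (d%:C : R[i]).

Lemma mval_constv (d : R) x : mval (constv d) (constv d) x = (d ^+ deg x)%:C.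
Proof.
have S (p : multi_index n) : monomial p (constv d) = (d ^+ (\sum_j p j)%N)%:C.
  rewrite /monomial -prodrXr rmorph_prod; apply: eq_bigr => j _.
  by rewrite mxE rmorphXn.
by rewrite /mval !S -rmorphM /deg exprD.
Qed.
End monomial_lists.

Section analytic_radial.
Variables (R : realType) (n : nat).
Notation idx := (multi_index n * multi_index n)%type.

(** Expand |z0 + h|^2 in h and hbar, then its powers, and collect. For |h_j| <= d the absolute
    values of the terms of the k-th power add up to at most X^k, where X = sum_j (|z0_j| + d)^2
    < rho; so the double series converges absolutely. *)
Lemma real_analytic_psum (p : nat -> R) (rho : R) (z0 : Cvec R n) :
  pconv p rho -> normsq z0 < rho ->
  exists a : multi_index n -> multi_index n -> R[i],
    \forall z \near z0, has_sum a (z - z0) (conjv (z - z0)) (psum p (normsq z))%:C.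
Proof.
move=> pc zr.
have [d d0 dr] : exists2 d : R, 0 < d &
    \sum_(j < n) (cnorm (z0 j 0) + d) * (cnorm (z0 j 0) + d) < rho.
  pose C : R := \sum_(j < n) (2 * cnorm (z0 j 0) + 1).
  have C0 : 0 <= C by apply: sumr_ge0 => j _; rewrite addr_ge0 ?mulr_ge0 ?cnorm_ge0.
  have z0E : normsq z0 = \sum_(j < n) cnorm (z0 j 0) ^+ 2.
    apply: eq_bigr => j _; rewrite cnorm_def sqr_sqrtr //; by rewrite addr_ge0 ?sqr_ge0.
  pose d := Num.min 1 ((rho - normsq z0) / (C + 1)).
  have d0 : 0 < d by rewrite lt_min ltr01 divr_gt0 ?subr_gt0 // ltr_wpDl.
  have d1 : d <= 1 by rewrite ge_min lexx.
  have dC : d * (C + 1) <= rho - normsq z0.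
    by rewrite -ler_pdivlMr ?ltr_wpDl // ge_min lexx orbT.
  exists d => //; apply: (@le_lt_trans _ _ (normsq z0 + d * C)).
    rewrite z0E /C mulr_sumr -big_split /=; apply: ler_sum => j _.
    have := cnorm_ge0 (z0 j 0); rewrite expr2; nra.
  by rewrite -ltrBrDl; apply: lt_le_trans dC; rewrite ltr_pM2l // ltrDl.
set X := \sum_(j < n) _ in dr.
have X0 : 0 <= X by apply: sumr_ge0 => j _; rewrite mulr_ge0 ?addr_ge0 ?cnorm_ge0 // ltW.
pose b k x := coef (normsq_pow z0 k) x.
have avX : av (constv n d) (constv n d) (normsq_list z0) = X.
  rewrite av_normsq_list; apply: eq_bigr => j _; rewrite !mxE.
  by rewrite cnorm_real gtr0_norm.
have bX k x : cnorm (b k x) * d ^+ deg x <= X ^+ k.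
  rewrite -avX -av_normsq_pow.
  have := @av_coef _ _ (constv n d) (constv n d) (normsq_pow z0 k) [:: x] isT.
  by rewrite big_seq1 cnormM mval_constv cnorm_real ger0_norm // exprn_ge0 // ltW.
have XR : `|X| < rho by rewrite ger0_norm.
have Mc := pconv_cvg_norm pc XR; set M := limn _ in Mc.
pose Mk K := \sum_(0 <= k < K) `|p k| * X ^+ k.
have MkE : Mk = series (fun k => `|p k * X ^+ k|).
  apply/funext => K; rewrite /Mk /series /=; apply: eq_bigr => k _.
  by rewrite normrM (ger0_norm (exprn_ge0 _ X0)).
have McE : Mk @ \oo --> M by rewrite MkE.
have Mle K : Mk K <= M.
  rewrite MkE; apply: nondecreasing_cvgn_le => //.
  by apply/nondecreasing_seqP => k; rewrite /series /= big_nat_recr //= lerDl.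
have dx x : 0 < d ^+ deg x by rewrite exprn_gt0.
have cvgpart (g : R[i] -> R) (G : forall c, `|g c| <= cnorm c) x :
    cvgn (series (fun k => p k * g (b k x))).
  apply: normed_cvg; rewrite /=.
  apply: (@series_le_cvg _ _ (fun k => (d ^+ deg x)^-1 * `|p k * X ^+ k|)) => //.
  - by move=> k /=; exact: normr_ge0.
  - by move=> k; rewrite mulr_ge0 // invr_ge0 ltW.
  - move=> k; rewrite /= [leRHS]mulrC ler_pdivlMr // !normrM -mulrA ler_wpM2l // (ger0_norm (exprn_ge0 _ X0)).
    by apply: le_trans (bX k x); rewrite ler_wpM2r // ltW.
  - exact: is_cvg_seriesZ.
pose a (q1 q2 : multi_index n) : R[i] :=
  limn (series (fun k => p k * complex.Re (b k (q1, q2)))) +i*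
  limn (series (fun k => p k * complex.Im (b k (q1, q2)))).
pose SK K x : R[i] := \sum_(0 <= k < K) (p k)%:C * b k x.
have SKa (x : idx) e : 0 < e -> exists K0, forall K, (K0 <= K)%N -> cnorm (SK K x - a x.1 x.2) < e.
  move=> e0; have e2 : 0 < e / 2 by rewrite divr_gt0.
  have Lr := cvgpart _ (@Re_cnorm R) x; have Li := cvgpart _ (@Im_cnorm R) x.
  move/cvgrPdist_lt: Lr => /(_ _ e2)[K1 _ H1]; move/cvgrPdist_lt: Li => /(_ _ e2)[K2 _ H2].
  exists (maxn K1 K2) => K; rewrite geq_max => /andP[/H1 k1 /H2 k2].
  have -> : SK K x - a x.1 x.2 = (complex.Re (SK K x - a x.1 x.2))%:C + 'i * (complex.Im (SK K x - a x.1 x.2))%:C.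
    by case: (SK K x - a x.1 x.2) => u v; simpc.
  apply: le_lt_trans (cnormD _ _) _; rewrite cnormM !cnorm_real.
  have -> : cnorm 'i = 1 :> R by rewrite cnorm_def /= expr0n expr1n add0r sqrtr1.
  rewrite mul1r !raddfB /= [e]splitr; apply: ltrD.
    move: k1; rewrite /= distrC -surjective_pairing; congr (`|_ - _| < _).
    rewrite /SK /series /= raddf_sum; apply: eq_bigr => k _ /=.
    by case: (b k x) => u v; simpc.
  move: k2; rewrite /= distrC -surjective_pairing; congr (`|_ - _| < _).
  rewrite /SK /series /= raddf_sum; apply: eq_bigr => k _ /=.
  by case: (b k x) => u v; simpc.
exists a.
apply/nbhs_normsqP; exists (d ^+ 2); first by rewrite exprn_gt0.
move=> z zd; set h := z - z0 in zd *.
have hd j : cnorm (h j 0) <= d.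
  rewrite -(ler_pXn2r (n := 2)) ?nnegrE ?cnorm_ge0 ?(ltW d0) // cnorm_def sqr_sqrtr; last first.
    by rewrite addr_ge0 ?sqr_ge0.
  apply: le_trans (ltW zd); rewrite /normsq (bigD1 j) //= lerDl.
  by apply: sumr_ge0 => i _; rewrite addr_ge0 ?sqr_ge0.
have hd' j : cnorm ((conjv h) j 0) <= d by rewrite mxE cnormJ.
have avh : av h (conjv h) (normsq_list z0) <= X.
  rewrite av_normsq_list; apply: ler_sum => j _.
  by apply: ler_pM; rewrite ?addr_ge0 ?cnorm_ge0 // lerD2l.
have avh0 l : 0 <= av h (conjv h) l by apply: sumr_ge0 => m _; exact: cnorm_ge0.
pose T := mval h (conjv h).
have tail (s : seq idx) K L : uniq s -> (K <= L)%N ->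
    \sum_(x <- s) cnorm (SK L x * T x - SK K x * T x) <= Mk L - Mk K.
  move=> us KL; have D (V : zmodType) (F : nat -> V) :
      \sum_(0 <= k < L) F k - \sum_(0 <= k < K) F k = \sum_(K <= k < L) F k.
    by rewrite (big_cat_nat _ (n := K)) //= addrAC subrr add0r.
  rewrite D; apply: (@le_trans _ _ (\sum_(x <- s) \sum_(K <= k < L) `|p k| * cnorm (b k x * T x))).
    apply: ler_sum => x _; rewrite -mulrBl D mulr_suml; apply: le_trans (cnorm_sum _ _) _.
    by apply: ler_sum => k _; rewrite -(mulrA (p k)%:C) [leLHS]cnormM cnorm_real.
  rewrite exchange_big /=; apply: ler_sum => k _; rewrite -mulr_sumr ler_wpM2l //.
  apply: le_trans (av_coef _ _ _ us) _; rewrite av_normsq_pow lerXn2r ?nnegrE //.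
have lims (s : seq idx) e : 0 < e -> exists L0, forall L, (L0 <= L)%N ->
    \sum_(x <- s) cnorm (a x.1 x.2 * T x - SK L x * T x) < e.
  elim: s e => [|x s IH] e e0; first by exists 0%N => L _; rewrite big_nil.
  have e2 : 0 < e / 2 by rewrite divr_gt0.
  have [L1 H1] := IH _ e2.
  have T0 : 0 < cnorm (T x) + 1 by rewrite ltr_wpDl ?cnorm_ge0.
  have [L2 H2] := SKa x (e / 2 / (cnorm (T x) + 1)) (divr_gt0 e2 T0).
  exists (maxn L1 L2) => L; rewrite geq_max => /andP[/H1 k1 /H2 k2].
  rewrite big_cons [e]splitr; apply: ltrD => //.
  rewrite -mulrBl cnormM -cnormN opprB.
  move: k2; rewrite ltr_pdivlMr //; apply: le_lt_trans.
  by rewrite ler_wpM2l ?cnorm_ge0 // lerDl.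
(* Truncating p at degree K costs at most the tail of the series sum_k |p_k| X^k. *)
have key (s : seq idx) K : uniq s -> \sum_(x <- s) cnorm (a x.1 x.2 * T x - SK K x * T x) <= M - Mk K.
  move=> us; apply/ler_addgt0Pr => e /(lims s)[L0 H].
  have {H} := H _ (leq_maxl L0 K); set L := maxn L0 K => H.
  have KL : (K <= L)%N by rewrite leq_maxr.
  apply: (@le_trans _ _ (\sum_(x <- s) (cnorm (SK L x * T x - SK K x * T x) + cnorm (a x.1 x.2 * T x - SK L x * T x)))).
    apply: ler_sum => x _.
    have -> : a x.1 x.2 * T x - SK K x * T x =
      (SK L x * T x - SK K x * T x) + (a x.1 x.2 * T x - SK L x * T x) by ring.
    exact: cnormD.
  rewrite big_split /=; apply: lerD; last exact: ltW.
  by apply: le_trans (tail _ _ _ us KL) _; rewrite lerD2r.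
have termE x : series_term a h (conjv h) x.1 x.2 = a x.1 x.2 * T x.
  by rewrite /series_term /T /mval mulrA.
split.
  apply/(@summable_bound _ _ (fun x => cnorm (series_term a h (conjv h) x.1 x.2))).
    by move=> x; exact: cnorm_ge0.
  exists (M - Mk 0) => s us; apply: le_trans (key s 0%N us).
  by apply: ler_sum => x _; rewrite termE /SK big_geq // mul0r subr0.
apply/ccvgP => e e0; have e2 : 0 < e / 2 by rewrite divr_gt0.
move/cvgrPdist_lt: McE => /(_ _ e2)[N1 _ H1].
have nz : `|normsq z| < rho.
  rewrite ger0_norm ?normsq_ge0 //; apply: le_lt_trans dr; apply: le_trans avh.
  have -> : normsq z = cnorm (ev h (conjv h) (normsq_list z0)).
    by rewrite ev_normsq_list /h addrC subrK cnorm_real ger0_norm ?normsq_ge0.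
  exact: cnorm_sum.
have := pconv_psum_cvg pc nz => /cvgrPdist_lt /(_ _ e2)[N2 _ H2].
exists (maxn N1 N2) => N; rewrite geq_max => /andP[/H1 k1 /H2 k2].
rewrite series_boxE.
have E : \sum_(x <- box n N) SK N x * T x = (series (fun k => p k * normsq z ^+ k) N)%:C.
  under eq_bigr do rewrite mulr_suml.
  rewrite exchange_big /= /series /= rmorph_sum big_nat_cond [RHS]big_nat_cond.
  apply: eq_bigr => k; rewrite andbT => /andP[_ kN].
  under eq_bigr do rewrite -mulrA.
  rewrite -mulr_sumr ev_coef ?box_uniq //; last by move=> m; exact: normsq_pow_box.
  by rewrite ev_normsq_pow /h addrC subrK -rmorphM.
have -> : \sum_(x <- box n N) series_term a h (conjv h) x.1 x.2 - (psum p (normsq z))%:C =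
   \sum_(x <- box n N) (a x.1 x.2 * T x - SK N x * T x) +
   (series (fun k => p k * normsq z ^+ k) N - psum p (normsq z))%:C.
  rewrite sumrB E rmorphB addrA subrK; congr (_ - _); apply: eq_bigr => x _; exact: termE.
apply: le_lt_trans (cnormD _ _) _; rewrite [e]splitr; apply: ltrD.
  apply: le_lt_trans (cnorm_sum _ _) _; apply: le_lt_trans (key _ _ (box_uniq _ _)) _.
  by apply: le_lt_trans k1; rewrite ler_norm.
by rewrite cnorm_real distrC.
Qed.
End analytic_radial.

(** * Derivatives of curves *)

Section vector_derivatives.
Variables (R : realType) (n : nat).
Implicit Types (f g : R -> R[i]) (F G : R -> Cvec R n) (u v w z : Cvec R n) (U : set (Cvec R n)).

Definition cder f (s : R) (d : R[i]) : Prop :=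
  is_derive s 1 (fun t => complex.Re (f t)) (complex.Re d) /\
  is_derive s 1 (fun t => complex.Im (f t)) (complex.Im d).

Definition vder F (s : R) (d : Cvec R n) : Prop := forall j, cder (fun t => F t j 0) s (d j 0).

Lemma cder_eq f g s c d : (forall t, f t = g t) -> c = d -> cder f s c -> cder g s d.
Proof. by move=> fg <- [H1 H2]; split; [apply: der_eq H1 | apply: der_eq H2] => // t; rewrite fg. Qed.

Lemma cder_cst s (c : R[i]) : cder (fun=> c) s 0.
Proof. by split; exact: der_cst. Qed.

Lemma cderD f g s c d : cder f s c -> cder g s d -> cder (fun t => f t + g t) s (c + d).
Proof.
move=> [a1 a2] [b1 b2]; split.
  by apply: der_eq (derD a1 b1) => [t|]; rewrite raddfD.
by apply: der_eq (derD a2 b2) => [t|]; rewrite raddfD.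
Qed.

Lemma cderM f g s c d : cder f s c -> cder g s d ->
  cder (fun t => f t * g t) s (c * g s + f s * d).
Proof.
move=> [a1 a2] [b1 b2]; split.
  apply: der_eq (derB (derM a1 b1) (derM a2 b2)) => [t|]; first by rewrite ReM.
  by rewrite ReD !ReM; ring.
apply: der_eq (derD (derM a1 b2) (derM a2 b1)) => [t|]; first by rewrite ImM.
by rewrite ImD !ImM; ring.
Qed.

Lemma cder_conj f s c : cder f s c -> cder (fun t => conjc (f t)) s (conjc c).
Proof.
move=> [a1 a2]; split; first by apply: der_eq a1 => [t|]; [case: (f t) | case: (c)].
by apply: der_eq (derN a2) => [t|]; [case: (f t) | case: (c)].
Qed.

Lemma cder_real (h : R -> R) (s d : R) : is_derive s 1 h d -> cder (fun t => (h t)%:C) s d%:C.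
Proof. by move=> H; split; [exact: H | exact: der_cst]. Qed.

Lemma cder_sum (I : Type) (r : seq I) (h : I -> R -> R[i]) (dh : I -> R[i]) s :
  (forall i, cder (h i) s (dh i)) ->
  cder (fun t => \sum_(i <- r) h i t) s (\sum_(i <- r) dh i).
Proof.
move=> H; split.
  apply: der_eq (der_sum r (fun i => (H i).1)) => [t|]; by rewrite raddf_sum.
apply: der_eq (der_sum r (fun i => (H i).2)) => [t|]; by rewrite raddf_sum.
Qed.

Lemma vder_cst s v : vder (fun=> v) s 0.
Proof. by move=> j; apply: cder_eq (cder_cst s _) => //; rewrite mxE. Qed.

Lemma vderZ f F s c u : cder f s c -> vder F s u ->
  vder (fun t => f t *: F t) s (c *: F s + f s *: u).
Proof. by move=> Hf HF j; apply: cder_eq (cderM Hf (HF j)) => [t|]; rewrite !mxE. Qed.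

Lemma cder_hdot F G s u v : vder F s u -> vder G s v ->
  cder (fun t => hdot (F t) (G t)) s (hdot u (G s) + hdot (F s) v).
Proof.
move=> HF HG; rewrite /hdot -big_split.
exact: (cder_sum _ (fun j => cderM (HF j) (cder_conj (HG j)))).
Qed.

Lemma der_normsq F s u : vder F s u ->
  is_derive s 1 (fun t => normsq (F t)) (2 * complex.Re (hdot u (F s))).
Proof.
move=> HF; have [H _] := cder_hdot HF HF.
apply: der_eq H => [t|]; first by rewrite hdot_normsq.
by rewrite (hdotC u (F s)) ReD; case: (hdot u (F s)) => a b /=; ring.
Qed.

Lemma vder_comb u v (a b : R -> R) (s da db : R) : is_derive s 1 a da -> is_derive s 1 b db ->
  vder (fun t => (a t)%:C *: u + (b t)%:C *: v) s (da%:C *: u + db%:C *: v).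
Proof.
move=> Ha Hb j; have H := cderD (cderM (cder_real Ha) (cder_cst s (u j 0)))
  (cderM (cder_real Hb) (cder_cst s (v j 0))).
apply: cder_eq H => [t|]; first by rewrite !mxE.
by rewrite !mulr0 !addr0 !mxE.
Qed.

Lemma smooth_C1 U (Psi : Cvec R n -> Cvec R n) j : smooth_map U Psi ->
  Ck_on 1 U (fun z => complex.Re (Psi z j 0)) /\ Ck_on 1 U (fun z => complex.Im (Psi z j 0)).
Proof. by move=> /(_ 1%N j). Qed.

Lemma vder_map U (Psi : Cvec R n -> Cvec R n) u v (a b : R -> R) (s da db : R) :
  open U -> smooth_map U Psi -> U ((a s)%:C *: u + (b s)%:C *: v) ->
  is_derive s 1 a da -> is_derive s 1 b db ->
  vder (fun t => Psi ((a t)%:C *: u + (b t)%:C *: v)) s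
    (tangent_map Psi ((a s)%:C *: u + (b s)%:C *: v) (da%:C *: u + db%:C *: v)).
Proof.
move=> oU sm Us Ha Hb j; have [C1 C2] := smooth_C1 j sm.
by rewrite mxE; split; [exact: (der_curve oU C1 Us Ha Hb) | exact: (der_curve oU C2 Us Ha Hb)].
Qed.

Lemma tangent_comb U (Psi : Cvec R n -> Cvec R n) z u v (a b : R) :
  open U -> smooth_map U Psi -> U z ->
  tangent_map Psi z (a%:C *: u + b%:C *: v) =
  a%:C *: tangent_map Psi z u + b%:C *: tangent_map Psi z v.
Proof.
move=> oU sm Uz; apply/matrixP => j k; rewrite !mxE /cdird.
have [C1 C2] := smooth_C1 j sm.
have L (p p' r r' : R) : (a * p + b * r) +i* (a * p' + b * r') =
    a%:C * (p +i* p') + b%:C * (r +i* r') by simpc.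
by rewrite -L; congr (_ +i* _); [exact: (dird_lin u v a b oU Uz C1) | exact: (dird_lin u v a b oU Uz C2)].
Qed.

Lemma tangent_eq (Psi : Cvec R n -> Cvec R n) z v d :
  vder (fun t => Psi (z + t%:C *: v)) 0 d -> tangent_map Psi z v = d.
Proof.
move=> H; apply/matrixP => j k; rewrite (ord1 k) mxE /cdird.
have [H1 H2] := H j.
rewrite (dird_eq (h := fun x => complex.Re (Psi x j 0)) H1).
by rewrite (dird_eq (h := fun x => complex.Im (Psi x j 0)) H2); case: (d j 0).
Qed.

Lemma cst_of_cder0 f (a b : R) : a <= b -> (forall t, a <= t <= b -> cder f t 0) -> f a = f b.
Proof.
move=> ab H; apply/eqP; rewrite eq_complex; apply/andP; split; apply/eqP.
  by apply: (cst_of_der0 (f := fun t => complex.Re (f t)) ab) => t /H[].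
by apply: (cst_of_der0 (f := fun t => complex.Im (f t)) ab) => t /H[].
Qed.
Lemma expi_der (m t : R) : cder (fun t => expi (m * t)) t ('i * m%:C * expi (m * t)).
Proof.
have dm : is_derive t 1 (fun t : R => m * t) m.
  by apply: der_eq (derZ m (der_id t)) => //; rewrite mulr1.
split; [have := der_comp (is_derive_cos (m * t)) dm | have := der_comp (is_derive_sin (m * t)) dm];
  apply: der_eq => //; rewrite /expi; simpc => /=; ring.
Qed.

(** The direction v is the component of z' orthogonal to z, rescaled. If z' = z or z' = - z this
    component is 0, and v = i z serves. *)
Lemma great_circle z z' : normsq z = normsq z' -> exists v t,
  [/\ normsq v = normsq z, complex.Re (hdot z v) = 0 & z' = (cos t)%:C *: z + (sin t)%:C *: v].
Proof.
move=> E; have [z0|z0] := eqVneq (normsq z) 0.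
  have zz : z = 0 by apply/eqP; rewrite -normsq_eq0 z0.
  have zz' : z' = 0 by apply/eqP; rewrite -normsq_eq0 -E z0.
  by exists 0, 0; rewrite zz zz' normsq0 hdot0l !scaler0 addr0.
set x := normsq z in E z0 *.
pose k := complex.Re (hdot z z') / x.
pose v0 := z' - k%:C *: z.
have x0 : 0 < x by rewrite lt_neqAle eq_sym z0 normsq_ge0.
have kx : k * x = complex.Re (hdot z z') by rewrite /k divfK.
have v0z : complex.Re (hdot z v0) = 0.
  by rewrite /v0 hdotDr hdotNr hdotZr_real hdot_normsq ReD ReN ReZr -kx subrr.
have nv0 : normsq v0 = x * (1 - k ^+ 2).
  rewrite /v0 normsqD normsqN normsqZ hdotNr hdotZr_real -E ReN ReZr hdotC ReJ -kx -/x; ring.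
have k1 : k ^+ 2 <= 1.
  by have := normsq_ge0 v0; rewrite nv0 pmulr_rge0 // subr_ge0.
have kb : -1 <= k <= 1 by rewrite -ler_norml -(ler_pXn2r (n := 2)) ?nnegrE // expr1n real_normK ?num_real.
have [k2|k2] := eqVneq (k ^+ 2) 1.
  exists ('i *: z), (acos k); split.
  - exact: normsq_i.
  - by rewrite hdotZr_i hdot_normsq ReN Re_iM oppr0 /= oppr0.
  - rewrite acosK ?in_itv // sin_acos // k2 subrr sqrtr0 scale0r addr0.
    have : v0 = 0 by apply/eqP; rewrite -normsq_eq0 nv0 k2 subrr mulr0.
    by rewrite /v0 => /eqP; rewrite subr_eq0 => /eqP.
have s0 : 0 < 1 - k ^+ 2 by rewrite subr_gt0 lt_neqAle k2.
pose s := Num.sqrt (1 - k ^+ 2); have sp : 0 < s by rewrite sqrtr_gt0.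
have s2 : s ^+ 2 = 1 - k ^+ 2 by rewrite sqr_sqrtr // ltW.
exists ((s^-1)%:C *: v0), (acos k); split.
- by rewrite normsqZ nv0 -s2 exprVn; field; rewrite gt_eqF.
- by rewrite hdotZr_real ReZr v0z mulr0.
- rewrite acosK ?in_itv // sin_acos // -/s scalerA -rmorphM /= mulfV ?gt_eqF // scale1r.
  by rewrite /v0 addrC subrK.
Qed.

Definition gc z v (t : R) : Cvec R n := (cos t)%:C *: z + (sin t)%:C *: v.
Definition dgc z v (t : R) : Cvec R n := (- sin t)%:C *: z + (cos t)%:C *: v.

Lemma gc_normsq z v t : normsq v = normsq z -> complex.Re (hdot z v) = 0 ->
  normsq (gc z v t) = normsq z.
Proof.
move=> nv zv; rewrite normsqD !normsqZ hdotZl hdotZr_real !ReZr zv nv.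
by rewrite -[RHS]mul1r -(cos2Dsin2 t); ring.
Qed.

Lemma gc_tangent z v t : normsq v = normsq z -> complex.Re (hdot z v) = 0 ->
  complex.Re (hdot (dgc z v t) (gc z v t)) = 0.
Proof.
move=> nv zv; rewrite /gc /dgc hdotDl !hdotDr !hdotZl !hdotZr_real !hdot_normsq !ReD !ReZr zv nv.
by rewrite hdotC ReJ zv /=; ring.
Qed.

Lemma gc_i z t : dgc z ('i *: z) t = 'i *: gc z ('i *: z) t.
Proof.
rewrite /dgc /gc scalerDr !scalerA addrC; congr (_ + _); first by rewrite mulrC.
by congr (_ *: _); rewrite mulrAC -expr2 sqr_i mulN1r rmorphN.
Qed.

Lemma lim_der (h : R -> R) (d : R) : is_derive (0 : R) (1 : R) h d -> h 0 = 0 ->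
  (fun t => t^-1 * h t) @ 0^'+ --> d.
Proof.
move=> /is_derive1P H h0; apply/cvgrPdist_le => e /H [r r0 Hr].
have N : \forall t \near (0 : R)^'+, t < r by exact: nbhs_right_lt.
have N' : \forall t \near (0 : R)^'+, 0 < t by exact: nbhs_right_gt.
near=> t.
have tr : t < r by near: t.
have t0 : 0 < t by near: t.
have := Hr t; rewrite (gtr0_norm t0) => /(_ tr); rewrite add0r h0 subr0.
move=> Ht; rewrite -(ler_pM2r t0); apply: le_trans Ht.
rewrite -[X in _ * X](gtr0_norm t0) -normrM distrC mulrBl mulrAC mulVf ?gt_eqF //.
by rewrite mul1r.
Unshelve. all: end_near.
Qed.

Lemma lim_sum (I : Type) (r : seq I) (h : I -> R -> R) (l : I -> R) (F : set_system R) :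
  Filter F -> (forall i, h i t @[t --> F] --> l i) ->
  (\sum_(i <- r) h i t) @[t --> F] --> \sum_(i <- r) l i.
Proof.
move=> FF H; elim: r => [|i r IH].
  rewrite big_nil (_ : (fun _ => _) = fun=> 0); first exact: cvg_cst.
  by apply/funext => t; rewrite big_nil.
rewrite big_cons (_ : (fun _ => _) = fun t => h i t + \sum_(j <- r) h j t); first by apply: cvgD.
by apply/funext => t; rewrite big_cons.
Qed.

Lemma lim_near (h g : R -> R) (l : R) :
  (\forall t \near (0 : R)^'+, h t = g t) -> h @ (0 : R)^'+ --> l -> g @ (0 : R)^'+ --> l.
Proof.
move=> E /cvgrPdist_lt H; apply/cvgrPdist_lt => e /H He.
by apply: filterS2 E He => t ->.
Qed.

Definition vlim (F : R -> Cvec R n) (L : Cvec R n) : Prop := forall j,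
  (complex.Re (F t j 0) @[t --> (0 : R)^'+] --> complex.Re (L j 0)) /\
  (complex.Im (F t j 0) @[t --> (0 : R)^'+] --> complex.Im (L j 0)).

Lemma lim_hdot F G L K : vlim F L -> vlim G K ->
  complex.Re (hdot (F t) (G t)) @[t --> (0 : R)^'+] --> complex.Re (hdot L K).
Proof.
move=> HF HG; rewrite Re_hdotE (_ : (fun _ => _) = fun t =>
  \sum_j (complex.Re (F t j 0) * complex.Re (G t j 0) + complex.Im (F t j 0) * complex.Im (G t j 0))).
  apply: lim_sum => j; have [a1 a2] := HF j; have [b1 b2] := HG j.
  by apply: cvgD; apply: cvgM.
by apply/funext => t; rewrite Re_hdotE.
Qed.

Lemma lim_normsq F L : vlim F L -> normsq (F t) @[t --> (0 : R)^'+] --> normsq L.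
Proof.
move=> HF; have := lim_hdot HF HF; rewrite hdot_normsq /=.
by under eq_fun do rewrite hdot_normsq /=.
Qed.

Lemma vlim_i F L : vlim F L -> vlim (fun t => 'i *: F t) ('i *: L).
Proof.
move=> H j; have [h1 h2] := H j; rewrite mxE Re_iM Im_iM; split.
  rewrite (_ : (fun _ => _) = fun t => - complex.Im (F t j 0)); first exact: cvgN.
  by apply/funext => t; rewrite mxE Re_iM.
rewrite (_ : (fun _ => _) = fun t => complex.Re (F t j 0)) //.
by apply/funext => t; rewrite mxE Im_iM.
Qed.

End vector_derivatives.

(** * Real-linear maps and their traces *)

Section real_matrix.
Variables (R : realType) (n : nat).
Implicit Types (u v z : Cvec R n) (L : Cvec R n -> Cvec R n).

(** C^n is viewed as R^(2n): the differential of a duality is only known to be real linear, so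
    traces have to be taken over R. *)
Definition toR u : 'rV[R]_(n + n) :=
  row_mx (\row_j complex.Re (u j 0)) (\row_j complex.Im (u j 0)).
Definition ofR (x : 'rV[R]_(n + n)) : Cvec R n :=
  \col_j ((lsubmx x 0 j) +i* (rsubmx x 0 j)).

Lemma toRK : cancel toR ofR.
Proof.
move=> u; apply/matrixP => j k; rewrite (ord1 k) /ofR /toR mxE row_mxKl row_mxKr !mxE.
by case: (u j 0).
Qed.

Lemma ofRK : cancel ofR toR.
Proof.
move=> x; rewrite -[RHS]hsubmxK /toR; congr row_mx; apply/matrixP => i j; by rewrite (ord1 i) !mxE.
Qed.

Definition rlinear L := forall (a b : R) u v, L (a%:C *: u + b%:C *: v) = a%:C *: L u + b%:C *: L v.

Definition mxR L : 'M[R]_(n + n) := \matrix_(i, k) toR (L (ofR (delta_mx 0 i))) 0 k.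

Lemma toR_comb (a b : R) u v : toR (a%:C *: u + b%:C *: v) = a *: toR u + b *: toR v.
Proof.
rewrite /toR !scale_row_mx add_row_mx; congr row_mx; apply/matrixP => i j; rewrite !mxE;
  case: (u j 0) (v j 0) => p q [s t]; simpc => /=; ring.
Qed.

Lemma mxRE L u : rlinear L -> toR u *m mxR L = toR (L u).
Proof.
move=> HL; pose g x := toR (L (ofR x)).
have gl (a b : R) x y : g (a *: x + b *: y) = a *: g x + b *: g y.
  by rewrite /g -toR_comb -HL -[x in LHS]ofRK -[y in LHS]ofRK -toR_comb toRK.
have g0 : g 0 = 0 by have := gl 0 0 0 0; rewrite !scale0r addr0.
have gD x y : g (x + y) = g x + g y by have := gl 1 1 x y; rewrite !scale1r.
have gZ a x : g (a *: x) = a *: g x by have := gl a 0 x 0; rewrite !scale0r !addr0.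
rewrite -[u in RHS]toRK -/(g (toR u)); move: (toR u) => x.
rewrite [in RHS](row_sum_delta x) (big_morph g gD g0).
apply/matrixP => i j; rewrite (ord1 i) mxE summxE; apply: eq_bigr => k _.
by rewrite gZ !mxE.
Qed.

Lemma mxR_eq (A B : 'M[R]_(n + n)) : (forall u, toR u *m A = toR u *m B) -> A = B.
Proof.
by move=> H; apply/row_matrixP => i; rewrite !rowE -(ofRK (delta_mx 0 i)).
Qed.

Lemma mxR_comp L1 L2 : rlinear L1 -> rlinear L2 -> mxR (fun u => L2 (L1 u)) = mxR L1 *m mxR L2.
Proof.
move=> H1 H2; apply: mxR_eq => u; rewrite mulmxA !mxRE // => a b x y.
by rewrite H1 H2.
Qed.

(** The radial form at z is - Im <radop a b z u, v>, where a and b are the first two derivatives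
    of the profile at |z|^2. The vector z is an eigenvector for a + |z|^2 b, its orthogonal
    complement an eigenspace for a. *)
Definition radop (a b : R) z u : Cvec R n := a%:C *: u + (b%:C * hdot u z) *: z.

Lemma radop_rlinear a b z : rlinear (radop a b z).
Proof.
move=> p q u v; apply/matrixP => j k; rewrite /radop !mxE hdotDl !hdotZl; ring.
Qed.

Lemma mxtrace_radop a b z : \tr (mxR (radop a b z)) = 2 * (n%:R * a + b * normsq z).
Proof.
rewrite /mxtrace big_split_ord /=.
have El j : ofR (delta_mx 0 (lshift n j)) = basis_vec R j.
  apply/matrixP => i k; rewrite (ord1 k) /basis_vec !mxE !eqxx /= andbT eq_lshift eq_rlshift.
  by case: (i == j).
have Er j : ofR (delta_mx 0 (rshift n j)) = 'i *: basis_vec R j.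
  apply/matrixP => i k; rewrite (ord1 k) /basis_vec !mxE !eqxx /= andbT eq_lrshift eq_rshift.
  by case: (i == j); rewrite ?mulr0n ?mulr1n; simpc.
have H1 j : mxR (radop a b z) (lshift n j) (lshift n j) = a + b * (complex.Re (z j 0) ^+ 2 + complex.Im (z j 0) ^+ 2).
  rewrite mxE El /toR row_mxEl mxE /radop !mxE hdotC hdot_basis !eqxx /=.
  by case: (z j 0) => p q /=; ring.
have H2 j : mxR (radop a b z) (rshift n j) (rshift n j) = a + b * (complex.Re (z j 0) ^+ 2 + complex.Im (z j 0) ^+ 2).
  rewrite mxE Er /toR row_mxEr mxE /radop !mxE hdotZl hdotC hdot_basis !eqxx /=.
  by case: (z j 0) => p q /=; ring.
rewrite (eq_bigr _ (fun j _ => H1 j)) (eq_bigr _ (fun j _ => H2 j)).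
rewrite big_split /= sumr_const card_ord -mulr_sumr -/(normsq z) -mulr_natl; ring.
Qed.

Lemma radop_inv a b z u : a != 0 -> a + normsq z * b != 0 ->
  radop a^-1 (- (b / (a * (a + normsq z * b)))) z (radop a b z u) = u.
Proof.
move=> a0 e0; apply/matrixP => j k; rewrite /radop !mxE hdotDl !hdotZl hdot_normsq.
set A := a%:C; have -> : (a^-1)%:C = A^-1 by rewrite /A fmorphV.
rewrite rmorphN fmorph_div rmorphM rmorphD rmorphM /= -/A.
set B := b%:C; set X := (normsq z)%:C.
have A0 : A != 0 by rewrite /A fmorph_eq0.
have E0 : A + X * B != 0 by rewrite /A /B /X -rmorphM -rmorphD fmorph_eq0.
by field; rewrite A0 E0.
Qed.
End real_matrix.

(** * Dualities at a point *)

Section duality_point.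
Variables (R : realType) (n : nat).
Implicit Types (u v z w c : Cvec R n).

(** [E1] and [E2] are the two equations of a duality at a point z with image w, for a real-linear D. *)
Variables (D : Cvec R n -> Cvec R n) (lam a b a' b' : R) (z w : Cvec R n).
Hypothesis Dlin : rlinear D.
Hypothesis E1 : forall u v,
  complex.Im (hdot (D u) (D v)) = lam * complex.Im (hdot (radop a b z u) v).
Hypothesis E2 : forall u v,
  lam * complex.Im (hdot (radop a' b' w (D u)) (D v)) = complex.Im (hdot u v).

Lemma toR0 : toR (0 : Cvec R n) = 0.
Proof.
by rewrite -[RHS]hsubmxK; congr row_mx; apply/matrixP => i j; rewrite !mxE.
Qed.

Lemma duality_unit : mxR D \in unitmx.
Proof.
rewrite -row_free_unit; apply: inj_row_free => x Hx.
have D0 : D (ofR x) = 0.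
  by apply: (can_inj (@toRK R n)); rewrite -mxRE // ofRK Hx toR0.
rewrite -(ofRK x) (_ : ofR x = 0) ?toR0 //.
apply: Im_hdot_nondeg => v; rewrite -E2 D0 (_ : radop a' b' w 0 = 0) ?hdot0l ?mulr0 //.
by rewrite /radop hdot0l mulr0 scale0r scaler0 addr0.
Qed.

Lemma duality_surj v : exists u, D u = v.
Proof.
exists (ofR (toR v *m invmx (mxR D))); apply: (can_inj (@toRK R n)).
by rewrite -mxRE // ofRK mulmxKV // duality_unit.
Qed.

Lemma duality_nondeg c : (forall u, complex.Im (hdot c (D u)) = 0) -> c = 0.
Proof. by move=> H; apply: Im_hdot_nondeg => v; have [u <-] := duality_surj v. Qed.

(** By [E2] and then [E1], both sides have the same symplectic product with D v for all v, and D
    is onto. *)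
Lemma duality_conj u : (lam ^+ 2)%:C *: radop a' b' w (D (radop a b z u)) = D u.
Proof.
apply/eqP; rewrite -subr_eq0; apply/eqP; apply: duality_nondeg => v.
rewrite hdotBl raddfB /= hdotZl ImZr expr2 -mulrA E2 E1 subrr //.
Qed.

(** By [duality_conj], lam^2 times the operator at w is conjugate to the inverse of the one at
    z. *)
Lemma duality_trace : mxR (radop a b z) \in unitmx /\
  lam ^+ 2 * \tr (mxR (radop a' b' w)) = \tr (invmx (mxR (radop a b z))).
Proof.
have Dl := Dlin; have P1 := @radop_rlinear R n a b z; have P2 := @radop_rlinear R n a' b' w.
have uD := duality_unit.
have PD : rlinear (fun u => D (radop a b z u)) by move=> p q x y; rewrite P1 Dl.
have E : mxR (radop a b z) *m mxR D *m (lam ^+ 2 *: mxR (radop a' b' w)) = mxR D.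
  rewrite -scalemxAr -mxR_comp // -mxR_comp //; apply: mxR_eq => u.
  rewrite -scalemxAr !mxRE //; last by move=> p q x y; rewrite PD P2.
  rewrite -[in RHS](duality_conj u) -[_ *: _ in RHS]addr0 -[0 in RHS](scale0r (0 : Cvec R n)).
  by rewrite (toR_comb _ 0) scale0r addr0.
have uP : mxR (radop a b z) \in unitmx.
  by move: (uD); rewrite -{1}E !unitmx_mul -andbA => /andP[].
split => //; rewrite -mxtraceZ.
have -> : lam ^+ 2 *: mxR (radop a' b' w) = invmx (mxR D) *m invmx (mxR (radop a b z)) *m mxR D.
  by rewrite -[X in _ = _ *m X]E !mulmxA -(mulmxA (invmx (mxR D))) mulVmx // mulmx1 mulVmx // mul1mx.
by rewrite mxtrace_mulC mulmxA mulmxV // mul1mx.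
Qed.
End duality_point.

Section forms.
Variables (R : realType) (n : nat).
Implicit Types (u v z w : Cvec R n).

Lemma kahler_form_radop (Phi : Cvec R n -> R) (a b : R) z u v :
  (forall j k, complex_hessian Phi z j k =
    a%:C * (j == k)%:R + b%:C * (conjc (z j 0) * z k 0)) ->
  kahler_form Phi z u v = (- complex.Im (hdot (radop a b z u) v))%:C.
Proof.
move=> H; rewrite (kahler_form_radial _ _ H) /radop hdotDl !hdotZl -(hdotC v z).
by rewrite -mulrA.
Qed.

Lemma duality_E1 (Phi : Cvec R n -> R) (Psi : Cvec R n -> Cvec R n) (lam a b : R) z u v :
  (forall j k, complex_hessian Phi z j k =
    a%:C * (j == k)%:R + b%:C * (conjc (z j 0) * z k 0)) ->
  pullback Psi (@flat_form R n) z u v = scale_form lam (kahler_form Phi) z u v <->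
  complex.Im (hdot (tangent_map Psi z u) (tangent_map Psi z v)) =
    lam * complex.Im (hdot (radop a b z u) v).
Proof.
move=> H; rewrite /pullback /scale_form flat_formE (kahler_form_radop _ _ H) -rmorphM.
split=> [/(congr1 (@complex.Re R)) /= | ->]; last by rewrite mulrN.
by rewrite mulrN => /oppr_inj.
Qed.

Lemma duality_E2 (Phi' : Cvec R n -> R) (Psi : Cvec R n -> Cvec R n) (lam a b : R) z u v :
  (forall j k, complex_hessian Phi' (Psi z) j k =
    a%:C * (j == k)%:R + b%:C * (conjc (Psi z j 0) * Psi z k 0)) ->
  pullback Psi (scale_form lam (kahler_form Phi')) z u v = flat_form z u v <->
  lam * complex.Im (hdot (radop a b (Psi z) (tangent_map Psi z u)) (tangent_map Psi z v)) =
    complex.Im (hdot u v).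
Proof.
move=> H; rewrite /pullback /scale_form flat_formE (kahler_form_radop _ _ H) -rmorphM.
split=> [/(congr1 (@complex.Re R)) /= | <-]; last by rewrite mulrN.
by rewrite mulrN => /oppr_inj.
Qed.
End forms.

(** * Smoothness and injectivity of power series in the squared norm *)

Section Ck.
Variables (R : realType) (n : nat).
Implicit Types (u v w z : Cvec R n) (U : set (Cvec R n)) (h g : Cvec R n -> R).

Lemma Ck_on_S k U h : Ck_on k.+1 U h -> Ck_on k U h.
Proof.
elim: k h => [|k IH] h; first by case.
by move=> [ch H]; split=> // v; have [d dh] := H v; split=> //; exact: IH.
Qed.

Lemma continuous_eq_on U h g : open U -> (forall z, U z -> h z = g z) ->
  (forall z, U z -> {for z, continuous h}) -> forall z, U z -> {for z, continuous g}.
Proof.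
move=> /openP oU E ch z Uz; apply/continuous_normsqP => e e0.
have [d d0 Hd] := (continuous_normsqP h z).1 (ch _ Uz) e e0.
have [d' d0' Hd'] := oU _ Uz; exists (Num.min d d'); first by rewrite lt_min d0.
by move=> w; rewrite lt_min => /andP[/Hd wd /Hd' wU]; rewrite -!E.
Qed.

Lemma dird_derivable h v z : derivable (fun t : R => h (z + t%:C *: v)) 0 1 ->
  is_derive (0 : R) (1 : R) (fun t : R => h (z + t%:C *: v)) (dird h v z).
Proof. by move=> H; exact: derivable_der H. Qed.

Lemma Ck_on_eq k U h g : open U -> (forall z, U z -> h z = g z) -> Ck_on k U h -> Ck_on k U g.
Proof.
move=> oU; elim: k h g => [|k IH] h g E [ch H].
  by split=> //; exact: continuous_eq_on ch.
split; first exact: continuous_eq_on ch.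
move=> v; have [dh ck] := H v.
have D z : U z -> is_derive (0 : R) (1 : R) (fun t : R => g (z + t%:C *: v)) (dird h v z).
  move=> Uz; apply: der_near (dird_derivable (dh _ Uz)).
  have /near_line : \forall w \near z, U w by apply: open_nbhs_nbhs.
  by move=> /(_ v); apply: filterS => t /E.
split; first by move=> z /D[].
by apply: IH ck => z /D /dird_eq ->.
Qed.

Lemma Ck_on_cst k U (a : R) : Ck_on k U (fun=> a).
Proof.
elim: k a => [|k IH] a; first by split=> // z _; exact: cst_continuous.
split=> [z _|v]; first exact: cst_continuous.
split; first by move=> z _; have [] := der_cst (0 : R) a.
rewrite (_ : dird _ v = fun=> 0) //; apply/funext => z; exact: (dird_eq (h := fun=> a) (der_cst 0 a)).
Qed.

Lemma Ck_onD k U h g : open U -> Ck_on k U h -> Ck_on k U g -> Ck_on k U (fun z => h z + g z).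
Proof.
move=> oU; elim: k h g => [|k IH] h g [ch H] [cg G].
  by split=> // z Uz; apply: continuousD; [exact: ch | exact: cg].
split=> [z Uz|v]; first by apply: continuousD; [exact: ch | exact: cg].
have [dh kh] := H v; have [dg kg] := G v.
have D z : U z -> is_derive (0 : R) (1 : R) (fun t : R => h (z + t%:C *: v) + g (z + t%:C *: v)) (dird h v z + dird g v z).
  by move=> Uz; apply: derD; apply: dird_derivable; [exact: dh | exact: dg].
split; first by move=> z /D[].
apply: Ck_on_eq (IH _ _ kh kg) => // z Uz.
by rewrite (dird_eq (h := fun z => h z + g z) (D _ Uz)).
Qed.

Lemma Ck_onM k U h g : open U -> Ck_on k U h -> Ck_on k U g -> Ck_on k U (fun z => h z * g z).
Proof.
move=> oU; elim: k h g => [|k IH] h g hk gk; have [ch H] := hk; have [cg G] := gk.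
  by split=> // z Uz; apply: continuousM; [exact: ch | exact: cg].
split=> [z Uz|v]; first by apply: continuousM; [exact: ch | exact: cg].
have [dh kh] := H v; have [dg kg] := G v.
have D z : U z -> is_derive (0 : R) (1 : R) (fun t : R => h (z + t%:C *: v) * g (z + t%:C *: v))
    (dird h v z * g z + h z * dird g v z).
  move=> Uz; have := derM (dird_derivable (dh _ Uz)) (dird_derivable (dg _ Uz)).
  by rewrite scale0r addr0.
split; first by move=> z /D[].
apply: Ck_on_eq (Ck_onD oU (IH _ _ kh (Ck_on_S gk)) (IH _ _ (Ck_on_S hk) kg)) => // z Uz.
by rewrite (dird_eq (h := fun z => h z * g z) (D _ Uz)).
Qed.

Lemma Ck_on_sum k U (I : Type) (r : seq I) (h : I -> Cvec R n -> R) : open U ->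
  (forall i, Ck_on k U (h i)) -> Ck_on k U (fun z => \sum_(i <- r) h i z).
Proof.
move=> oU H; elim: r => [|i r IH].
  by rewrite (_ : (fun _ => _) = fun=> 0); [exact: Ck_on_cst | apply/funext => z; rewrite big_nil].
rewrite (_ : (fun _ => _) = fun z => h i z + \sum_(i <- r) h i z); first exact: Ck_onD.
by apply/funext => z; rewrite big_cons.
Qed.

Lemma Re_Im_continuous (j : 'I_n) z :
  {for z, continuous (fun z : Cvec R n => complex.Re (z j 0))} /\
  {for z, continuous (fun z : Cvec R n => complex.Im (z j 0))}.
Proof.
have B (w : Cvec R n) : complex.Re (w j 0) ^+ 2 + complex.Im (w j 0) ^+ 2 <= normsq w.
  by rewrite /normsq (bigD1 j) //= lerDl sumr_ge0 // => i _; rewrite addr_ge0 ?sqr_ge0.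
split; apply/continuous_normsqP => e e0; exists (e ^+ 2); rewrite ?exprn_gt0 // => w wz;
  have H := le_lt_trans (B (w - z)) wz; rewrite -(ltr_pXn2r (n := 2)) ?nnegrE ?normr_ge0 ?(ltW e0) //;
  rewrite real_normK ?num_real //; apply: le_lt_trans H; rewrite !mxE;
  case: (w j 0) (z j 0) => a b [p q]; simpc => /=.
  by rewrite lerDl sqr_ge0.
by rewrite lerDr sqr_ge0.
Qed.

Lemma Ck_on_coord k U (j : 'I_n) :
  Ck_on k U (fun z => complex.Re (z j 0)) /\ Ck_on k U (fun z => complex.Im (z j 0)).
Proof.
case: k => [|k].
  by split; split=> // z _; have [] := Re_Im_continuous j z.
split; (split=> [z _|v]; first by have [] := Re_Im_continuous j z).
  split; first by move=> z _; have [[]] := der_coord z v j.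
  rewrite (_ : dird _ v = fun=> complex.Re (v j 0)); first exact: Ck_on_cst.
  by apply/funext => z; apply: (dird_eq (h := fun z => complex.Re (z j 0))); have [] := der_coord z v j.
split; first by move=> z _; have [_ []] := der_coord z v j.
rewrite (_ : dird _ v = fun=> complex.Im (v j 0)); first exact: Ck_on_cst.
by apply/funext => z; apply: (dird_eq (h := fun z => complex.Im (z j 0))); have [] := der_coord z v j.
Qed.

Lemma Ck_on_Re_hdot k U v : open U -> Ck_on k U (fun z => complex.Re (hdot z v)).
Proof.
move=> oU; rewrite (_ : (fun _ => _) = fun z : Cvec R n =>
  \sum_j (complex.Re (z j 0) * complex.Re (v j 0) + complex.Im (z j 0) * complex.Im (v j 0))).
  apply: Ck_on_sum => // j; apply: Ck_onD => //; apply: Ck_onM => //; try exact: Ck_on_cst.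
    by have [] := Ck_on_coord k U j.
  by have [] := Ck_on_coord k U j.
by apply/funext => z; rewrite Re_hdotE.
Qed.

Lemma continuous_comp_normsq (phi : R -> R) z : {for normsq z, continuous phi} ->
  {for z, continuous (fun w : Cvec R n => phi (normsq w))}.
Proof.
move=> /continuousP_dist H; apply/continuous_normsqP => e /H[r r0 Hr].
have /nbhs_normsqP[d d0 Hd] := normsq_cont z r0.
by exists d => // w /Hd; exact: Hr.
Qed.

Lemma Ck_on_psum k U c rho : open U -> pconv c rho -> (forall z, U z -> normsq z < rho) ->
  Ck_on k U (fun z => psum c (normsq z)).
Proof.
move=> oU pc HU; have N z : U z -> `|normsq z| < rho by move=> /HU; rewrite ger0_norm ?normsq_ge0.
have C c' z : pconv c' rho -> U z -> {for z, continuous (fun z : Cvec R n => psum c' (normsq z))}.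
  by move=> pc' /N Uz; apply: continuous_comp_normsq; exact: der_cont (der_psum pc' Uz).
elim: k c pc => [|k IH] c pc; first by split=> // z; exact: C pc.
split=> [z|v]; first exact: C pc.
have D z : U z -> is_derive (0 : R) (1 : R) (fun t : R => psum c (normsq (z + t%:C *: v)))
    (psum (pseries_diffs c) (normsq z) * (2 * complex.Re (hdot z v))).
  by move=> /N Uz; apply: der_radial; exact: der_psum pc _.
split; first by move=> z /D[].
apply: Ck_on_eq (Ck_onM oU (IH _ (pconv_diffs pc)) (Ck_onM oU (Ck_on_cst k U 2) (Ck_on_Re_hdot k v oU))) => //.
by move=> z Uz; rewrite (dird_eq (h := fun z => psum c (normsq z)) (D _ Uz)).
Qed.

Lemma smooth_radial_scale U c rho : open U -> pconv c rho -> (forall z, U z -> normsq z < rho) ->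
  smooth_map U (fun z => (psum c (normsq z))%:C *: z).
Proof.
move=> oU pc HU k j; have [cr ci] := Ck_on_coord k U j; have P := Ck_on_psum k oU pc HU.
split; [have := Ck_onM oU P cr | have := Ck_onM oU P ci]; apply: Ck_on_eq => // z _;
  by rewrite mxE; case: (z j 0) => a b; simpc.
Qed.

Lemma normsq_map_continuous U (Psi : Cvec R n -> Cvec R n) z : open U -> smooth_map U Psi -> U z ->
  {for z, continuous (fun z => normsq (Psi z))}.
Proof.
move=> oU sm Uz; have [H _] : Ck_on 0 U (fun z => normsq (Psi z)).
  rewrite /normsq; apply: Ck_on_sum => // j; have [cr ci] := sm 0%N j.
  by apply: Ck_onD => //; exact: Ck_onM.
exact: H.
Qed.
End Ck.

Section injectivity.
Variable R : realType.
Implicit Types (c : nat -> R) (x rho : R).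

Lemma pconv_unshift c rho : pconv (fun k => c k.+1) rho -> pconv c rho.
Proof.
move=> [r0 H]; split=> // r r1 r2; have [B HB] := H _ r1 r2.
exists (Num.max `|c 0%N| (B * r)) => -[|k]; first by rewrite expr0 mulr1 le_max lexx.
by rewrite le_max exprSr mulrA ler_pM2r // HB orbT.
Qed.

Lemma psum_mulx c rho x : pconv (fun k => k.+1%:R * c k.+1) rho -> `|x| < rho ->
  psum (fun k => k%:R * c k) x = x * psum (pseries_diffs c) x.
Proof.
move=> pc xr; have pu : pconv (fun k => k%:R * c k) rho by exact: pconv_unshift.
by rewrite (pconv_step pu xr) mul0r add0r.
Qed.

(** Zeros of the derivative are isolated, so near 0 none lies strictly between two points on the
    same side of 0. *)
Lemma psum_one_sided_inj c rho m : pconv c rho -> c m.+1 != 0 ->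
  exists2 e, 0 < e & e <= rho /\ forall x x', `|x| < e -> `|x'| < e -> 0 <= x * x' ->
    psum c x = psum c x' -> x = x'.
Proof.
move=> pc cm; have [|e e0 He] := @psum_isolated_zero _ (pseries_diffs c) rho m (pconv_diffs pc).
  by rewrite /pseries_diffs mulf_neq0 // pnatr_eq0.
have r0 := pc.1; exists (Num.min e rho); first by rewrite lt_min e0.
split; first by rewrite ge_min lexx orbT.
have key x x' : x < x' -> `|x| < Num.min e rho -> `|x'| < Num.min e rho -> 0 <= x * x' ->
    psum c x <> psum c x'.
  rewrite !lt_min => xx /andP[xe xr] /andP[xe' xr'] s E.
  have : exists2 t, x < t < x' & psum c x' - psum c x = psum (pseries_diffs c) t * (x' - x).
    have D t : x <= t <= x' -> is_derive t 1 (psum c) (psum (pseries_diffs c) t).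
      move=> /andP[t1 t2]; apply: der_psum pc _; rewrite ltr_norml.
      by move: xr xr'; rewrite !ltr_norml => /andP[? ?] /andP[? ?]; apply/andP; split; lra.
    have D1 (t : R) : t \in `]x, x'[ -> is_derive t 1 (psum c) (psum (pseries_diffs c) t).
      by rewrite in_itv /= => /andP[t1 t2]; apply: D; rewrite !ltW.
    have C : {within `[x, x'], continuous (psum c)}.
      apply: continuous_in_subspaceT => t /set_mem; rewrite /= in_itv /= => tx.
      by apply: der_cont; exact: D.
    by have [t] := MVT xx D1 C; rewrite in_itv /= => ? ?; exists t.
  move=> [t /andP[t1 t2]]; rewrite E subrr => /esym/eqP; rewrite mulf_eq0 subr_eq0 (gt_eqF xx) // orbF.
  apply/negP/He.
    rewrite normr_gt0; apply/eqP => t0; rewrite t0 in t1 t2; nra.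
  by move: xe xe'; rewrite !ltr_norml => /andP[? ?] /andP[? ?]; apply/andP; split; lra.
move=> x x' xe xe' s E; case: (ltgtP x x') => // xx.
  by case: (key _ _ xx xe xe' s).
by case: (key _ _ xx xe' xe); rewrite // mulrC.
Qed.
End injectivity.

(** * Dualities that fix the origin *)

Section core.
Variables (R : realType) (n : nat).
Implicit Types (u v z w : Cvec R n).

(** Here f1 and f2 stand for the derivatives f' and f''; what is assumed of them holds near 0 for
    every f with f'(0) > 0 that is not affine. *)
Variables (f1 f2 : R -> R) (eps : R).
Hypothesis df1 : forall x : R, `|x| < eps -> is_derive x 1 f1 (f2 x).
Hypothesis f1_pos : forall x, `|x| < eps -> 0 < f1 x.
Hypothesis e_pos : forall x, `|x| < eps -> 0 < f1 x + x * f2 x.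
Hypothesis f2_nz : forall x, `|x| < eps -> x != 0 -> f2 x != 0.
Hypothesis T_inj : forall x x', `|x| < eps -> `|x'| < eps -> 0 <= x * x' ->
  n%:R * f1 x + x * f2 x = n%:R * f1 x' + x' * f2 x' -> x = x'.

Variables (lam : R) (U : set (Cvec R n)) (Psi : Cvec R n -> Cvec R n) (delta : R).
Hypothesis lam_gt0 : 0 < lam.
Hypothesis oU : open U.
Hypothesis sm : smooth_map U Psi.
Hypothesis Psi_inj : forall z z', U z -> U z' -> Psi z = Psi z' -> z = z'.
Hypothesis Psi0 : Psi 0 = 0.
Hypothesis delta_gt0 : 0 < delta.
Hypothesis ball : forall z, normsq z < delta ->
  [/\ U z, normsq z < eps & normsq (Psi z) < eps].

Local Notation D := (tangent_map Psi).
Local Notation x_ z := (normsq z).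
Local Notation y_ z := (normsq (Psi z)).
Local Notation e_ z := (f1 (normsq z) + normsq z * f2 (normsq z)).
Local Notation P z := (radop (f1 (normsq z)) (f2 (normsq z)) z).
Local Notation Q z := (radop (f1 (- normsq (Psi z))) (- f2 (- normsq (Psi z))) (Psi z)).

Hypothesis E1 : forall z, normsq z < delta -> forall u v,
  complex.Im (hdot (D z u) (D z v)) = lam * complex.Im (hdot (P z u) v).
Hypothesis E2 : forall z, normsq z < delta -> forall u v,
  lam * complex.Im (hdot (Q z (D z u)) (D z v)) = complex.Im (hdot u v).

Lemma Uball z : x_ z < delta -> U z. Proof. by move=> /ball[]. Qed.

Lemma xeps z : x_ z < delta -> `|x_ z| < eps.
Proof. by move=> /ball[_ h _]; rewrite ger0_norm ?normsq_ge0. Qed.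

Lemma yeps z : x_ z < delta -> `|- y_ z| < eps.
Proof. by move=> /ball[_ _ h]; rewrite normrN ger0_norm ?normsq_ge0. Qed.

Lemma Dlin z : x_ z < delta -> rlinear (D z).
Proof. by move=> /Uball Uz a b u v; rewrite (tangent_comb _ _ _ _ oU sm Uz). Qed.

Lemma delta0 : x_ (0 : Cvec R n) < delta. Proof. by rewrite normsq0. Qed.

Lemma Psi_neq0 z : x_ z < delta -> z != 0 -> Psi z != 0.
Proof.
move=> zd; apply: contra_neq => H; apply: Psi_inj.
- exact: Uball.
- exact: Uball delta0.
- by rewrite H Psi0.
Qed.

(** [duality_trace] expresses n f1 (- y) - y f2 (- y) through x, and by [T_inj] this quantity
    determines y. *)
Lemma y_radial z z' : x_ z < delta -> x_ z = x_ z' -> y_ z = y_ z'.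
Proof.
move=> zd E; have zd' : x_ z' < delta by rewrite -E.
have tr w : x_ w < delta -> lam ^+ 2 * (2 * (n%:R * f1 (- y_ w) - f2 (- y_ w) * y_ w)) =
    2 * (n%:R * (f1 (x_ w))^-1 - (f2 (x_ w) / (f1 (x_ w) * e_ w)) * x_ w).
  move=> wd; have [uP T] := duality_trace (Dlin wd) (E1 wd) (E2 wd).
  rewrite mxtrace_radop mulNr in T; rewrite T.
  have a0 : f1 (x_ w) != 0 by rewrite gt_eqF // f1_pos // xeps.
  have e0 : e_ w != 0 by rewrite gt_eqF // e_pos // xeps.
  have -> : invmx (mxR (P w)) = mxR (radop (f1 (x_ w))^-1 (- (f2 (x_ w) / (f1 (x_ w) * e_ w))) w).
    have I : mxR (P w) *m mxR (radop (f1 (x_ w))^-1 (- (f2 (x_ w) / (f1 (x_ w) * e_ w))) w) = 1%:M.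
      rewrite -mxR_comp; [|exact: radop_rlinear|exact: radop_rlinear].
      apply: mxR_eq => u; rewrite mxRE ?mulmx1 ?radop_inv // => p q s t.
      by rewrite !radop_rlinear.
    by rewrite -[LHS]mulmx1 -I mulmxA mulVmx // mul1mx.
  by rewrite mxtrace_radop mulNr.
have H : lam ^+ 2 * (2 * (n%:R * f1 (- y_ z) - f2 (- y_ z) * y_ z)) =
    lam ^+ 2 * (2 * (n%:R * f1 (- y_ z') - f2 (- y_ z') * y_ z')) by rewrite !tr // E.
have l2 : lam ^+ 2 * 2 != 0 by rewrite gt_eqF // mulr_gt0 // exprn_gt0.
rewrite !mulrA -!(mulrA _ 2) in H; rewrite !(mulrA _ 2) in H.
move/(mulfI l2): H => H; apply: oppr_inj; apply: T_inj; rewrite ?yeps //.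
  by rewrite mulrNN mulr_ge0 ?normsq_ge0.
by rewrite !mulNr ![y_ _ * _]mulrC.
Qed.

Lemma vder_Psi_gc z v t : x_ z < delta -> normsq v = normsq z -> complex.Re (hdot z v) = 0 ->
  vder (fun t => Psi (gc z v t)) t (D (gc z v t) (dgc z v t)).
Proof.
move=> zd nv zv; apply: (vder_map oU sm) (is_derive_cos t) (is_derive_sin t).
by apply: Uball; rewrite -/(gc z v t) gc_normsq.
Qed.

(** A vector tangent to a sphere is the velocity of a great circle, along which y is constant.
    *)
Lemma D_tangent z u : x_ z < delta -> complex.Re (hdot z u) = 0 ->
  complex.Re (hdot (D z u) (Psi z)) = 0.
Proof.
move=> zd zu; have [u0|u0] := eqVneq u 0.
  have -> : D z u = 0 by have := Dlin zd 0 0 0 0; rewrite u0 !scale0r addr0.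
  by rewrite hdot0l.
have nu0 : 0 < normsq u by rewrite lt_neqAle eq_sym normsq_eq0 u0 normsq_ge0.
have [z0|z0] := eqVneq z 0.
  by rewrite z0 Psi0 hdotC hdot0l ReJ.
have nz0 : 0 < x_ z by rewrite lt_neqAle eq_sym normsq_eq0 z0 normsq_ge0.
pose k := Num.sqrt (x_ z / normsq u); have k0 : 0 < k by rewrite sqrtr_gt0 divr_gt0.
have k2 : k ^+ 2 = x_ z / normsq u by rewrite sqr_sqrtr // ltW // divr_gt0.
pose v := k%:C *: u.
have nv : normsq v = normsq z by rewrite normsqZ k2 divfK // gt_eqF.
have zv : complex.Re (hdot z v) = 0 by rewrite hdotZr_real ReZr zu mulr0.
have H := der_normsq (vder_Psi_gc 0 zd nv zv).
have C : is_derive (0 : R) (1 : R) (fun t => normsq (Psi (gc z v t))) 0.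
  apply: der_eq (der_cst (0 : R) (y_ z)) => // t; apply: y_radial => //.
  by rewrite gc_normsq.
have := der_uniq H C; rewrite /gc /dgc sin0 cos0 !scale0r !addr0 oppr0 scale0r add0r !scale1r.
have -> : D z v = k%:C *: D z u by have := Dlin zd k 0 u 0; rewrite !scale0r !addr0.
rewrite hdotZl ReZr => /eqP; rewrite !mulf_eq0 pnatr_eq0 /= (gt_eqF k0) /= => /eqP //.
Qed.

(** The factor of proportionality in [D_kap], read off at u = z. *)
Definition kap z := complex.Re (hdot (D z z) (Psi z)) / x_ z.

Lemma D_kap z u : x_ z < delta -> z != 0 ->
  complex.Re (hdot (D z u) (Psi z)) = kap z * complex.Re (hdot u z).
Proof.
move=> zd z0; have x0 := pos_normsq z0.
pose r := complex.Re (hdot u z) / x_ z.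
have := @D_tangent z (1%:C *: u + (- r)%:C *: z) zd.
rewrite (Dlin zd) !scale1r hdotDl hdotDr hdotZr_real hdotZl hdot_normsq !ReD !ReZr.
have -> : complex.Re (hdot z u) + - r * complex.Re (x_ z)%:C = 0.
  by rewrite hdotC ReJ /= mulNr /r divfK ?subrr // gt_eqF.
move=> /(_ erefl) /eqP; rewrite mulNr subr_eq0 => /eqP ->.
by rewrite /kap /r; ring.
Qed.

(** Both sides have the same symplectic product with D v: for the left one by [E1], i z being an
    eigenvector of P, and for the right one by [D_kap]. *)
Lemma Dcplx z u : x_ z < delta -> z != 0 -> kap z != 0 ->
  D z ('i *: z) = ((lam * e_ z / kap z)%:C * 'i) *: Psi z.
Proof.
move=> zd z0 k0; set m := _ / _.
apply/eqP; rewrite -subr_eq0; apply/eqP.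
apply: (duality_nondeg (Dlin zd) (E2 zd)) => v.
rewrite hdotC ImJ hdotDr hdotNr -scalerA hdotZr_real hdotZr_i ImD ImN ImZr ImN Im_iM.
rewrite (D_kap _ zd z0) (E1 zd) /radop hdotDl !hdotZl !hdotZr_i hdot_normsq.
have -> : (f2 (x_ z))%:C * hdot v z * (- ('i * (x_ z)%:C)) =
  (- (f2 (x_ z) * x_ z))%:C * ('i * hdot v z).
  by rewrite rmorphN rmorphM; ring.
rewrite mulrN ImD ImN !ImZr Im_iM /m.
by field.
Qed.

(** Otherwise i Psi z would be symplectically orthogonal to the whole image of D. *)
Lemma kap_neq0 z : x_ z < delta -> z != 0 -> kap z != 0.
Proof.
move=> zd z0; apply/eqP => k0.
have : 'i *: Psi z = 0.
  apply: (duality_nondeg (Dlin zd) (E2 zd)) => u.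
  by rewrite hdotZl Im_iM hdotC ReJ (D_kap _ zd z0) k0 mul0r.
move/eqP; rewrite scaler_eq0 (negbTE (Psi_neq0 zd z0)) orbF => /eqP /(congr1 (@complex.Im R)) /= /eqP.
by rewrite oner_eq0.
Qed.

Definition mu z := lam * e_ z / kap z.

Lemma D_iz z : x_ z < delta -> z != 0 -> D z ('i *: z) = ((mu z)%:C * 'i) *: Psi z.
Proof. by move=> zd z0; apply: Dcplx => //; exact: kap_neq0. Qed.

(** kap z is the derivative of y along the ray of z, divided by 2 x, and y depends on x only. *)
Lemma kap_radial z z' : x_ z < delta -> x_ z = x_ z' -> kap z = kap z'.
Proof.
move=> zd E; rewrite /kap -E; congr (_ / _).
have zd' : x_ z' < delta by rewrite -E.
have d w : x_ w < delta -> is_derive (0 : R) (1 : R) (fun t : R => y_ ((1 + t)%:C *: w + 0%:C *: 0))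
    (2 * complex.Re (hdot (D w w) (Psi w))).
  move=> wd; have W : ((1 : R) + 0)%:C *: w + 0%:C *: 0 = w by rewrite addr0 scale1r scaler0 addr0.
  have U1 : U (((1 : R) + 0)%:C *: w + 0%:C *: 0) by rewrite W; exact: Uball.
  have d1 : is_derive (0 : R) (1 : R) (fun t : R => 1 + t) (1 : R).
    by apply: der_eq (derD (der_cst (0 : R) (1 : R)) (der_id 0)) => //; rewrite add0r.
  have := der_normsq (vder_map (a := fun t => 1 + t) (b := fun=> 0) oU sm U1 d1 (der_cst 0 0)).
  by rewrite !W !scaler0 !addr0 scale1r.
have H : is_derive (0 : R) (1 : R) (fun t : R => y_ ((1 + t)%:C *: z' + 0%:C *: 0))
    (2 * complex.Re (hdot (D z z) (Psi z))).
  apply: der_near (d _ zd).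
  have N : nbhs z [set w | x_ w < delta].
    have := normsq_cont z (r := delta - x_ z); rewrite subr_gt0 => /(_ zd).
    by apply: filterS => w; rewrite ltr_norml => /andP[_]; rewrite ltrD2r.
  have := near_line z N; apply: filterS => t /= td; apply: y_radial.
    by move: td; rewrite scaler0 addr0 rmorphD scalerDl scale1r.
  by rewrite !scaler0 !addr0 !normsqZ E.
by have := der_uniq H (d _ zd') => /(mulfI _); apply; rewrite pnatr_eq0.
Qed.

Lemma mu_radial z z' : x_ z < delta -> x_ z = x_ z' -> mu z = mu z'.
Proof. by move=> zd E; rewrite /mu (kap_radial zd E) E. Qed.

(** By [D_iz] the curve e^(- i mu t) Psi (e^(it) z) has derivative 0; its values at 0 and 2 pi
    coincide. *)
Lemma cos_mu z : x_ z < delta -> z != 0 -> cos (mu z * (pi *+ 2)) = 1.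
Proof.
move=> zd z0; set m := mu z; set v := 'i *: z.
have nv : normsq v = normsq z by exact: normsq_i.
have zv : complex.Re (hdot z v) = 0.
  by rewrite /v hdotZr_i hdot_normsq ReN Re_iM /= !oppr0.
pose G t : Cvec R n := expi (- m * t) *: Psi (gc z v t).
have dG t : vder G t 0.
  have H := vderZ (expi_der (- m) t) (vder_Psi_gc t zd nv zv).
  have nz : normsq (gc z v t) = normsq z by exact: gc_normsq.
  have g0 : gc z v t != 0 by rewrite -normsq_eq0 nz normsq_eq0.
  move: H; rewrite gc_i D_iz ?nz // -(mu_radial zd (esym nz)) -/m.
  rewrite scalerA -scalerDl => H j; have := H j; congr (cder _ _ _).
  rewrite !mxE; have -> : ('i * (- m)%:C * expi (- m * t) + expi (- m * t) * (m%:C * 'i)) = 0.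
    by rewrite rmorphN; ring.
  by rewrite mul0r.
have pi2 : (0 : R) <= pi *+ 2 by rewrite mulrn_wge0 // pi_ge0.
have GE : G 0 = G (pi *+ 2).
  apply/matrixP => j k; rewrite (ord1 k).
  by apply: (cst_of_cder0 (f := fun t => G t j 0) pi2) => t _; have := dG t j; rewrite mxE.
have g0 : gc z v 0 = z by rewrite /gc cos0 sin0 scale1r scale0r addr0.
have g2 : gc z v (pi *+ 2) = z by rewrite /gc cos2pi sin2pi scale1r scale0r addr0.
move: GE; rewrite /G g0 g2 mulr0 => /eqP; rewrite -subr_eq0 -scalerBl scaler_eq0.
rewrite (negbTE (Psi_neq0 zd z0)) orbF subr_eq0 => /eqP /(congr1 (@complex.Re R)) /=.
by rewrite cos0 mulNr cosN.
Qed.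

Lemma vlim_quotient (s : Cvec R n) : vlim (fun t => (t^-1)%:C *: Psi (t%:C *: s)) (D 0 s).
Proof.
have H : vder (fun t : R => Psi (t%:C *: s + 0%:C *: 0)) 0 (D 0 s).
  have W : (0 : R)%:C *: s + 0%:C *: 0 = 0 by rewrite scale0r scaler0 addr0.
  have U1 : U ((0 : R)%:C *: s + 0%:C *: 0) by rewrite W; exact: Uball delta0.
  have := vder_map (a := id) (b := fun=> 0) oU sm U1 (der_id 0) (der_cst 0 0).
  by rewrite W scale1r scaler0 addr0.
move=> j; have [d1 d2] := H j.
have P0 : Psi ((0 : R)%:C *: s + 0%:C *: 0) j 0 = 0.
  by rewrite scale0r scaler0 addr0 Psi0 mxE.
have := lim_der d1; have := lim_der d2; rewrite P0 => /(_ erefl) L2 /(_ erefl) L1.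
split; [move: L1 | move: L2]; set g1 := (fun _ => _); set g2 := (fun _ => _);
  suff -> : g1 = g2 by []; apply/funext => t; rewrite /g1 /g2 scaler0 addr0 mxE.
  by rewrite ReZr.
by rewrite ImZr.
Qed.

Lemma vlim_differential (s v : Cvec R n) : vlim (fun t => D (t%:C *: s) v) (D 0 v).
Proof.
move=> j; have [c1 c2] := smooth_C1 j sm.
have L (h : Cvec R n -> R) : {for (0 : Cvec R n), continuous h} ->
    h (t%:C *: s) @[t --> (0 : R)^'+] --> h 0.
  move=> /continuous_normsqP H; apply/cvgrPdist_lt => e /H [d d0 Hd].
  have N : nbhs (0 : Cvec R n) [set w | `|h w - h 0| < e].
    by apply/nbhs_normsqP; exists d.
  have N2 := near_line s N.
  have N3 : \forall t \near (0 : R)^'+, `|h (0 + t%:C *: s) - h 0| < e.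
    by apply: filterS N2 => t Ht _.
  by apply: filterS N3 => t; rewrite add0r distrC.
have [_ /(_ v) [_ [cc1 _]]] := c1; have [_ /(_ v) [_ [cc2 _]]] := c2.
have L1 := L _ (cc1 _ (Uball delta0)); have L2 := L _ (cc2 _ (Uball delta0)).
rewrite [D 0 v j 0]mxE /cdird /=; split.
  rewrite (_ : (fun t => complex.Re (D (t%:C *: s) v j 0)) =
    (fun t => dird (fun z => complex.Re (Psi z j 0)) v (t%:C *: s))) //.
  by apply/funext => t; rewrite mxE.
rewrite (_ : (fun t => complex.Im (D (t%:C *: s) v j 0)) =
  (fun t => dird (fun z => complex.Im (Psi z j 0)) v (t%:C *: s))) //.
by apply/funext => t; rewrite mxE.
Qed.

Variable j0 : 'I_n.

Lemma D0_neq0 (s : Cvec R n) : s != 0 -> D 0 s != 0.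
Proof.
apply: contra_neq => Ds; apply: Im_hdot_nondeg => v; rewrite -(E2 delta0) Ds /radop.
by rewrite hdot0l !mulr0 scale0r scaler0 addr0 hdot0l mulr0.
Qed.

Lemma ImD0 u v : complex.Im (hdot (D 0 u) (D 0 v)) = lam * f1 0 * complex.Im (hdot u v).
Proof. by rewrite (E1 delta0) /radop normsq0 scaler0 addr0 hdotZl ImZr mulrA. Qed.

Lemma eps_gt0 : 0 < eps.
Proof. by have [_ + _] := ball delta0; rewrite normsq0. Qed.

Lemma f10_pos : 0 < f1 0. Proof. by apply: f1_pos; rewrite normr0 eps_gt0. Qed.

Lemma near_ray (s : Cvec R n) : \forall t \near (0 : R)^'+, 0 < t /\ x_ (t%:C *: s) < delta.
Proof.
have N : nbhs (0 : Cvec R n) [set w | x_ w < delta].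
  by apply/nbhs_normsqP; exists delta => // w; rewrite subr0.
apply: filterI; first exact: nbhs_right_gt.
by apply: filterS (near_line s N) => t Ht _; rewrite /= add0r in Ht.
Qed.

Lemma ray_D (s : Cvec R n) (t : R) : 0 < t -> x_ (t%:C *: s) < delta -> s != 0 ->
  D (t%:C *: s) ('i *: s) = ((mu (t%:C *: s))%:C * 'i) *: ((t^-1)%:C *: Psi (t%:C *: s)).
Proof.
move=> t0 ts s0; have ts0 : t%:C *: s != 0.
  by rewrite scaler_eq0 negb_or s0 andbT; apply/eqP => /(congr1 (@complex.Re R)) /= E; rewrite E ltxx in t0.
have := D_iz ts ts0; have -> : 'i *: (t%:C *: s) = t%:C *: ('i *: s) by rewrite !scalerA mulrC.
have -> : D (t%:C *: s) (t%:C *: ('i *: s)) = t%:C *: D (t%:C *: s) ('i *: s).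
  by have := Dlin ts t 0 ('i *: s) 0; rewrite !scale0r !addr0.
move=> E; rewrite scalerA mulrC -scalerA -E scalerA -rmorphM /= mulVf ?gt_eqF //.
by rewrite scale1r.
Qed.

(** Pair the identity D_(ts) (i s) = mu i Psi (t s) / t with i Psi (t s) / t and let t tend to
    0. *)
Lemma lim_mu (s : Cvec R n) : s != 0 ->
  mu (t%:C *: s) @[t --> (0 : R)^'+] --> lam * f1 0 * x_ s / x_ (D 0 s).
Proof.
move=> s0; have N1 : x_ (D 0 s) != 0 by rewrite normsq_eq0 D0_neq0.
pose F t := (t^-1)%:C *: Psi (t%:C *: s).
have LP : vlim F (D 0 s) by exact: vlim_quotient.
have LQ := vlim_differential s ('i *: s).
have L1 := lim_hdot LQ (vlim_i LP); have L2 := lim_normsq LP.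
have -> : lam * f1 0 * x_ s = complex.Re (hdot (D 0 ('i *: s)) ('i *: D 0 s)).
  rewrite hdotZr_i ReN Re_iM opprK ImD0 hdotZl Im_iM hdot_normsq //.
apply: lim_near (cvgM L1 (cvgV N1 L2)); apply: filterS (near_ray s) => t [t0 ts].
have F0 : F t != 0.
  rewrite scaler_eq0 negb_or; apply/andP; split.
    apply/eqP => /(congr1 (@complex.Re R)) /= /eqP; rewrite invr_eq0 => /eqP E; by rewrite E ltxx in t0.
  apply: Psi_neq0 => //; rewrite scaler_eq0 negb_or s0 andbT.
  by apply/eqP => /(congr1 (@complex.Re R)) /= E; rewrite E ltxx in t0.
rewrite /= (ray_D t0 ts s0) -/(F t); move: (F t) F0 => p p0.
rewrite -scalerA !hdotZl hdotZr_i hdot_normsq ReZr.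
have -> : 'i * (- ('i * (normsq p)%:C)) = (normsq p)%:C.
  by rewrite mulrN mulrA -expr2 sqr_i mulN1r opprK.
by rewrite /= mulfK // normsq_eq0.
Qed.

(** As mu takes the same values along s and i s, [lim_mu] gives |D_0 s| = |D_0 (i s)|. The limit
    of the norm of D_(ts) (i s) = mu i Psi (t s) / t then shows that mu tends to 1, that is |D_0
    s|^2 = lam f1(0) |s|^2, and expanding |D_0 (i s) - i D_0 s|^2 gives 0. *)
Lemma D0_i (s : Cvec R n) : D 0 ('i *: s) = 'i *: D 0 s.
Proof.
have [->|s0] := eqVneq s 0.
  by rewrite scaler0 (_ : D 0 0 = 0) ?scaler0 //; have := Dlin delta0 0 0 0 0; rewrite !scale0r addr0.
have is0 : 'i *: s != 0 by rewrite -normsq_eq0 normsq_i normsq_eq0.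
set K := lam * f1 0 * x_ s.
have K0 : 0 < K by rewrite !mulr_gt0 ?f10_pos ?pos_normsq.
have M1 := lim_mu s0; have M2 := lim_mu is0; rewrite normsq_i -/K in M1 M2.
have N1 : 0 < x_ (D 0 s) by rewrite pos_normsq // D0_neq0.
have N2 : 0 < x_ (D 0 ('i *: s)) by rewrite pos_normsq // D0_neq0.
have NN : x_ (D 0 s) = x_ (D 0 ('i *: s)).
  have M3 : mu (t%:C *: s) @[t --> (0 : R)^'+] --> K / x_ (D 0 ('i *: s)).
    apply: lim_near M2; apply: filterS (near_ray s) => t [t0 ts].
    by apply: esym; apply: mu_radial => //; rewrite !normsqZ normsq_i.
  have E : K / x_ (D 0 s) = K / x_ (D 0 ('i *: s)) by apply: (cvg_unique (@Rhausdorff R) M1 M3).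
  by apply: invr_inj; exact: (mulfI (lt0r_neq0 K0) E).
have E : x_ (D 0 ('i *: s)) = (K / x_ (D 0 s)) ^+ 2 * x_ (D 0 s).
  have L1 := lim_normsq (vlim_differential s ('i *: s)).
  have L2 := lim_normsq (vlim_quotient s).
  have L4 : normsq (D (t%:C *: s) ('i *: s)) @[t --> (0 : R)^'+] --> (K / x_ (D 0 s)) ^+ 2 * x_ (D 0 s).
    rewrite expr2; apply: lim_near (cvgM (cvgM M1 M1) L2); apply: filterS (near_ray s) => t [t0 ts].
    by rewrite /= (ray_D t0 ts s0) -scalerA [RHS]normsqZ normsq_i -expr2.
  by apply: (cvg_unique (@Rhausdorff R) L1 L4).
have KN : K = x_ (D 0 s).
  apply/eqP; rewrite -(@eqrXn2 _ 2 _ _ isT (ltW K0) (ltW N1)); apply/eqP.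
  have := E; rewrite -NN => /(congr1 (fun r => r * x_ (D 0 s))); rewrite -expr2 => ->.
  by rewrite -mulrA -expr2 -exprMn (divfK (lt0r_neq0 N1)).
apply/eqP; rewrite -subr_eq0 -normsq_eq0 normsqD normsqN normsq_i -NN hdotNr hdotZr_i opprK Re_iM.
by rewrite ImD0 hdotZl Im_iM hdot_normsq /= -/K KN; apply/eqP; ring.
Qed.

Lemma normsq_D0 (s : Cvec R n) : x_ (D 0 s) = lam * f1 0 * x_ s.
Proof.
have := ImD0 ('i *: s) s; rewrite D0_i !hdotZl !Im_iM !hdot_normsq //.
Qed.

(** By [cos_mu] mu is an integer, and by [lim_mu] it is close to 1 near the origin. *)
Lemma mu_eq1 : exists2 d, 0 < d & d <= delta /\ forall z, z != 0 -> x_ z < d -> mu z = 1.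
Proof.
pose s : Cvec R n := basis_vec R j0.
have s1 : x_ s = 1 by exact: normsq_basis.
have s0 : s != 0 by rewrite -normsq_eq0 s1 oner_eq0.
have := lim_mu s0; rewrite normsq_D0 s1 mulr1 mulfV; last first.
  by rewrite gt_eqF // mulr_gt0 // f10_pos.
move=> /cvgrPdist_lt /(_ (2^-1)) []; first by rewrite invr_gt0.
move=> r /= r0 Hr.
exists (Num.min delta (r ^+ 2)); first by rewrite lt_min delta_gt0 exprn_gt0.
split; first by rewrite ge_min lexx.
move=> z z0; rewrite lt_min => /andP[zd zr].
pose t := Num.sqrt (x_ z); have x0 := pos_normsq z0.
have t0 : 0 < t by rewrite sqrtr_gt0.
have t2 : t ^+ 2 = x_ z by rewrite sqr_sqrtr // ltW.
have tr : t < r by rewrite -(ltr_pXn2r (n := 2)) ?nnegrE ?ltW // t2.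
have E : mu z = mu (t%:C *: s).
  by apply: mu_radial => //; rewrite normsqZ s1 mulr1 t2.
have := Hr t; rewrite /= sub0r normrN gtr0_norm // => /(_ tr t0); rewrite -E.
have := cos_mu zd z0; set m := mu z => C.
have {C} : cos `|(m - 1) * (pi *+ 2)| = 1.
  by rewrite cos_norm mulrBl mul1r cosB cos2pi sin2pi mulr0 addr0 mulr1.
rewrite -[1 in RHS]cos0 => C H.
have pp : 0 < pi :> R by exact: pi_gt0.
have := @cos_inj R _ 0 _ _ C; rewrite !in_itv /= lexx (ltW pp) => /(_ _ isT) N.
have {N} /normr0P : `|(m - 1) * (pi *+ 2)| = 0.
  apply: N; rewrite normr_ge0 /= normrM [`|pi *+ 2|]ger0_norm; last by rewrite mulrn_wge0 ?ltW.
  rewrite -mulr_natr; move: H; rewrite distrC; nra.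
rewrite mulf_eq0 mulrn_eq0 (gt_eqF pp) /= orbF subr_eq0 => /eqP //.
Qed.

Variable d1 : R.
Hypothesis d1_le : d1 <= delta.
Hypothesis mu1 : forall z, z != 0 -> x_ z < d1 -> mu z = 1.

Lemma d1_delta z : x_ z < d1 -> x_ z < delta. Proof. by move=> h; exact: lt_le_trans d1_le. Qed.

Lemma kapE z : z != 0 -> x_ z < d1 -> kap z = lam * e_ z.
Proof.
move=> z0 zd; have := mu1 z0 zd; rewrite /mu => /(congr1 (fun r => r * kap z)).
by rewrite mul1r divfK // kap_neq0 // d1_delta.
Qed.

Lemma D_iz1 z : z != 0 -> x_ z < d1 -> D z ('i *: z) = 'i *: Psi z.
Proof. by move=> z0 zd; rewrite D_iz ?d1_delta // mu1 // mul1r. Qed.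

Lemma ray_le z (t : R) : 0 <= t <= 1 -> x_ (t%:C *: z) <= x_ z.
Proof.
by move=> /andP[t0 t1]; rewrite normsqZ ler_piMl ?normsq_ge0 // expr_le1.
Qed.

Lemma vder_ray z (t : R) : 0 <= t <= 1 -> x_ z < delta ->
  vder (fun t : R => Psi (t%:C *: z + 0%:C *: 0)) t (D (t%:C *: z) z).
Proof.
move=> t01 zd; have W : t%:C *: z + 0%:C *: 0 = t%:C *: z by rewrite scaler0 addr0.
have U1 : U (t%:C *: z + 0%:C *: 0) by rewrite W; apply: Uball; exact: le_lt_trans (ray_le z t01) zd.
have := vder_map (a := id) (b := fun=> 0) oU sm U1 (der_id t) (der_cst t 0).
by rewrite W scale1r scaler0 addr0.
Qed.

Lemma D_ray z (t : R) : 0 < t -> x_ (t%:C *: z) < delta ->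
  D (t%:C *: z) z = (t^-1)%:C *: D (t%:C *: z) (t%:C *: z).
Proof.
move=> t0 td; have := Dlin td t 0 z 0; rewrite !scale0r !addr0 => ->.
by rewrite scalerA -rmorphM /= mulVf ?gt_eqF // scale1r.
Qed.

(** Both sides agree at 0 and have the same derivative along the ray of z, since kap = lam e by
    [mu_eq1]. *)
Lemma y_formula z : x_ z < d1 -> y_ z = lam * x_ z * f1 (x_ z).
Proof.
move=> zd; have [->|z0] := eqVneq z 0.
  by rewrite Psi0 normsq0 mulr0 mul0r.
have zdelta := d1_delta zd.
pose h (t : R) := y_ (t%:C *: z + 0%:C *: 0) - lam * ((t * t * x_ z) * f1 (t * t * x_ z)).
have H : h 0 = h 1.
  apply: cst_of_der0 => // t t01; have /andP[t0 t1] := t01.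
  have td : x_ (t%:C *: z) < d1 by exact: le_lt_trans (ray_le z t01) zd.
  have nt : x_ (t%:C *: z) = t * t * x_ z by rewrite normsqZ expr2.
  have A1 := der_normsq (vder_ray t01 zdelta).
  have dX : is_derive t 1 (fun t : R => t * t * x_ z) (2 * t * x_ z).
    by apply: der_eq (derM (derM (der_id t) (der_id t)) (der_cst t (x_ z))) => //; ring.
  have dF : is_derive (t * t * x_ z) 1 f1 (f2 (t * t * x_ z)).
    by apply: df1; rewrite -nt; apply: xeps; exact: d1_delta.
  have A2 := derZ lam (derM dX (der_comp (g := fun t => t * t * x_ z) dF dX)).
  apply: der_eq (derB A1 A2) => //; rewrite /h.
  rewrite scaler0 addr0; apply/eqP; rewrite subr_eq0; apply/eqP.
  move: t0; rewrite le_eqVlt => /predU1P[<-|t0].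
    by rewrite scale0r Psi0 hdotC hdot0l ReJ /=; ring.
  rewrite D_ray ?d1_delta // hdotZl ReZr.
  have tz0 : t%:C *: z != 0 by rewrite -normsq_eq0 nt !mulf_neq0 ?gt_eqF // pos_normsq.
  rewrite (D_kap _ (d1_delta td) tz0) (kapE tz0 td) hdot_normsq /= nt.
  by field; rewrite gt_eqF.
move: H; rewrite /h scale0r scale1r scaler0 !addr0 Psi0 normsq0 !mul0r mulr0 subrr !mul1r.
by move/esym/eqP; rewrite subr_eq0 => /eqP ->; ring.
Qed.

Lemma y_pos z : z != 0 -> x_ z < d1 -> 0 < y_ z.
Proof. by move=> z0 /d1_delta zd; apply: pos_normsq; exact: Psi_neq0. Qed.

Lemma radop_self (a b : R) z (k : R[i]) : radop a b z (k *: z) = (a + normsq z * b)%:C *: (k *: z).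
Proof.
rewrite /radop hdotZl hdot_normsq !scalerA -scalerDl; congr (_ *: _).
by rewrite rmorphD rmorphM; ring.
Qed.

Lemma D_scale z (r : R) u : x_ z < delta -> D z (r%:C *: u) = r%:C *: D z u.
Proof. by move=> zd; have := Dlin zd r 0 u 0; rewrite !scale0r !addr0. Qed.

(** i z and i Psi z are eigenvectors of the two operators in [duality_conj]. *)
Lemma e_dual z : z != 0 -> x_ z < d1 ->
  lam ^+ 2 * e_ z * (f1 (- y_ z) + (- y_ z) * f2 (- y_ z)) = 1.
Proof.
move=> z0 zd; have zdelta := d1_delta zd; have w0 := Psi_neq0 zdelta z0.
have H := duality_conj (Dlin zdelta) (E1 zdelta) (E2 zdelta) ('i *: z).
rewrite radop_self (D_scale _ _ zdelta) (D_iz1 z0 zd) [_%:C *: ('i *: Psi z)]scalerA radop_self in H.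
set es := f1 _ + y_ z * _ in H.
have {}H : (lam ^+ 2 * es * e_ z)%:C *: ('i *: Psi z) = 'i *: Psi z.
  by rewrite -[RHS]H !scalerA !rmorphM; congr (_ *: _); ring.
have iw : 'i *: Psi z != 0 by rewrite -normsq_eq0 normsq_i normsq_eq0.
have : (lam ^+ 2 * es * e_ z - 1)%:C *: ('i *: Psi z) = 0.
  by rewrite rmorphB scalerBl H scale1r subrr.
move/eqP; rewrite scaler_eq0 (negbTE iw) orbF => /eqP /(congr1 (@complex.Re R)) /= /eqP.
by rewrite subr_eq0 => /eqP <-; rewrite /es; ring.
Qed.

Lemma f2_dual_neq0 z : z != 0 -> x_ z < d1 -> f2 (- y_ z) != 0.
Proof.
move=> z0 zd; apply: f2_nz; first by apply: yeps; exact: d1_delta.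
by rewrite oppr_eq0 gt_eqF // y_pos.
Qed.

(** In [duality_conj] at z, the product lam^2 e(x) f1 (- y) differs from 1 by a multiple of f2
    (- y), which is not 0; hence D z has no component outside the complex line of Psi z. *)
Lemma D_radial z : z != 0 -> x_ z < d1 ->
  D z z = (hdot (D z z) (Psi z) / (y_ z)%:C) *: Psi z.
Proof.
move=> z0 zd; have zdelta := d1_delta zd.
have H := duality_conj (Dlin zdelta) (E1 zdelta) (E2 zdelta) (1 *: z).
rewrite radop_self scale1r (D_scale _ _ zdelta) in H.
have ed := e_dual z0 zd; have y0 := y_pos z0 zd.
set g1 := f1 (- y_ z) in H ed; set g2 := f2 (- y_ z) in H ed.
have g0 : g2 != 0 by exact: f2_dual_neq0.
set p := D z z in H *; set h := hdot p (Psi z).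
pose k := lam ^+ 2 * e_ z * g2.
have k0 : k != 0.
  rewrite /k mulf_neq0 // mulf_neq0 //; first by rewrite gt_eqF // exprn_gt0.
  by rewrite gt_eqF // e_pos // xeps.
have Hp : p = (lam ^+ 2 * e_ z * g1)%:C *: p + ((- k)%:C * h) *: Psi z.
  rewrite -[LHS]H /radop hdotZl -/h scalerDr !scalerA; congr (_ *: _ + _ *: _); rewrite /k !(rmorphM, rmorphN) /=; ring.
have : p - (lam ^+ 2 * e_ z * g1)%:C *: p = ((- k)%:C * h) *: Psi z by rewrite {1}Hp addrAC subrr add0r.
rewrite -[X in X - _]scale1r -scalerBl.
have -> : 1 - (lam ^+ 2 * e_ z * g1)%:C = (- k * y_ z)%:C :> R[i].
  by rewrite -(rmorph1 (@real_complex R)) -rmorphB /=; congr (_%:C); rewrite -ed /k; ring.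
move=> E; have K0 : (- k * y_ z)%:C != 0 :> R[i].
  by rewrite fmorph_eq0 mulf_neq0 ?oppr_eq0 // gt_eqF.
apply: (scalerI K0); rewrite E scalerA; congr (_ *: _); rewrite !rmorphM rmorphN.
by field; rewrite fmorph_eq0 gt_eqF.
Qed.

(** If the product were nonzero, [duality_conj] would give lam^2 f1 (x) (f1 (- y) - y f2 (- y))
    = 1, against [e_dual], because f2 (x) is not 0. *)
Lemma D_orth z u : z != 0 -> x_ z < d1 -> hdot u z = 0 -> hdot (D z u) (Psi z) = 0.
Proof.
move=> z0 zd uz; have zdelta := d1_delta zd.
have H := duality_conj (Dlin zdelta) (E1 zdelta) (E2 zdelta) u.
have Pu : P z u = (f1 (x_ z))%:C *: u by rewrite /radop uz mulr0 scale0r addr0.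
rewrite Pu (D_scale _ _ zdelta) in H.
have := congr1 (fun v => hdot v (Psi z)) H.
rewrite hdotZl /radop hdotDl !hdotZl hdot_normsq; set h := hdot (D z u) (Psi z).
have ed := e_dual z0 zd; set g1 := f1 (- y_ z) in ed *; set g2 := f2 (- y_ z) in ed *.
set a := f1 (x_ z) in ed *; set b := f2 (x_ z) in ed *; set X := x_ z in ed *; set Y := y_ z in ed *.
have -> : (lam ^+ 2)%:C * (g1%:C * (a%:C * h) + (- g2)%:C * (a%:C * h) * Y%:C) =
   (lam ^+ 2 * a * (g1 + (- Y) * g2))%:C * h.
  by rewrite !(rmorphM, rmorphD, rmorphN) /=; ring.
move=> E; apply/eqP; apply: contraT => h0; move: E => /eqP.
rewrite -[X in _ == X]mul1r (inj_eq (mulIf h0)) => /eqP /(congr1 (@complex.Re R)) /= E.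
have b0 : X * b != 0.
  have x0 : X != 0 by rewrite gt_eqF // pos_normsq.
  by rewrite mulf_neq0 // f2_nz // xeps.
have Z : X * b * (lam ^+ 2 * (g1 + (- Y) * g2)) = 0 by rewrite -(subrr 1) -{1}ed -E; ring.
move/eqP: Z; rewrite mulf_eq0 (negbTE b0) /= => /eqP Z; have := ed.
rewrite mulrAC Z mul0r => /eqP; rewrite eq_sym oner_eq0 //.
Qed.

(** By [D_radial] the velocity of s |-> Psi (s z) is a complex multiple of Psi (s z), so the
    Hermitian angle between Psi (s z) and Psi z is constant, and it is 0 for s = 1. *)
Lemma ray_gram z (t : R) : z != 0 -> x_ z < d1 -> 0 < t <= 1 ->
  sqn (hdot (Psi z) (Psi (t%:C *: z))) = normsq (Psi z) * normsq (Psi (t%:C *: z)).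
Proof.
move=> z0 zd /andP[t0 t1]; have zdelta := d1_delta zd.
pose F (s : R) := Psi (s%:C *: z + 0%:C *: 0).
have FE s : F s = Psi (s%:C *: z) by rewrite /F scaler0 addr0.
pose g s := sqn (hdot (Psi z) (F s)) * (normsq (F s))^-1.
have G : g t = g 1.
  apply: cst_of_der0 => // s /andP[ts s1]; have s0 := lt_le_trans t0 ts.
  have s01 : 0 <= s <= 1 by rewrite ltW.
  have sd : x_ (s%:C *: z) < d1 by exact: le_lt_trans (ray_le z s01) zd.
  have sz0 : s%:C *: z != 0.
    by rewrite -normsq_eq0 normsqZ mulf_neq0 ?normsq_eq0 // expf_neq0 // gt_eqF.
  pose m : R[i] := (s^-1)%:C * (hdot (D (s%:C *: z) (s%:C *: z)) (F s) / (normsq (F s))%:C).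
  have dF : vder F s (m *: F s).
    have := vder_ray s01 zdelta; rewrite D_ray ?d1_delta // D_radial //.
    by rewrite scalerA -FE.
  have y0 : normsq (F s) != 0 by rewrite FE gt_eqF // y_pos.
  have [dA dB] := cder_hdot (vder_cst s (Psi z)) dF.
  have dy := der_normsq dF.
  have H := derM (derD (derM dA dA) (derM dB dB)) (derV dy y0).
  apply: der_eq H => [r|]; first by rewrite /g /sqn !expr2.
  rewrite hdot0l add0r hdotZr hdotZl hdot_normsq.
  move: (hdot _ _) => [a b]; move: (normsq _) y0 => Y Y0.
  case: m {dF dA dB dy} => p q /=; field; exact: Y0.
have F1 : F 1 = Psi z by rewrite FE scale1r.
have Ft0 : normsq (F t) != 0.
  have tz0 : t%:C *: z != 0.
    by rewrite scaler_eq0 negb_or z0 andbT fmorph_eq0 (lt0r_neq0 t0).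
  have td : x_ (t%:C *: z) < d1 by apply: le_lt_trans (ray_le z _) zd; rewrite (ltW t0) t1.
  by rewrite FE; exact: lt0r_neq0 (y_pos tz0 td).
move: G; rewrite /g F1 hdot_normsq {2}/sqn /= expr0n addr0 -FE => /(congr1 (fun r => r * normsq (F t))).
by rewrite mulfVK // => ->; rewrite expr2 mulfK // gt_eqF // y_pos.
Qed.

(** Divide Psi (t z) by t in [ray_gram] and let t tend to 0. *)
Lemma Psi_line z : z != 0 -> x_ z < d1 ->
  Psi z = (hdot (Psi z) (D 0 z) / (normsq (D 0 z))%:C) *: D 0 z.
Proof.
move=> z0 zd; set w := Psi z; set d := D 0 z.
have d0 : 0 < normsq d by apply: pos_normsq; exact: D0_neq0.
have LP := vlim_quotient z.
have vc v : vlim (fun=> v) v by move=> j; split; exact: cvg_cst.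
have L1 := lim_hdot (vc w) LP; have L2 := lim_hdot (vlim_i (vc w)) LP; have L3 := lim_normsq LP.
have E : sqn (hdot w d) = normsq w * normsq d.
  have sE v : sqn (hdot w v) = complex.Re (hdot w v) * complex.Re (hdot w v) +
     complex.Re (hdot ('i *: w) v) * complex.Re (hdot ('i *: w) v).
    by rewrite hdotZl Re_iM /sqn !expr2 mulrNN.
  rewrite sE; apply: (cvg_unique (@Rhausdorff R) (cvgD (cvgM L1 L1) (cvgM L2 L2))).
  apply: lim_near (cvgM (cvg_cst (normsq w)) L3).
  have N1 : \forall t \near (0 : R)^'+, t <= 1 by apply: nbhs_right_le.
  apply: filterS2 N1 (near_ray z) => t t1 [t0 td] /=.
  rewrite !fctE -sE hdotZr_real normsqZ mulrCA -ray_gram ?t0 //.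
  by rewrite /sqn ReZr ImZr; ring.
have : normsq ((normsq d)%:C *: w - hdot w d *: d) == 0 by rewrite gram E; apply/eqP; ring.
rewrite normsq_eq0 subr_eq0 => /eqP H.
have D0 : (normsq d)%:C != 0 :> R[i] by rewrite fmorph_eq0 gt_eqF.
by apply: (scalerI D0); rewrite H scalerA mulrC divfK.
Qed.

Definition s0 : R := Num.sqrt (lam * f1 0).

Lemma s0_sq : s0 ^+ 2 = lam * f1 0.
Proof. by rewrite sqr_sqrtr // ltW // mulr_gt0 // f10_pos. Qed.

Lemma s0_pos : 0 < s0. Proof. by rewrite sqrtr_gt0 mulr_gt0 // f10_pos. Qed.

(** The differential at 0 divided by sqrt(lam f1(0)); it is complex linear by [D0_i]. *)
Definition unitary_part : 'M[R[i]]_n :=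
  \matrix_(i, j) ((s0^-1)%:C * (D 0 (basis_vec R j) i 0 : R[i])).

Lemma D0_clinear (c : R[i]) u v : D 0 (c *: u + v) = c *: D 0 u + D 0 v.
Proof.
have -> : c *: u + v = 1%:C *: ((complex.Re c)%:C *: u + (complex.Im c)%:C *: ('i *: u)) + 1%:C *: v.
  rewrite !scale1r scalerA -scalerDl; congr (_ *: _ + _).
  by case: c => a b; simpc.
rewrite (Dlin delta0) (Dlin delta0) D0_i !scale1r scalerA -scalerDl; congr (_ *: _ + _).
by case: c => a b; simpc.
Qed.

Lemma unitary_partE z : unitary_part *m z = (s0^-1)%:C *: D 0 z.
Proof.
have zE : z = \sum_j z j 0 *: basis_vec R j.
  apply/matrixP => i k; rewrite (ord1 k) summxE (bigD1 i) //= big1 => [|j ji]; rewrite /basis_vec !mxE.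
    by rewrite !eqxx /= mulr1 addr0.
  by rewrite eq_sym (negbTE ji) /= mulr0.
have D00 : D 0 0 = 0 by have := Dlin delta0 0 0 0 0; rewrite !scale0r addr0.
have DD u v : D 0 (u + v) = D 0 u + D 0 v by have := D0_clinear 1 u v; rewrite !scale1r.
have DZ (c : R[i]) u : D 0 (c *: u) = c *: D 0 u by have := D0_clinear c u 0; rewrite D00 !addr0.
rewrite [in RHS]zE (big_morph (D 0) DD D00) scaler_sumr; apply/matrixP => i k.
rewrite (ord1 k) mxE summxE; apply: eq_bigr => j _; rewrite DZ !mxE.
by rewrite mulrAC -mulrA.
Qed.

Lemma hdot_D0 u v : hdot (D 0 u) (D 0 v) = (lam * f1 0)%:C * hdot u v.
Proof.
have := ImD0 ('i *: u) v; rewrite D0_i !hdotZl !Im_iM => H.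
by apply/eqP; rewrite eq_complex ReZr ImZr ImD0 H !eqxx.
Qed.

Lemma hdot_unitary_part u v : hdot (unitary_part *m u) (unitary_part *m v) = hdot u v.
Proof.
rewrite !unitary_partE hdotZl hdotZr_real hdot_D0 !mulrA -!rmorphM /= -s0_sq.
have -> : s0^-1 * s0^-1 * s0 ^+ 2 = 1 by field; rewrite gt_eqF // s0_pos.
by rewrite mul1r.
Qed.

Lemma unitary_part_unitary : unitary_part \is unitarymx.
Proof.
apply/unitarymxP; apply: mulmx1C; apply/matrixP => i j.
rewrite !mxE; have := hdot_unitary_part (basis_vec R j) (basis_vec R i).
have C m k : (unitary_part *m basis_vec R m) k 0 = unitary_part k m.
  rewrite mxE (bigD1 m) //= big1 => [|l lm]; rewrite /basis_vec !mxE.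
    by rewrite !eqxx /= mulr1 addr0.
  by rewrite (negbTE lm) /= mulr0.
rewrite hdot_basis /hdot /basis_vec !mxE eqxx andbT => <-; apply: eq_bigr => k _.
by rewrite !C !mxE mulrC.
Qed.

Definition factor z : R[i] := hdot (Psi z) (unitary_part *m z) / (x_ z)%:C.

Lemma Psi_factor z : z != 0 -> x_ z < d1 -> Psi z = factor z *: (unitary_part *m z).
Proof.
move=> z0 zd; have x0 := pos_normsq z0.
rewrite {1}(Psi_line z0 zd) /factor unitary_partE hdotZr_real normsq_D0 scalerA; congr (_ *: _).
rewrite -s0_sq rmorphM rmorphXn /= fmorphV.
by field; rewrite !fmorph_eq0 !gt_eqF // s0_pos.
Qed.

Lemma sqn_factor z : z != 0 -> x_ z < d1 -> sqn (factor z) = lam * f1 (x_ z).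
Proof.
move=> z0 zd; have x0 := pos_normsq z0.
have H : y_ z = sqn (factor z) * x_ z.
  rewrite {1}(Psi_factor z0 zd) normsqZc sqnE /=; congr (_ * _).
  by have := hdot_unitary_part z z; rewrite !hdot_normsq => /(congr1 (@complex.Re R)).
apply: (mulIf (lt0r_neq0 x0)); rewrite -H y_formula //; ring.
Qed.

Lemma factor_neq0 z : z != 0 -> x_ z < d1 -> factor z != 0.
Proof.
move=> z0 zd; apply/eqP => E; have := Psi_neq0 (d1_delta zd) z0.
by rewrite (Psi_factor z0 zd) E scale0r eqxx.
Qed.

(** The derivative of <Psi z, A z> along a tangent vector u. The component of u orthogonal to z
    contributes 0 by [D_orth] and unitarity; for the component along i z the two terms cancel.
    *)
Lemma factor_stationary z u : z != 0 -> x_ z < d1 -> complex.Re (hdot u z) = 0 ->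
  hdot (D z u) (unitary_part *m z) + hdot (Psi z) (unitary_part *m u) = 0.
Proof.
move=> z0 zd uz; have zdelta := d1_delta zd; have x0 := pos_normsq z0.
pose b := complex.Im (hdot u z).
have uzE : hdot u z = 'i * b%:C by rewrite /b; case: (hdot u z) uz => r s /= ->; simpc.
pose v := u - (b / x_ z)%:C *: ('i *: z).
have vz : hdot v z = 0.
  rewrite /v hdotBl !hdotZl uzE hdot_normsq rmorphM /= fmorphV; field.
  by rewrite fmorph_eq0 gt_eqF.
have uE : u = 1%:C *: v + (b / x_ z)%:C *: ('i *: z) by rewrite scale1r subrK.
have Dv := D_orth z0 zd vz.
have DvA : hdot (D z v) (unitary_part *m z) = 0.
  move: Dv; rewrite (Psi_factor z0 zd) hdotZr => /eqP; rewrite mulf_eq0 => /orP[|/eqP //].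
  by rewrite conjc_eq0 (negbTE (factor_neq0 z0 zd)).
have qx : hdot (Psi z) (unitary_part *m z) = factor z * (x_ z)%:C.
  by rewrite /factor divfK // fmorph_eq0 gt_eqF.
rewrite {1}uE (Dlin zdelta) D_iz1 // scale1r hdotDl DvA add0r !hdotZl qx.
rewrite {1}(Psi_factor z0 zd) hdotZl hdot_unitary_part (hdotC u z) uzE.
have -> : conjc ('i * b%:C) = - ('i * b%:C) :> R[i].
  by apply/eqP; rewrite eq_complex /=; apply/andP; split; apply/eqP; ring.
by rewrite rmorphM /= fmorphV; field; rewrite fmorph_eq0 gt_eqF.
Qed.

(** Two points of a sphere lie on a great circle, along which [factor_stationary] applies. *)
Lemma factor_radial z z' : z != 0 -> x_ z < d1 -> x_ z = x_ z' -> factor z = factor z'.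
Proof.
move=> z0 zd E; rewrite /factor -E; congr (_ / _).
have [v [t [nv zv ->]]] := great_circle E; have zdelta := d1_delta zd.
pose H (s : R) : R[i] := hdot (Psi (gc z v s)) (unitary_part *m gc z v s).
have dA s : vder (fun s => unitary_part *m gc z v s) s (unitary_part *m dgc z v s).
  have L a b (p r : Cvec R n) : unitary_part *m (a%:C *: p + b%:C *: r) =
      (a%:C : R[i]) *: (unitary_part *m p) + b%:C *: (unitary_part *m r).
    by rewrite mulmxDr -!scalemxAr.
  rewrite /dgc L; have := vder_comb (unitary_part *m z) (unitary_part *m v) (is_derive_cos s) (is_derive_sin s).
  by move=> K j; apply: cder_eq (K j) => // r; rewrite /gc L.
have dH s : cder H s 0.
  have := cder_hdot (vder_Psi_gc s zdelta nv zv) (dA s).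
  have ng : x_ (gc z v s) = x_ z by exact: gc_normsq.
  rewrite factor_stationary ?ng //; first by rewrite -normsq_eq0 ng normsq_eq0.
  exact: gc_tangent.
have g0 : gc z v 0 = z by rewrite /gc cos0 sin0 scale1r scale0r addr0.
rewrite -/(gc z v t) -[LHS]/(hdot (Psi z) (unitary_part *m z)) -{1 2}g0 -/(H 0) -/(H t).
case: (leP 0 t) => [t0|/ltW t0]; first by apply: cst_of_cder0 t0 _ => s _.
by apply/esym; apply: cst_of_cder0 t0 _ => s _.
Qed.

Lemma lam_f10 : lam ^+ 2 * f1 0 ^+ 2 = 1.
Proof.
have b1 : complex.Im (hdot ('i *: basis_vec R j0) (basis_vec R j0)) = 1.
  by rewrite hdotZl Im_iM hdot_basis /basis_vec !mxE !eqxx.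
have := E2 delta0 ('i *: basis_vec R j0) (basis_vec R j0).
rewrite Psi0 normsq0 oppr0 /radop scaler0 addr0 hdotZl ImZr ImD0 b1 => <-; ring.
Qed.

Lemma duality_near0 : [/\ unitary_part \is unitarymx,
  forall z, z != 0 -> x_ z < d1 ->
    [/\ Psi z = factor z *: (unitary_part *m z), sqn (factor z) = lam * f1 (x_ z) &
      forall z', x_ z = x_ z' -> factor z = factor z'],
  lam ^+ 2 * f1 0 ^+ 2 = 1 &
  forall x, 0 < x -> x < d1 -> let y := lam * x * f1 x in
    `|y| < eps /\ lam ^+ 2 * (f1 x + x * f2 x) * (f1 (- y) + (- y) * f2 (- y)) = 1].
Proof.
split; first exact: unitary_part_unitary.
- by move=> z z0 zd; split; [exact: Psi_factor | exact: sqn_factor | move=> z'; exact: factor_radial].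
- exact: lam_f10.
move=> x x0 xd; pose z : Cvec R n := (Num.sqrt x)%:C *: basis_vec R j0.
have zx : x_ z = x by rewrite normsqZ sqr_sqrtr ?normsq_basis ?mulr1 // ltW.
have z0 : z != 0 by rewrite -normsq_eq0 zx gt_eqF.
have zd : x_ z < d1 by rewrite zx.
have yE := y_formula zd; rewrite zx in yE.
rewrite /= -yE; split; last by have := e_dual z0 zd; rewrite zx.
by have := yeps (d1_delta zd); rewrite normrN.
Qed.

End core.

(** * Radial potentials away from the origin *)

Section local_lemmas.
Variables (R : realType) (n : nat).
Implicit Types (u v z w : Cvec R n) (U M : set (Cvec R n)).

(** f is given by a power series near 0 only. At |z1|^2 its smoothness is inherited from Phi by
    restriction to the ray of z1, on which x is the squared norm of sqrt(x / |z1|^2) z1. *)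
Lemma radial_C2 M (Phi : Cvec R n -> R) (f : R -> R) z1 : open M -> real_analytic M Phi ->
  (forall z, M z -> Phi z = f (normsq z)) -> M z1 -> z1 != 0 ->
  exists (phi1 : R -> R) (phi2 r : R), [/\ 0 < r,
    forall x : R, `|x - normsq z1| < r -> is_derive x 1 f (phi1 x) &
    is_derive (normsq z1) 1 phi1 phi2].
Proof.
move=> oM an E Mz z0; set x1 := normsq z1.
have x0 : 0 < x1 by exact: pos_normsq.
have [c [rho [pc Hc]]] := analytic_line z1 an Mz.
have : \forall w \near z1, M w by apply: open_nbhs_nbhs.
move=> /(near_line z1) /nbhs_ballP[r0 /= r0_gt0 Hr0].
pose sg (x : R) := Num.sqrt (x / x1) - 1.
have dsg (x : R) : 0 < x -> is_derive x 1 sg ((2 * Num.sqrt (x / x1))^-1 * x1^-1).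
  move=> xp; have xq : 0 < x / x1 by rewrite divr_gt0.
  have dl : is_derive x 1 (fun x : R => x / x1) x1^-1.
    by apply: der_eq (derM (der_id x) (der_cst x x1^-1)) => //; rewrite mulr0 addr0 mul1r.
  have := derB (der_comp (g := fun x => x / x1) (is_derive1_sqrt xq) dl) (der_cst x 1).
  by apply: der_eq => //; rewrite subr0.
have sg1 : sg x1 = 0 by rewrite /sg mulfV ?gt_eqF // sqrtr1 subrr.
have rho0 := pc.1.
have /continuousP_dist := der_cont (dsg _ x0).
move=> /(_ (Num.min rho r0)) []; first by rewrite lt_min rho0.
move=> r r_gt0 Hr; rewrite sg1 in Hr.
have small x : `|x - x1| < r -> `|sg x| < rho /\ `|sg x| < r0.
  by move=> /Hr; rewrite subr0 lt_min => /andP[].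
have fE x : `|x - x1| < r -> 0 < x -> f x = psum c (sg x).
  move=> xr xp; have [s1 s2] := small _ xr.
  rewrite -(Hc _ s1) E; last by apply: Hr0; rewrite /ball /= sub0r normrN.
  congr f; have -> : z1 + (sg x)%:C *: z1 = (Num.sqrt (x / x1))%:C *: z1.
    by rewrite -[X in X + _]scale1r -scalerDl -rmorphD addrC subrK.
  by rewrite normsqZ sqr_sqrtr ?divfK ?gt_eqF // divr_ge0 // ltW.
pose phi1 x := psum (pseries_diffs c) (sg x) * ((2 * Num.sqrt (x / x1))^-1 * x1^-1).
have pos x : `|x - x1| < Num.min r x1 -> 0 < x /\ `|x - x1| < r.
  rewrite lt_min => /andP[xr xx]; split => //.
  by move: xx; rewrite ltr_norml => /andP[]; lra.
have hs : is_derive x1 1 (fun x : R => 2 * Num.sqrt (x / x1)) (2 * ((2 * Num.sqrt (x1 / x1))^-1 * x1^-1)).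
  by have := derZ 2 (derD (dsg _ x0) (der_cst x1 1)); apply: der_eq => [t|]; rewrite ?subrK ?addr0.
have hs0 : 2 * Num.sqrt (x1 / x1) != 0.
  by rewrite mulfV ?gt_eqF // sqrtr1 mulr1 pnatr_eq0.
have dg : is_derive (sg x1) 1 (psum (pseries_diffs c)) (psum (pseries_diffs (pseries_diffs c)) (sg x1)).
  by apply: der_psum (pconv_diffs pc) _; rewrite sg1 normr0.
exists phi1; eexists; exists (Num.min r x1); split.
- by rewrite lt_min r_gt0.
- move=> x xr; have [xp xr'] := pos _ xr.
  have D : is_derive x 1 (fun t => psum c (sg t)) (phi1 x).
    by apply: der_comp (dsg _ xp); apply: der_psum pc _; have [] := small _ xr'.
  apply: der_near D; apply/nbhs_ballP; exists (Num.min r x1 - `|x - x1|); first by rewrite /= subr_gt0.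
  move=> t; rewrite /ball /= distrC => xt.
  have /pos[tp tr] : `|t - x1| < Num.min r x1.
    rewrite -(subrK x t) -addrA; apply: le_lt_trans (ler_normD _ _) _; move: xt; lra.
  by rewrite fE.
- exact: derM (der_comp dg (dsg _ x0)) (derM (derV hs hs0) (der_cst x1 x1^-1)).
Qed.

Lemma hessian_on M (Phi : Cvec R n -> R) (f phi1 : R -> R) (phi2 r : R) z : open M ->
  (forall z, M z -> Phi z = f (normsq z)) -> M z -> 0 < r ->
  (forall x : R, `|x - normsq z| < r -> is_derive x 1 f (phi1 x)) ->
  is_derive (normsq z) 1 phi1 phi2 ->
  forall j k, complex_hessian Phi z j k =
    (phi1 (normsq z))%:C * (j == k)%:R + phi2%:C * (conjc (z j 0) * z k 0).
Proof.
move=> oM E Mz r0 D1 D2; apply: (complex_hessian_radial r0 D1 D2).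
have : \forall w \near z, M w by apply: open_nbhs_nbhs.
by apply: filterS => w; exact: E.
Qed.

Lemma hessian_psum M (Phi : Cvec R n -> R) (c : nat -> R) (rho : R) z : open M -> pconv c rho ->
  (forall z, M z -> normsq z < rho -> Phi z = psum c (normsq z)) -> M z -> normsq z < rho ->
  forall j k, complex_hessian Phi z j k =
    (psum (pseries_diffs c) (normsq z))%:C * (j == k)%:R +
    (psum (pseries_diffs (pseries_diffs c)) (normsq z))%:C * (conjc (z j 0) * z k 0).
Proof.
move=> oM pc E Mz zr; have z0 := normsq_ge0 z.
have r0 : 0 < rho - normsq z by rewrite subr_gt0.
apply: (complex_hessian_radial (phi := psum c) r0).
- move=> x xr; apply: der_psum pc _; rewrite -(subrK (normsq z) x).
  by apply: le_lt_trans (ler_normD _ _) _; rewrite (ger0_norm z0) -ltrBrDr.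
- by apply: der_psum (pconv_diffs pc) _; rewrite ger0_norm.
have N1 : \forall w \near z, M w by apply: open_nbhs_nbhs.
apply: filterS2 N1 (normsq_cont z r0) => w Mw; rewrite ltr_norml => /andP[_].
by rewrite ltrD2r; exact: E.
Qed.

Lemma hessian_dual (Phi' : Cvec R n -> R) (c : nat -> R) (rho d : R) z : pconv c rho ->
  (forall z, normsq z < d -> Phi' z = - psum c (- normsq z)) -> normsq z < d -> normsq z < rho ->
  forall j k, complex_hessian Phi' z j k =
    (psum (pseries_diffs c) (- normsq z))%:C * (j == k)%:R +
    (- psum (pseries_diffs (pseries_diffs c)) (- normsq z))%:C * (conjc (z j 0) * z k 0).
Proof.
move=> pc E zd zr; have z0 := normsq_ge0 z.
have r0 : 0 < Num.min rho d - normsq z by rewrite subr_gt0 lt_min zr.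
have N (x : R) : is_derive x 1 (fun t : R => - t) (- 1).
  exact: derN (der_id x).
have B (x : R) : `|x - normsq z| < Num.min rho d - normsq z -> `|x| < rho /\ x < d.
  move=> xr; have xm : `|x| < Num.min rho d.
    rewrite -(subrK (normsq z) x); apply: le_lt_trans (ler_normD _ _) _.
    by rewrite (ger0_norm z0) -ltrBrDr.
  move: xm; rewrite lt_min => /andP[h1 h2]; split => //.
  exact: le_lt_trans (ler_norm _) h2.
apply: (complex_hessian_radial (phi := fun x => - psum c (- x))
  (phi1 := fun x => psum (pseries_diffs c) (- x)) r0).
- move=> x /B[xr _]; have xr' : `|- x| < rho by rewrite normrN.
  by have := derN (der_comp (g := fun t => - t) (der_psum pc xr') (N x)); apply: der_eq => //; ring.
- have xr' : `|- normsq z| < rho by rewrite normrN ger0_norm.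
  by have := der_comp (g := fun t => - t) (der_psum (pconv_diffs pc) xr') (N _); apply: der_eq => //; ring.
apply: filterS (normsq_cont z r0) => w /B[_]; exact: E.
Qed.

Lemma radop_rotate (a b : R) z (c : R[i]) : c * conjc c = 1 -> radop a b (c *: z) = radop a b z.
Proof.
move=> c1; apply/funext => u; rewrite /radop hdotZr scalerA; congr (_ + _ *: _).
by rewrite -[in RHS](mul1r (hdot u z)) -c1; ring.
Qed.
End local_lemmas.

(** * A duality fixes the origin *)

Section preimage.
Variables (R : realType) (n : nat).
Implicit Types (u v z w : Cvec R n) (U M : set (Cvec R n)).

Lemma normsq_expi z (t : R) : normsq (expi t *: z) = normsq z.
Proof. by rewrite normsqZc expi_mul /= mul1r. Qed.

Lemma near_rotation z (N : set (Cvec R n)) : nbhs z N ->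
  exists2 t : R, 0 < t < pi & N (expi t *: z).
Proof.
move=> /nbhs_normsqP[d d0 Hd].
have D : is_derive (0 : R) 1 (fun t : R => 2 * normsq z * cos t) (2 * normsq z * - sin 0).
  exact: derZ (is_derive_cos 0).
have /continuousP_dist /(_ _ d0)[r r0 Hr] := der_cont D.
pose t := Num.min r pi / 2; have p0 : 0 < pi :> R by exact: pi_gt0.
have m0 : 0 < Num.min r pi by rewrite lt_min r0.
have t0 : 0 < t by rewrite divr_gt0.
have tm : t < Num.min r pi by rewrite ltr_pdivrMr // ltr_pMr // ltr1n.
have /andP[tr tp] : (t < r) && (t < pi) by rewrite -lt_min.
exists t; first by rewrite t0.
apply: Hd; have -> : expi t *: z - z = (expi t - 1) *: z by rewrite scalerBl scale1r.
have -> : normsq ((expi t - 1) *: z) = 2 * normsq z * cos 0 - 2 * normsq z * cos t.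
  rewrite normsqZc cos0 /expi /=; have := cos2Dsin2 t; rewrite !expr2 => H.
  have -> : 2 * normsq z * 1 - 2 * normsq z * cos t =
    (cos t * cos t + sin t * sin t) * normsq z + normsq z - 2 * normsq z * cos t by rewrite H; ring.
  by ring.
by apply: le_lt_trans (ler_norm _) _; rewrite distrC; apply: Hr; rewrite subr0 gtr0_norm.
Qed.

(** The operator at z1 is the same as at z2 = e^(it) z1. If Psi z1 = 0 then, by [duality_trace],
    Psi z2 = 0 as well for small t > 0, so z2 = z1 by injectivity, which forces z1 = 0. *)
Lemma preimage_zero M U (Phi Phi' : Cvec R n -> R) (Psi : Cvec R n -> Cvec R n) (f : R -> R)
    (c : nat -> R) (rho d eps lam : R) z1 :
  open M -> real_analytic M Phi -> (forall z, M z -> Phi z = f (normsq z)) ->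
  open U -> U `<=` M -> smooth_map U Psi ->
  (forall z z', U z -> U z' -> Psi z = Psi z' -> z = z') -> 0 < lam ->
  eq_form_on U (pullback Psi (@flat_form R n)) (scale_form lam (kahler_form Phi)) ->
  eq_form_on U (pullback Psi (scale_form lam (kahler_form Phi'))) (@flat_form R n) ->
  pconv c rho -> (forall z, normsq z < d -> Phi' z = - psum c (- normsq z)) ->
  0 < eps -> eps <= rho -> eps <= d ->
  (forall x x', `|x| < eps -> `|x'| < eps -> 0 <= x * x' ->
    n%:R * psum (pseries_diffs c) x + x * psum (pseries_diffs (pseries_diffs c)) x =
    n%:R * psum (pseries_diffs c) x' + x' * psum (pseries_diffs (pseries_diffs c)) x' -> x = x') ->
  U z1 -> Psi z1 = 0 -> z1 = 0.
Proof.
move=> oM an PhiE oU UM sm inj lam0 F1 F2 pc dualE eps0 er ed Tinj Uz1 Pz1.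
have l2 : lam ^+ 2 * 2 != 0 by rewrite gt_eqF // mulr_gt0 // exprn_gt0.
apply/eqP; apply: contraT => z10.
have [phi1 [phi2 [r [r0 D1 D2]]]] := radial_C2 oM an PhiE (UM _ Uz1) z10.
have NU : nbhs z1 (U `&` [set w | normsq (Psi w) < eps]).
  apply: filterI; first by apply: open_nbhs_nbhs.
  have /continuous_normsqP := normsq_map_continuous oU sm Uz1; rewrite Pz1 normsq0 => /(_ _ eps0)[e e0 He].
  by apply/nbhs_normsqP; exists e => // w /He; rewrite subr0 ger0_norm // normsq_ge0.
have [t /andP[t0 tpi] [Ut yt]] := near_rotation NU.
set z2 := expi t *: z1 in Ut yt.
have nz2 : normsq z2 = normsq z1 by exact: normsq_expi.
have H z : U z -> normsq z = normsq z1 -> normsq (Psi z) < eps ->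
    lam ^+ 2 * 2 * (n%:R * psum (pseries_diffs c) (- normsq (Psi z)) +
      - psum (pseries_diffs (pseries_diffs c)) (- normsq (Psi z)) * normsq (Psi z)) =
    \tr (invmx (mxR (radop (phi1 (normsq z1)) phi2 z))).
  move=> Uz nz yz.
  have h1 : forall x : R, `|x - normsq z| < r -> is_derive x 1 f (phi1 x) by rewrite nz.
  have h2 : is_derive (normsq z) 1 phi1 phi2 by rewrite nz.
  have hess := hessian_on oM PhiE (UM _ Uz) r0 h1 h2; rewrite nz in hess.
  have hess' := hessian_dual pc dualE (lt_le_trans yz ed) (lt_le_trans yz er).
  have Dl : rlinear (tangent_map Psi z) by move=> a b u v; exact: tangent_comb oU sm Uz.
  have e1 u v := (duality_E1 Psi lam u v hess).1 (F1 _ Uz u v).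
  have e2 u v := (duality_E2 lam u v hess').1 (F2 _ Uz u v).
  by have [_ <-] := duality_trace Dl e1 e2; rewrite mxtrace_radop -mulrA.
have y1 : normsq (Psi z1) < eps by rewrite Pz1 normsq0.
have := H _ Uz1 erefl y1; have := H _ Ut nz2 yt.
rewrite /z2 (radop_rotate _ _ _ (expi_mul t)) -/z2 => <- E.
have {}E := mulfI l2 E; rewrite Pz1 normsq0 in E.
have y2 : - normsq (Psi z2) = - 0.
  apply: Tinj; rewrite ?normrN ?normr0 ?ger0_norm ?normsq_ge0 //.
    by rewrite oppr0 mulr0.
  by move: E; rewrite oppr0 mul0r mulr0 addr0 => ->; ring.
have Pz2 : Psi z2 = Psi z1.
  by rewrite Pz1; apply/eqP; rewrite -normsq_eq0 -oppr_eq0 y2 oppr0.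
have /eqP := inj _ _ Ut Uz1 Pz2.
rewrite -subr_eq0 /z2 -[X in _ - X]scale1r -scalerBl scaler_eq0 (negbTE z10) orbF subr_eq0.
move=> /eqP /(congr1 (@complex.Im R)) /= /eqP.
by rewrite gt_eqF // sin_gt0_pi // t0 tpi.
Qed.
End preimage.

(** * Local form of a duality *)

Section structure.
Variables (R : realType) (n : nat).
Implicit Types (u v z w : Cvec R n) (U M : set (Cvec R n)).

Definition dpsum (c : nat -> R) := psum (pseries_diffs c).
Definition ddpsum (c : nat -> R) := psum (pseries_diffs (pseries_diffs c)).

Lemma positive_near (h : R -> R) (d : R) : is_derive (0 : R) 1 h d -> 0 < h 0 ->
  exists2 e, 0 < e & forall x, `|x| < e -> 0 < h x.
Proof.
move=> /der_cont /continuousP_dist H h0; have [r r0 Hr] := H _ h0; exists r => // x xr.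
by have := Hr x; rewrite subr0 => /(_ xr); rewrite ltr_norml => /andP[]; lra.
Qed.

(** The first two conditions hold near 0 by continuity; the last two because f'' and the
    derivative of n f' + x f'' are nonzero power series. *)
Lemma positivity_radius (c : nat -> R) (rho : R) (m : nat) : pconv c rho -> 0 < c 1%N ->
  pseries_diffs (pseries_diffs c) m != 0 ->
  exists eps, [/\ 0 < eps, eps <= rho,
    forall x, `|x| < eps -> [/\ 0 < dpsum c x, 0 < dpsum c x + x * ddpsum c x & x != 0 -> ddpsum c x != 0] &
    forall x x', `|x| < eps -> `|x'| < eps -> 0 <= x * x' ->
      n%:R * dpsum c x + x * ddpsum c x = n%:R * dpsum c x' + x' * ddpsum c x' -> x = x'].
Proof.
move=> pc c1 dm; have pd := pconv_diffs pc; have pdd := pconv_diffs pd; have rho0 := pc.1.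
have h0 : `|0 : R| < rho by rewrite normr0.
have p10 : 0 < dpsum c 0 by rewrite /dpsum (pconv_psum0 pd) /pseries_diffs mul1r.
have d1 : is_derive (0 : R) 1 (dpsum c) (ddpsum c 0) by exact: der_psum pd h0.
have [e1 e10 H1] := positive_near d1 p10.
have d2 := derD d1 (derM (der_id 0) (der_psum pdd h0)).
have [|e2 e20 H2] := positive_near d2; first by rewrite mul0r addr0.
have [e3 e30 H3] := psum_isolated_zero pdd dm.
pose tc k := n%:R * pseries_diffs c k + k%:R * pseries_diffs c k.
have pk : pconv (fun k => k%:R * pseries_diffs c k) rho by exact: pconv_unshift.
have ptc : pconv tc rho by exact: pconv_add (pconv_scale _ pd) pk.
have tcE x : `|x| < rho -> psum tc x = n%:R * dpsum c x + x * ddpsum c x.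
  move=> xr; rewrite (psum_add (pconv_scale _ pd) pk xr) (psum_scale _ pd xr).
  by rewrite (psum_mulx pdd xr).
have tcm : tc m.+1 != 0.
  rewrite /tc -mulrDl -natrD mulf_neq0 // ?pnatr_eq0 ?addnS //.
  by move: dm; rewrite {1}/pseries_diffs mulf_eq0 negb_or => /andP[].
have [e4 e40 [e4r H4]] := psum_one_sided_inj ptc tcm.
exists (Num.min (Num.min e1 e2) (Num.min e3 e4)); split.
- by rewrite !lt_min e10 e20 e30.
- by rewrite !ge_min e4r !orbT.
- move=> x; rewrite !lt_min => /andP[/andP[x1 x2] /andP[x3 x4]]; split.
  + exact: H1.
  + exact: H2.
  + by move=> x0; apply: H3 => //; rewrite normr_gt0.
- move=> x x'; rewrite !lt_min => /andP[_ /andP[_ x4]] /andP[_ /andP[_ x4']] s E.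
  apply: H4 => //; rewrite !tcE //; exact: lt_le_trans e4r.
Qed.

(** Psi 0 = 0 by [preimage_zero]; the rest is restriction to a ball that Psi maps into the
    domain of the dual series, where the results on dualities fixing the origin apply. *)
Lemma duality_structure M M' U U' (Phi Phi' : Cvec R n -> R) (Psi : Cvec R n -> Cvec R n) (f : R -> R)
    (c : nat -> R) (rho d eps lam : R) (j0 : 'I_n) :
  open M -> real_analytic M Phi -> (forall z, M z -> Phi z = f (normsq z)) ->
  pconv c rho -> (forall x, `|x| < rho -> f x = psum c x) ->
  (forall z, normsq z < d -> Phi' z = - psum c (- normsq z)) ->
  0 < d -> 0 < eps -> eps <= rho ->
  (forall x, `|x| < eps -> [/\ 0 < dpsum c x, 0 < dpsum c x + x * ddpsum c x & x != 0 -> ddpsum c x != 0]) ->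
  (forall x x', `|x| < eps -> `|x'| < eps -> 0 <= x * x' ->
      n%:R * dpsum c x + x * ddpsum c x = n%:R * dpsum c x' + x' * ddpsum c x' -> x = x') ->
  0 < lam ->
  symplectic_duality lam M (kahler_form Phi) M' (kahler_form Phi') U U' Psi ->
  exists (r : R) (q : Cvec R n -> R[i]) (A : 'M[R[i]]_n), [/\ 0 < r <= eps,
    A \is unitarymx,
    forall z, normsq z < r -> U z,
    Psi 0 = 0 /\ forall z, z != 0 -> normsq z < r ->
      [/\ Psi z = q z *: (A *m z), sqn (q z) = lam * dpsum c (normsq z) &
        forall z', normsq z = normsq z' -> q z = q z'] &
    lam ^+ 2 * dpsum c 0 ^+ 2 = 1 /\ forall x, 0 < x -> x < r ->
      let y := lam * x * dpsum c x in
      [/\ `|y| < eps & lam ^+ 2 * (dpsum c x + x * ddpsum c x) * (dpsum c (- y) + (- y) * ddpsum c (- y)) = 1]].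
Proof.
move=> oM an PhiE pc fE dualE d0 eps0 er prof Tinj lam0 [[oU U0 UM] [oU' U'0 _] [bij sm _] F1 F2].
pose eps' := Num.min eps d.
have eps'0 : 0 < eps' by rewrite lt_min eps0.
have e'e : eps' <= eps by rewrite ge_min lexx.
have e'd : eps' <= d by rewrite ge_min lexx orbT.
have inj z z' : U z -> U z' -> Psi z = Psi z' -> z = z'.
  have [_ I _] := bij; by move=> Uz Uz' E; apply: I; rewrite ?inE.
have Tinj' x x' : `|x| < eps' -> `|x'| < eps' -> 0 <= x * x' ->
    n%:R * dpsum c x + x * ddpsum c x = n%:R * dpsum c x' + x' * ddpsum c x' -> x = x'.
  by move=> h h'; apply: Tinj; [exact: lt_le_trans e'e | exact: lt_le_trans e'e].
have Psi0 : Psi 0 = 0.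
  have [_ _ S] := bij; have [z1 Uz1 Pz1] := S _ U'0.
  have z10 := preimage_zero oM an PhiE oU UM sm inj lam0 F1 F2 pc dualE eps'0 (le_trans e'e er) e'd Tinj' Uz1 Pz1.
  by rewrite z10 in Pz1.
have PhiE' z : M z -> normsq z < rho -> Phi z = psum c (normsq z).
  by move=> Mz zr; rewrite PhiE // fE // ger0_norm ?normsq_ge0.
have [delta delta0 ball] : exists2 delta : R, 0 < delta &
    forall z, normsq z < delta -> [/\ U z, normsq z < eps' & normsq (Psi z) < eps'].
  have [d2 d20 H2] := (openP U).1 oU _ U0.
  have /continuous_normsqP := normsq_map_continuous oU sm U0; rewrite Psi0 normsq0.
  move=> /(_ _ eps'0)[d3 d30 H3].
  exists (Num.min d2 (Num.min d3 eps')); first by rewrite !lt_min d20 d30 eps0 d0.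
  move=> z; rewrite lt_min [_ < Num.min d3 _]lt_min => /and3P[z2 z3 z4]; split=> //.
    by apply: H2; rewrite subr0.
  have H := H3 z; rewrite !subr0 ger0_norm ?normsq_ge0 // in H.
  exact: H z3.
have dpsum_der (x : R) : `|x| < eps' -> is_derive x 1 (dpsum c) (ddpsum c x).
  by move=> xe; apply: der_psum (pconv_diffs pc) _; exact: lt_le_trans (le_trans e'e er).
have prof' x : `|x| < eps' -> [/\ 0 < dpsum c x, 0 < dpsum c x + x * ddpsum c x & x != 0 -> ddpsum c x != 0].
  by move=> xe; apply: prof; exact: lt_le_trans e'e.
have f1p x : `|x| < eps' -> 0 < dpsum c x by move=> /prof'[].
have ep x : `|x| < eps' -> 0 < dpsum c x + x * ddpsum c x by move=> /prof'[].
have f2n x : `|x| < eps' -> x != 0 -> ddpsum c x != 0 by move=> /prof'[].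
have e1 z (zd : normsq z < delta) u v := (duality_E1 Psi lam u v
  (hessian_psum oM pc PhiE' (UM _ (let: And3 h _ _ := ball z zd in h))
   (lt_le_trans (let: And3 _ h _ := ball z zd in h) (le_trans e'e er)))).1
  (F1 _ (let: And3 h _ _ := ball z zd in h) u v).
have e2 z (zd : normsq z < delta) u v := (duality_E2 lam u v
  (hessian_dual pc dualE (lt_le_trans (let: And3 _ _ h := ball z zd in h) e'd)
   (lt_le_trans (let: And3 _ _ h := ball z zd in h) (le_trans e'e er)))).1
  (F2 _ (let: And3 h _ _ := ball z zd in h) u v).
have [d1 d10 [d1le mu1]] := mu_eq1 f1p ep Tinj' lam0 oU sm inj Psi0 delta0 ball e1 e2 j0.
have [S1 S2 S3 S4] := duality_near0 dpsum_der f1p ep f2n Tinj' lam0 oU sm inj Psi0 delta0 ball e1 e2 j0 d1le mu1.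
exists (Num.min d1 eps), (factor (dpsum c) lam Psi), (unitary_part (dpsum c) lam Psi); split => //.
- by rewrite lt_min d10 eps0 ge_min lexx orbT.
- by move=> z; rewrite lt_min => /andP[zd _]; have [] := ball z (lt_le_trans zd d1le).
- by split=> // z z0; rewrite lt_min => /andP[zd _]; exact: S2.
split=> // x x0; rewrite lt_min => /andP[xd _]; have [yl E] := S4 _ x0 xd; split => //.
exact: lt_le_trans e'e.
Qed.
End structure.

(** * The functional equation *)

Section relation.
Variable R : realType.

(** The hypothesis says that the derivative of y f'(- y) in x is 1 / lam, where y = lam x f'(x).
    Hence y f'(- y) = x / lam, which is the equation for x >= 0. A small x < 0 is - y(t) for
    some t > 0; the equation at t then gives - y(x) = t, and reads the same at x. *)
Lemma relation_near (c : nat -> R) (rho eps lam r : R) : pconv c rho -> eps <= rho ->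
  0 < r <= eps -> 0 < lam -> (forall x, `|x| < eps -> 0 < dpsum c x) ->
  lam ^+ 2 * dpsum c 0 ^+ 2 = 1 ->
  (forall x, 0 < x -> x < r -> let y := lam * x * dpsum c x in
    `|y| < eps /\ lam ^+ 2 * (dpsum c x + x * ddpsum c x) * (dpsum c (- y) + (- y) * ddpsum c (- y)) = 1) ->
  exists2 e, 0 < e & forall x, `|x| < e ->
    lam ^+ 2 * dpsum c x * dpsum c (- (lam * x * dpsum c x)) = 1.
Proof.
move=> pc er /andP[r0 re] lam0 pos H0 H.
pose a (x : R) : R := lam * x * dpsum c x.
have eps0 : 0 < eps by exact: lt_le_trans re.
have d1 (x : R) : `|x| < eps -> is_derive x 1 (dpsum c) (ddpsum c x).
  by move=> xe; apply: der_psum (pconv_diffs pc) _; exact: lt_le_trans er.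
have da (x : R) : `|x| < eps -> is_derive x 1 a (lam * (dpsum c x + x * ddpsum c x)).
  move=> /d1 D; have := derM (derZ lam (der_id x)) D.
  by apply: der_eq => //; ring.
have norm_pos x : 0 <= x -> x < r -> `|x| < eps.
  by move=> x0 xr; rewrite ger0_norm // (lt_le_trans xr).
have ay x : 0 <= x -> x < r -> `|- a x| < eps.
  rewrite le_eqVlt normrN => /predU1P[<- _|x0 xr]; first by rewrite /a mulr0 mul0r normr0.
  by have [] := H _ x0 xr.
have B x : 0 <= x -> x < r -> a x * dpsum c (- a x) = x / lam.
  move=> x0 xr; pose b (t : R) := a t * dpsum c (- a t) - t * lam^-1.
  have E : b 0 = b x.
    apply: cst_of_der0 => // t /andP[t0 tx]; have tr := le_lt_trans tx xr.
    have D1 := da _ (norm_pos _ t0 tr); have D2 := d1 _ (ay _ t0 tr).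
    have D3 := derM D1 (der_comp (g := fun t => - a t) D2 (derN D1)).
    have D4 := derB D3 (derM (der_id t) (der_cst t lam^-1)).
    apply: der_eq D4 => //.
    have K : lam * (dpsum c t + t * ddpsum c t) * (dpsum c (- a t) + (- a t) * ddpsum c (- a t)) = lam^-1.
      apply: (mulfI (lt0r_neq0 lam0)); rewrite mulfV ?gt_eqF // 2!mulrA -expr2.
      move: t0; rewrite le_eqVlt => /predU1P[<-|t0]; last by have [_] := H _ t0 tr.
      by rewrite /a mulr0 !mul0r oppr0 !mul0r !addr0 -mulrA -expr2.
    by rewrite mulr0 addr0 mul1r -{1}K; ring.
  move: E; rewrite /b [a 0]/a !mulr0 !mul0r subrr => /esym/eqP.
  by rewrite subr_eq0 => /eqP.
have rel x : 0 <= x -> x < r -> lam ^+ 2 * dpsum c x * dpsum c (- a x) = 1.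
  rewrite le_eqVlt => /predU1P[<- _|x0 xr].
    by rewrite /a mulr0 mul0r oppr0 -mulrA -expr2.
  have := B _ (ltW x0) xr => Bx.
  apply: (mulIf (lt0r_neq0 x0)); rewrite mul1r.
  have -> : lam ^+ 2 * dpsum c x * dpsum c (- a x) * x = lam * (a x * dpsum c (- a x)) by rewrite /a; ring.
  by rewrite Bx mulrC divfK // gt_eqF.
have r2 : 0 < r / 2 by rewrite divr_gt0.
have r2r : r / 2 < r by rewrite ltr_pdivrMr // ltr_pMr // ltr1n.
have A0 : 0 < a (r / 2).
  by rewrite /a !mulr_gt0 // pos // norm_pos // ltW.
exists (Num.min (r / 2) (a (r / 2))); first by rewrite lt_min r2.
move=> x; rewrite lt_min => /andP[x1 x2]; rewrite -/(a x).
have [x0|x0] := leP 0 x.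
  by apply: rel => //; rewrite ger0_norm // in x1; exact: lt_trans r2r.
rewrite ltr0_norm // in x2.
have C : {within `[0, r / 2], continuous a}.
  apply: continuous_in_subspaceT => t /set_mem; rewrite /= in_itv /= => /andP[t0 t1].
  by apply: der_cont (da _ (norm_pos _ t0 (le_lt_trans t1 r2r))).
have a00 : a 0 = 0 by rewrite /a mulr0 mul0r.
have [|t] := @IVT R a 0 (r / 2) (- x) (ltW r2) C.
  by rewrite a00 ge_min le_max oppr_ge0 (ltW x0) (ltW x2) orbT.
rewrite in_itv /= => /andP[t0 t1] at_; have tr := le_lt_trans t1 r2r.
have xE : x = - a t by rewrite at_ opprK.
have ax : - a x = t.
  have := B _ t0 tr; rewrite -xE at_ => Bt.
  have -> : - a x = lam * (- x * dpsum c x) by rewrite /a; ring.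
  by rewrite Bt mulrC divfK // gt_eqF.
by rewrite ax -[RHS](rel _ t0 tr) -xE; ring.
Qed.
End relation.

(** * Radial rescalings as dualities *)

Section radial_scaling.
Variables (R : realType) (n : nat).
Implicit Types (u v w z : Cvec R n).

Lemma tangent_radial_scale (s : R -> R) (s' : R) z u : is_derive (normsq z) 1 s s' ->
  tangent_map (fun z => (s (normsq z))%:C *: z) z u =
  (s (normsq z))%:C *: u + (2 * s' * complex.Re (hdot u z))%:C *: z.
Proof.
move=> ds; apply: tangent_eq.
have H1 := cder_real (der_radial u ds).
have H2 : vder (fun t : R => z + t%:C *: u) 0 u.
  have H := vder_comb z u (der_cst (0 : R) (1 : R)) (der_id (0 : R)).
  move=> j; apply: cder_eq (H j) => [t|]; first by rewrite !mxE mul1r.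
  by rewrite !mxE mul0r mul1r add0r.
have H := vderZ H1 H2; move=> j; apply: cder_eq (H j) => // .
rewrite scale0r addr0 addrC !mxE; congr (_ * _ + _ * _).
by rewrite hdotC ReJ; congr (_%:C); ring.
Qed.

(** The imaginary part of <u, z> conj <v, z>, which accompanies the second derivative of the
    profile in a radial form. *)
Definition radial_area u v z : R :=
  complex.Im (hdot u z) * complex.Re (hdot v z) - complex.Re (hdot u z) * complex.Im (hdot v z).

Lemma Im_radop (a b : R) z u v :
  complex.Im (hdot (radop a b z u) v) = a * complex.Im (hdot u v) + b * radial_area u v z.
Proof.
rewrite /radop hdotDl !hdotZl -mulrA ImD !ImZr (hdotC v z) ImM ReJ ImJ /radial_area.
by congr (_ + _ * _); ring.
Qed.

Lemma Im_radial_scale (s k : R) z u v :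
  complex.Im (hdot (s%:C *: u + (k * complex.Re (hdot u z))%:C *: z)
                   (s%:C *: v + (k * complex.Re (hdot v z))%:C *: z)) =
  s ^+ 2 * complex.Im (hdot u v) + s * k * radial_area u v z.
Proof.
rewrite !hdotDl !hdotDr !hdotZl !hdotZr_real hdot_normsq !ImD !ImZr (hdotC v z) ImJ /radial_area /=.
by ring.
Qed.

Lemma radial_area_scale (s k : R) z u v :
  let p u := s%:C *: u + (k * complex.Re (hdot u z))%:C *: z in
  radial_area (p u) (p v) (s%:C *: z) =
  s ^+ 2 * (s ^+ 2 + s * k * normsq z) * radial_area u v z.
Proof.
have H u' : hdot (s%:C *: u' + (k * complex.Re (hdot u' z))%:C *: z) (s%:C *: z) =
    s%:C * (s%:C * hdot u' z + (k * complex.Re (hdot u' z))%:C * (normsq z)%:C).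
  by rewrite hdotZr_real hdotDl !hdotZl hdot_normsq.
rewrite /radial_area !H; case: (hdot u z) (hdot v z) => [a1 a2] [b1 b2]; simpc => /=; ring.
Qed.
End radial_scaling.

Section converse.
Variables (R : realType) (n : nat).
Implicit Types (u v w z : Cvec R n) (M : set (Cvec R n)).

Lemma psum_opp (p : nat -> R) (y : R) : psum p (- y) = psum (fun k => (- 1) ^+ k * p k) y.
Proof.
rewrite /psum (_ : pseries p (- y) = pseries (fun k => (- 1) ^+ k * p k) y) //.
apply/funext => N; apply: eq_bigr => k _.
by rewrite /= -[- y]mulN1r exprMn mulrA [p k * _]mulrC.
Qed.

Lemma pconv_opp (p : nat -> R) rho : pconv p rho -> pconv (fun k => (- 1) ^+ k * p k) rho.
Proof.
move=> [r0 H]; split=> // r r1 r2; have [B HB] := H _ r1 r2; exists B => k.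
by rewrite normrM normrX normrN1 expr1n mul1r.
Qed.

(** The map is z |-> sqrt(lam f'(x)) z, with inverse w |-> sqrt(lam f'(- y)) w. The first form
    equation holds for every f. In the second one the coefficient of Im <u, v> is given by the
    functional equation, and the coefficient of [radial_area] by its derivative in x. *)
Lemma duality_converse M M' (Phi Phi' : Cvec R n -> R) (c : nat -> R) (rho d eps e0 lam : R) :
  open M -> M 0 -> open M' -> M' 0 ->
  (forall z, M z -> normsq z < rho -> Phi z = psum c (normsq z)) ->
  pconv c rho -> (forall z, normsq z < d -> Phi' z = - psum c (- normsq z)) -> 0 < d ->
  0 < eps -> eps <= rho -> (forall x, `|x| < eps -> 0 < dpsum c x /\ 0 < dpsum c x + x * ddpsum c x) ->
  0 < lam -> 0 < e0 ->
  (forall x, `|x| < e0 -> lam ^+ 2 * dpsum c x * dpsum c (- (lam * x * dpsum c x)) = 1) ->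
  exists U U' (Psi : Cvec R n -> Cvec R n),
    symplectic_duality lam M (kahler_form Phi) M' (kahler_form Phi') U U' Psi.
Proof.
move=> oM M0 oM' M'0 PhiE pc dualE d0 eps0 er pos lam0 e00 rel.
have pd := pconv_diffs pc.
have [p [r1 [pp r1r pE]]] : exists p r1, [/\ pconv p r1, r1 <= rho &
    forall x, `|x| < r1 -> 0 < dpsum c x /\ psum p x = Num.sqrt (lam * dpsum c x)].
  have [|p [r1 [h1 h2 h3]]] := sqrt_series (pconv_scale lam pd).
    rewrite mulr_gt0 //; have [] := pos 0 _; rewrite ?normr0 // /dpsum.
    by rewrite (pconv_psum0 pd).
  exists p, r1; split => // x xr; have [k1 k2] := h3 x xr.
  have E : psum (fun k => lam * pseries_diffs c k) x = lam * dpsum c x.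
    by rewrite (psum_scale _ pd) // (lt_le_trans xr).
  by rewrite E in k1 k2; split => //; rewrite -(pmulr_rgt0 _ lam0).
have [m1 m10 HM] := (openP M).1 oM _ M0.
have [m2 m20 HM'] := (openP M').1 oM' _ M'0.
have r10 := pp.1.
pose kp := Num.min (Num.min (Num.min eps e0) (Num.min r1 d)) (Num.min m1 m2).
have kp0 : 0 < kp by rewrite !lt_min eps0 e00 r10 d0 m10.
have kpB (x : R) : x < kp -> [/\ x < eps, x < e0 & x < r1] /\ [/\ x < d, x < m1 & x < m2].
  by rewrite /kp !lt_min => /andP[/andP[/andP[? ?] /andP[? ?]] /andP[? ?]]; split; split.
(* a x is the squared norm of the image of a point of squared norm x *)
pose s := psum p; pose a (x : R) : R := lam * x * dpsum c x.
have f1p (x : R) : `|x| < kp -> 0 < dpsum c x by move=> /kpB[[/pos[]]].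
have ep (x : R) : `|x| < kp -> 0 < dpsum c x + x * ddpsum c x by move=> /kpB[[/pos[]]].
have xrho (x : R) : `|x| < kp -> `|x| < rho by move=> /kpB[[h _ _] _]; exact: lt_le_trans er.
have sE (x : R) : `|x| < kp -> s x = Num.sqrt (lam * dpsum c x) by move=> /kpB[[_ _ /pE[]]].
have s_pos (x : R) : `|x| < kp -> 0 < s x by move=> xk; rewrite sE // sqrtr_gt0 mulr_gt0 // f1p.
have s2 (x : R) : `|x| < kp -> s x ^+ 2 = lam * dpsum c x.
  by move=> xk; rewrite sE // sqr_sqrtr // ltW // mulr_gt0 // f1p.
have relk (x : R) : `|x| < kp -> lam ^+ 2 * dpsum c x * dpsum c (- a x) = 1.
  by move=> /kpB[[_ h _] _]; exact: rel.
have d1 (x : R) : `|x| < kp -> is_derive x 1 (dpsum c) (ddpsum c x).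
  by move=> /xrho; exact: der_psum.
have da (x : R) : `|x| < kp -> is_derive x 1 a (lam * (dpsum c x + x * ddpsum c x)).
  by move=> /d1 D; have := derM (derZ lam (der_id x)) D; apply: der_eq => //; ring.
have ds (x : R) : `|x| < kp -> is_derive x 1 s (psum (pseries_diffs p) x).
  by move=> /kpB[[_ _ h] _]; exact: (der_psum pp h).
have nearkp (x : R) : `|x| < kp -> \forall t \near x, `|t| < kp.
  move=> xk; apply/nbhs_ballP; exists (kp - `|x|); first by rewrite /= subr_gt0.
  move=> t; rewrite /ball /= distrC => tx; rewrite -(subrK x t).
  by apply: le_lt_trans (ler_normD _ _) _; rewrite -ltrBrDr.
have ss' (x : R) : `|x| < kp -> s x * (2 * psum (pseries_diffs p) x) = lam * ddpsum c x.
  move=> xk; have H1 := derM (ds _ xk) (ds _ xk); have H2 := derZ lam (d1 _ xk).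
  have H3 : is_derive x 1 (fun t => lam * dpsum c t) (psum (pseries_diffs p) x * s x + s x * psum (pseries_diffs p) x).
    by apply: der_near H1; apply: filterS (nearkp _ xk) => t /s2 <-; rewrite expr2.
  by rewrite -(der_uniq H3 H2); ring.
have k00 : `|0 : R| < kp by rewrite normr0.
have a0 : a 0 = 0 by rewrite /a mulr0 mul0r.
have [r r0 [rk ak]] : exists2 r : R, 0 < r & r < kp /\ forall x, 0 <= x <= r -> a x < kp.
  have /continuousP_dist /(_ _ kp0)[q q0 Hq] := der_cont (da _ k00).
  pose m := Num.min q kp; have m0 : 0 < m by rewrite lt_min q0.
  have mm : m / 2 < m by rewrite ltr_pdivrMr // ltr_pMr // ltr1n.
  exists (m / 2); first by rewrite divr_gt0.
  split; first by apply: lt_le_trans mm _; rewrite ge_min lexx orbT.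
  move=> x /andP[x0 xm]; apply: le_lt_trans (ler_norm _) _.
  have := Hq x; rewrite a0 !subr0; apply; rewrite ger0_norm //.
  by apply: le_lt_trans xm _; apply: lt_le_trans mm _; rewrite ge_min lexx.
have xk (x : R) : 0 <= x -> x <= r -> `|x| < kp by move=> x0 xr; rewrite ger0_norm // (le_lt_trans xr).
have a_mono x x' : 0 <= x -> x < x' -> x' <= r -> a x < a x'.
  move=> x0 xx xr.
  have D t : x <= t <= x' -> is_derive t 1 a (lam * (dpsum c t + t * ddpsum c t)).
    by move=> /andP[t0 t1]; apply: da; apply: xk; [exact: le_trans t0 | exact: le_trans xr].
  have [t /andP[t0 t1] E] := MVTle (ltW xx) D.
  rewrite -subr_gt0 E mulr_gt0 ?subr_gt0 // mulr_gt0 // ep // xk //; first exact: le_trans t0.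
  exact: le_trans xr.
have a_ge0 x : 0 <= x -> x <= r -> 0 <= a x.
  by move=> x0 xr; rewrite !mulr_ge0 ?(ltW lam0) // ltW // f1p // xk.
have a_onto y : 0 <= y -> y < a r -> exists2 x, 0 <= x < r & a x = y.
  move=> y0 yr; have C : {within `[0, r], continuous a}.
    apply: continuous_in_subspaceT => t /set_mem; rewrite /= in_itv /= => /andP[t0 t1].
    by apply: der_cont (da _ (xk _ t0 t1)).
  have [|t] := @IVT R a 0 r y (ltW r0) C; first by rewrite a0 ge_min le_max y0 (ltW yr) orbT.
  rewrite in_itv /= => /andP[t0 t1] at_; exists t => //; rewrite t0 lt_neqAle t1 andbT.
  by apply/eqP => tr; rewrite -at_ tr ltxx in yr.
have sms (x : R) : 0 <= x -> x <= r -> s x * s (- a x) = 1.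
  move=> x0 xr; have ax : `|- a x| < kp by rewrite normrN ger0_norm ?a_ge0 // ak // x0.
  rewrite sE ?xk // sE // -sqrtrM ?mulr_ge0 ?(ltW lam0) ?(ltW (f1p _ _)) ?xk //.
  by rewrite mulrACA -expr2 mulrA relk ?xk // sqrtr1.
pose Psi z : Cvec R n := (s (normsq z))%:C *: z.
pose Theta w : Cvec R n := (psum (fun k => (- 1) ^+ k * p k) (normsq w))%:C *: w.
pose U := [set z : Cvec R n | normsq z < r]; pose U' := [set w : Cvec R n | normsq w < a r].
have nPsi z : normsq z < r -> normsq (Psi z) = a (normsq z).
  by move=> zr; rewrite normsqZ s2 ?xk ?normsq_ge0 ?ltW // /a; ring.
have PsiU z : U z -> U' (Psi z).
  by move=> zr; rewrite /U' /= nPsi // a_mono ?normsq_ge0.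
have TP z : U z -> Theta (Psi z) = z.
  move=> zr; rewrite /Theta -psum_opp nPsi // scalerA -rmorphM /= mulrC sms ?scale1r ?normsq_ge0 //.
  exact: ltW.
have PT w : U' w -> U (Theta w) /\ Psi (Theta w) = w.
  move=> wr; have [x /andP[x0 xr] ax] := a_onto _ (normsq_ge0 w) wr.
  have sx := sms _ x0 (ltW xr).
  have nT : normsq (Theta w) = x.
    rewrite normsqZ -psum_opp -ax -/s.
    have -> : s (- a x) ^+ 2 * a x = (s x * s (- a x)) ^+ 2 * x.
      by rewrite exprMn (s2 x (xk _ x0 (ltW xr))) /a; ring.
    by rewrite sx expr1n mul1r.
  split; first by rewrite /U /= nT.
  by rewrite /Psi nT /Theta -psum_opp -ax scalerA -rmorphM /= sx scale1r.
exists U, U', Psi.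
have oU : open U by exact: open_ball.
have oU' : open U' by exact: open_ball.
have U_M z : U z -> [/\ M z, normsq z < rho & `|normsq z| < kp].
  move=> zr; have zk : `|normsq z| < kp by apply: xk; rewrite ?normsq_ge0 // ltW.
  split => //; last by have := xrho _ zk; rewrite ger0_norm ?normsq_ge0.
  by apply: HM; rewrite subr0; move: zk; rewrite ger0_norm ?normsq_ge0 // => /kpB[_ []].
have U'_kp w : U' w -> normsq w < kp.
  by move=> wr; apply: lt_trans wr _; apply: ak; rewrite ltW //=.
split.
- split => //; first by rewrite /U /= normsq0.
  by move=> z /U_M[].
- split => //; first by rewrite /U' /= normsq0 -a0 a_mono.
  by move=> w /U'_kp /kpB[_ [_ _ h]]; apply: HM'; rewrite subr0.
- split.
  + split.
    * by move=> z /PsiU.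
    * move=> z z' /set_mem Uz /set_mem Uz' E; by rewrite -(TP _ Uz) E TP.
    * by move=> w /PT[h1 h2]; exists (Theta w).
  + apply: (smooth_radial_scale oU pp) => z /U_M[_ _]; rewrite ger0_norm ?normsq_ge0 //.
    by move=> /kpB[[]].
  + exists Theta; split; last by move=> z /set_mem; exact: TP.
    by apply: (smooth_radial_scale oU' (pconv_opp pp)) => w /U'_kp /kpB[[]].
- move=> z Uz u v; have [Mz zr zk] := U_M _ Uz.
  apply: (duality_E1 Psi lam u v (hessian_psum oM pc PhiE Mz zr)).2.
  rewrite !(tangent_radial_scale _ (ds _ zk)) Im_radial_scale Im_radop s2 // ss' //.
  by rewrite -/(dpsum c) -/(ddpsum c); ring.
- move=> z Uz u v; have [Mz zr zk] := U_M _ Uz.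
  have wk := U'_kp _ (PsiU _ Uz); have [[weps _ _] [wd _ _]] := kpB _ wk.
  apply: (duality_E2 lam u v (hessian_dual pc dualE wd (lt_le_trans weps er))).2.
  rewrite !(tangent_radial_scale _ (ds _ zk)) Im_radop Im_radial_scale.
  rewrite (radial_area_scale _ _ _ u v) nPsi // s2 // ss' // -/(dpsum c) -/(ddpsum c).
  set x := normsq z in zk *.
  have akx : `|- a x| < kp by rewrite normrN ger0_norm ?a_ge0 ?normsq_ge0 ?ltW // -nPsi.
  have Z : ddpsum c x * dpsum c (- a x) - dpsum c x * ddpsum c (- a x) * (lam * (dpsum c x + x * ddpsum c x)) = 0.
    have H1 := derM (derZ (lam ^+ 2) (d1 _ zk)) (der_comp (g := fun t => - a t) (d1 _ akx) (derN (da _ zk))).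
    have H2 : is_derive x 1 (fun t => lam ^+ 2 * dpsum c t * dpsum c (- a t)) 0.
      apply: der_near (der_cst x 1); apply: filterS (nearkp _ zk) => t tk; by rewrite relk.
    have := der_uniq H1 H2; have l2 : lam ^+ 2 != 0 by rewrite gt_eqF // exprn_gt0.
    move=> E; apply: (mulfI l2); rewrite mulr0 -E; ring.
  have rx := relk _ zk.
  set A := complex.Im _; set K := radial_area _ _ _.
  transitivity (lam ^+ 2 * dpsum c x * dpsum c (- a x) * A +
    lam ^+ 2 * (ddpsum c x * dpsum c (- a x) - dpsum c x * ddpsum c (- a x) * (lam * (dpsum c x + x * ddpsum c x))) * K).
    by ring.
  by rewrite rx Z mulr0 mul0r addr0 mul1r.
Qed.
End converse.

(** * Phases, non-flatness and the theorem *)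

Section setup.
Variables (R : realType) (n : nat).
Implicit Types (u v w z : Cvec R n) (M : set (Cvec R n)).

Lemma unit_arg (c : R[i]) : sqn c = 1 -> exists t, expi t = c.
Proof.
case: c => a b; rewrite /sqn /= => ab.
have aB : -1 <= a <= 1.
  by rewrite -ler_norml -(ler_pXn2r (n := 2)) ?nnegrE // expr1n real_normK ?num_real // -ab lerDl sqr_ge0.
have sE : Num.sqrt (1 - a ^+ 2) = `|b| by rewrite -ab addrAC subrr add0r sqrtr_sqr.
have [b0|b0] := leP 0 b.
  exists (acos a); rewrite /expi acosK // sin_acos // sE ger0_norm //.
exists (- acos a); rewrite /expi cosN sinN acosK // sin_acos // sE ltr0_norm // opprK //.
Qed.

Definition flat_somewhere M (Phi : Cvec R n -> R) := exists (W : set (Cvec R n)) (c : R),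
  [/\ open W, W !=set0, W `<=` M &
      eq_form_on W (kahler_form Phi) (scale_form c (@flat_form R n))].

(** In dimension 0 both forms vanish. *)
Lemma nonflat_dim M (Phi : Cvec R n -> R) : open M -> M 0 -> ~ flat_somewhere M Phi -> inhabited 'I_n.
Proof.
move=> oM M0 nf; case: (posnP n) => [n0|n0]; last by split; exact: Ordinal n0.
exfalso; apply: nf; exists M, 0; split => //; first by exists 0.
move=> z _ u v; rewrite /kahler_form /scale_form mul0r big1 ?mulr0 // => j _.
by have := ltn_ord j; rewrite [X in (_ < X)%N]n0.
Qed.

(** If f'' vanished identically, omega would be f'(0) times the flat form near 0. *)
Lemma nonflat_coef M (Phi : Cvec R n -> R) c rho :
  open M -> M 0 -> pconv c rho ->
  (forall z, M z -> normsq z < rho -> Phi z = psum c (normsq z)) ->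
  ~ flat_somewhere M Phi -> exists m, pseries_diffs (pseries_diffs c) m != 0.
Proof.
move=> oM M0 pc PhiE nf; apply: contrapT => H; apply: nf.
have dd k : pseries_diffs (pseries_diffs c) k = 0.
  by apply/eqP; apply: contrapT => /negP h; apply: H; exists k.
have pdd := pconv_diffs (pconv_diffs pc).
have P2 x : `|x| < rho -> ddpsum c x = 0.
  move=> xr; rewrite /ddpsum; have := psum_scale 0 pdd xr; rewrite mul0r => <-.
  by congr (psum _ x); apply/funext => k; rewrite mul0r dd.
have P1 x : 0 <= x -> x < rho -> dpsum c x = dpsum c 0.
  move=> x0 xr; apply/esym/cst_of_der0 => // t /andP[t0 tx].
  have tr : `|t| < rho by rewrite ger0_norm // (le_lt_trans tx).
  by rewrite -(P2 t tr); apply: der_psum (pconv_diffs pc) tr.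
have [m m0 Hm] := (openP M).1 oM _ M0.
exists [set z | normsq z < Num.min m rho], (dpsum c 0); split.
- exact: open_ball.
- by exists 0; rewrite /= normsq0 lt_min m0 pc.1.
- by move=> z; rewrite /= lt_min => /andP[zm _]; apply: Hm; rewrite subr0.
move=> z; rewrite /= lt_min => /andP[zm zr] u v; have z0 := normsq_ge0 z.
have Mz : M z by apply: Hm; rewrite subr0.
rewrite (kahler_form_radial _ _ (hessian_psum oM pc PhiE Mz zr)) -/(dpsum c _) -/(ddpsum c _).
rewrite P1 // P2 ?ger0_norm // mul0r addr0 /scale_form flat_formE -rmorphM /=.
by rewrite ImZr mulrN.
Qed.

(** The Levi form at 0 takes the value f'(0) on a basis vector. *)
Lemma psh_coef M (Phi : Cvec R n -> R) c rho (j0 : 'I_n) :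
  open M -> M 0 -> pconv c rho ->
  (forall z, M z -> normsq z < rho -> Phi z = psum c (normsq z)) ->
  strictly_psh M Phi -> 0 < c 1%N.
Proof.
move=> oM M0 pc PhiE psh.
have b0 : basis_vec R j0 != 0 by rewrite -normsq_eq0 normsq_basis oner_neq0.
have := psh 0 M0 _ b0.
have E := levi_radial (basis_vec R j0) (basis_vec R j0) (hessian_psum oM pc PhiE M0 _).
rewrite normsq0 in E.
under eq_bigr do under eq_bigr do rewrite -mulrA.
rewrite E ?pc.1 // hdot_normsq normsq_basis mulr1.
have -> : hdot (basis_vec R j0) (0 : Cvec R n) = 0 by rewrite hdotC hdot0l rmorph0.
rewrite mul0r mulr0 addr0 (pconv_psum0 (pconv_diffs pc)) /pseries_diffs mul1r.
by rewrite ltcR.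
Qed.

Lemma local_profile M (Phi : Cvec R n -> R) f M' (Phi' : Cvec R n -> R) :
  complex_domain M -> M 0 -> kahler_potential M Phi -> associated_function M Phi f ->
  local_dual Phi M' Phi' -> ~ flat_somewhere M Phi ->
  exists (j0 : 'I_n) (c : nat -> R) (rho d : R),
  [/\ pconv c rho, forall x, `|x| < rho -> f x = psum c x,
      0 < d, forall z, normsq z < d -> Phi' z = - psum c (- normsq z) &
      0 < c 1%N /\ exists m, pseries_diffs (pseries_diffs c) m != 0].
Proof.
move=> [oM _] M0 [an psh] [PhiE anf] [_ _ _ [a Ha]] nf.
have [j0] := nonflat_dim oM M0 nf.
have [c [rho [pc fE]]] := analytic_psum anf.
have PE z : M z -> normsq z < rho -> Phi z = psum c (normsq z).
  by move=> Mz zr; rewrite PhiE // fE // ger0_norm ?normsq_ge0.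
have nPhi : \forall z \near (0 : Cvec R n), Phi z = f (normsq z).
  have : \forall z \near (0 : Cvec R n), M z by apply: open_nbhs_nbhs.
  by apply: filterS => w; exact: PhiE.
have /nbhs_normsqP[d d0 Hd] := dual_radial nPhi anf Ha.
exists j0, c, rho, (Num.min d rho); split => //.
- by rewrite lt_min d0 pc.1.
- move=> z; rewrite lt_min => /andP[zd zr]; rewrite (Hd z) ?subr0 // fE // normrN.
  by rewrite ger0_norm ?normsq_ge0.
- by split; [exact: (psh_coef j0 oM M0 pc PE psh) | exact: nonflat_coef oM M0 pc PE nf].
Qed.

Lemma derive1_psum (f : R -> R) c rho x : pconv c rho -> (forall x, `|x| < rho -> f x = psum c x) ->
  `|x| < rho -> derive1 f x = dpsum c x.
Proof.
move=> pc fE xr; apply: der_derive1; apply: der_near (der_psum pc xr).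
apply/nbhs_ballP; exists (rho - `|x|); first by rewrite /= subr_gt0.
move=> t; rewrite /ball /= distrC => tx; rewrite fE // -(subrK x t).
by apply: le_lt_trans (ler_normD _ _) _; rewrite -ltrBrDr.
Qed.

Lemma relation_derive1 (f : R -> R) c rho lam : pconv c rho ->
  (forall x, `|x| < rho -> f x = psum c x) ->
  \forall x \near (0 : R), lam ^+ 2 * dpsum c x * dpsum c (- (lam * x * dpsum c x)) =
    lam ^+ 2 * derive1 f x * derive1 f (- lam * x * derive1 f x).
Proof.
move=> pc fE; have r0 := pc.1; have h0 : `|0 : R| < rho by rewrite normr0.
have D := derM (derZ lam (der_id 0)) (der_psum (pconv_diffs pc) h0).
have /continuousP_dist /(_ _ r0)[e e0 He] := der_cont D.
apply/nbhs_ballP; exists (Num.min e rho); first by rewrite /= lt_min e0.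
move=> x; rewrite /ball /= sub0r normrN lt_min => /andP[xe xr].
have := He x; rewrite mulr0 mul0r !subr0 => /(_ xe) h.
by rewrite (derive1_psum pc fE xr) !mulNr (derive1_psum pc fE) ?normrN.
Qed.

(** g z is chosen as a function of q z and psi z only, which makes it radial. Its value at 0 is
    immaterial since Psi 0 = 0. *)
Lemma duality_polar (U : set (Cvec R n)) (Psi : Cvec R n -> Cvec R n)
    (q : Cvec R n -> R[i]) (A : 'M[R[i]]_n) (f : R -> R) (c : nat -> R) (rho r lam : R) :
  pconv c rho -> (forall x, `|x| < rho -> f x = psum c x) -> 0 < lam -> 0 < c 1%N -> 0 < r ->
  (forall z, normsq z < r -> U z) -> A \is unitarymx -> Psi 0 = 0 ->
  (forall z, z != 0 -> normsq z < r ->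
      [/\ Psi z = q z *: (A *m z), sqn (q z) = lam * dpsum c (normsq z) &
        forall z', normsq z = normsq z' -> q z = q z']) ->
  exists (V : set (Cvec R n)) (g psi : Cvec R n -> R) (A : 'M[R[i]]_n),
       [/\ [/\ open V, V 0 & V `<=` U],
           radial V g,
           A \is unitarymx,
           [/\ radial V psi, real_analytic V psi &
               forall z, V z ->
                 0 <= lam * derive1 f (normsq z) /\
                 psi z = Num.sqrt (lam * derive1 f (normsq z))] &
           forall z, V z ->
             Psi z = (expi (g z) * (psi z)%:C) *: (A *m z)].
Proof.
move=> pc fE lam0 c1 r0 rU unA Psi0 H; have pd := pconv_diffs pc.
have [|p [r1 [pp r1r pE]]] := sqrt_series (pconv_scale lam pd).
  by rewrite mulr_gt0 // /pseries_diffs mul1r.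
pose psi z := Num.sqrt (lam * derive1 f (normsq z)).
have small z : normsq z < r1 -> [/\ derive1 f (normsq z) = dpsum c (normsq z),
    0 < lam * derive1 f (normsq z) & psi z = psum p (normsq z)].
  move=> zr; have zr' : `|normsq z| < r1 by rewrite ger0_norm ?normsq_ge0.
  have zrho := lt_le_trans zr' r1r; have [h1 h2] := pE _ zr'.
  have E := derive1_psum pc fE zrho.
  have S : psum (fun k => lam * pseries_diffs c k) (normsq z) = lam * dpsum c (normsq z).
    by rewrite (psum_scale _ pd).
  by rewrite S in h1 h2; split; rewrite /psi E.
pose V := [set z : Cvec R n | normsq z < Num.min r r1].
have VB z : V z -> normsq z < r /\ normsq z < r1 by rewrite /V /= lt_min => /andP[].
pose g z : R := if z == 0 then 0 else xget 0 [set t | expi t * (psi z)%:C = q z].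
exists V, g, psi, A; split => //.
- split; [exact: open_ball | by rewrite /V /= normsq0 lt_min r0 pp.1 |].
  by move=> z /VB[/rU].
- move=> z w /VB[zr _] /VB[wr _] E; rewrite /g -!normsq_eq0 -E.
  case: eqP => // /eqP z0; rewrite /psi -E; have z0' : z != 0 by rewrite -normsq_eq0.
  by have [_ _ /(_ _ E) ->] := H z z0' zr.
- split; first by move=> z w _ _ E; rewrite /psi E.
    move=> z0 Vz0; have [_ z0r] := VB _ Vz0; have [a Ha] := real_analytic_psum pp z0r.
    exists a; have NV : \forall z \near z0, V z by apply: open_nbhs_nbhs; split=> //; exact: open_ball.
    apply: filterS2 NV Ha => z /VB[_ /small[_ _ ->]] //.
  by move=> z /VB[_ /small[_ h _]]; split => //; exact: ltW.
- move=> z /VB[zr /small[E pos _]]; rewrite /g; case: eqP => [->|/eqP z0].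
    by rewrite Psi0 mulmx0 scaler0.
  have [-> sq _] := H z z0 zr; congr (_ *: _).
  have ps : 0 < psi z by rewrite sqrtr_gt0.
  have [t Ht] : exists t, expi t * (psi z)%:C = q z.
    have [|t Et] := @unit_arg (q z * ((psi z)^-1)%:C).
      have -> : sqn (q z * ((psi z)^-1)%:C) = sqn (q z) * (psi z)^-1 ^+ 2.
        by rewrite /sqn; case: (q z) => a b; simpc => /=; ring.
      by rewrite exprVn sq -E -(sqr_sqrtr (ltW pos)) divff // gt_eqF // exprn_gt0.
    exists t; rewrite Et -mulrA -rmorphM /= mulVf ?mulr1 // gt_eqF //.
  by have /= := @xgetPex _ 0 [set t | expi t * (psi z)%:C = q z] (ex_intro _ t Ht).
Qed.
End setup.

Theorem theorem1p6 (R : realType) (n : nat)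
    (M : set (Cvec R n)) (Phi : Cvec R n -> R) (f : R -> R)
    (M' : set (Cvec R n)) (Phi' : Cvec R n -> R) (lambda : R)
    (domM : complex_domain M) (M0 : M 0)
    (kahlerPhi : kahler_potential M Phi) (radialPhi : radial M Phi)
    (assocf : associated_function M Phi f)
    (dualPhi : local_dual Phi M' Phi')
    (nonflat : ~ exists (W : set (Cvec R n)) (c : R),
       [/\ open W, W !=set0, W `<=` M &
           eq_form_on W (kahler_form Phi) (scale_form c (@flat_form R n))])
    (lambda_gt0 : 0 < lambda) :
  (forall (U U' : set (Cvec R n)) (Psi : Cvec R n -> Cvec R n),
     symplectic_duality lambda M (kahler_form Phi) M' (kahler_form Phi')
       U U' Psi ->
     exists (V : set (Cvec R n)) (g psi : Cvec R n -> R) (A : 'M[R[i]]_n),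
       [/\ [/\ open V, V 0 & V `<=` U],
           radial V g,
           A \is unitarymx,
           [/\ radial V psi, real_analytic V psi &
               forall z, V z ->
                 0 <= lambda * derive1 f (normsq z) /\
                 psi z = Num.sqrt (lambda * derive1 f (normsq z))] &
           forall z, V z ->
             Psi z = (expi (g z) * (psi z)%:C) *: (A *m z)]) /\
  ((exists (U U' : set (Cvec R n)) (Psi : Cvec R n -> Cvec R n),
      symplectic_duality lambda M (kahler_form Phi) M' (kahler_form Phi')
        U U' Psi) <->
   (\forall x \near (0 : R),
      lambda ^+ 2 * derive1 f x * derive1 f (- lambda * x * derive1 f x) = 1)).
Proof.
have [j0 [c [rho [d [pc fE d0 dualE [c1 [m dm]]]]]]] :=
  local_profile domM M0 kahlerPhi assocf dualPhi nonflat.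
have [eps [eps0 er prof Tinj]] := positivity_radius n pc c1 dm.
have [oM _] := domM; have [an _] := kahlerPhi; have [PhiE _] := assocf.
have [[oM' _] M'0 _ _] := dualPhi.
have structure U U' Psi := @duality_structure R n M M' U U' Phi Phi' Psi f c rho d eps lambda j0
  oM an PhiE pc fE dualE d0 eps0 er prof Tinj lambda_gt0.
have rel := relation_derive1 lambda pc fE.
split; last split.
- move=> U U' Psi /structure[r [q [A [/andP[r0 _] unA rU [Psi0 H] _]]]].
  exact: (duality_polar pc fE lambda_gt0 c1 r0 rU unA Psi0 H).
- move=> [U [U' [Psi /structure[r [q [A [rB _ _ _ [H0 H]]]]]]]].
  have [||e e0 He] := relation_near pc er rB lambda_gt0 _ H0 _.
  + by move=> x /prof[].
  + by move=> x x0 xr; have [h1 h2] := H x x0 xr.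
  have : \forall x \near (0 : R), `|x| < e.
    by apply/nbhs_ballP; exists e => //= x; rewrite /ball /= sub0r normrN.
  by apply: filterS2 rel => x <- /He.
- move=> near1.
  have /nbhs_ballP[e /= e0 He] : \forall x \near (0 : R),
      lambda ^+ 2 * dpsum c x * dpsum c (- (lambda * x * dpsum c x)) = 1.
    by apply: filterS2 rel near1 => x ->.
  apply: (duality_converse oM M0 oM' M'0 _ pc dualE d0 eps0 er _ lambda_gt0 e0).
  + by move=> z Mz zr; rewrite PhiE // fE // ger0_norm ?normsq_ge0.
  + by move=> x /prof[].
  + by move=> x xe; apply: He; rewrite /ball /= sub0r normrN.
Qed.
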